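(* Let $n\ge1$, $s>0$, $\sigma>0$, $\omega\in\mathbb R$, and let $\phi\in H^s(\mathbb R^n)\cap C(\mathbb R^n)$, $\phi\not\equiv 0$, be a weak solution of $$(-\Delta)^s \phi+\omega \phi - |\phi(0)|^{2\sigma} \phi(0)\, \delta_0=0.$$ Then either $\omega>0$ and $s>\frac n2$, or $\omega<0$ and $s<\frac n2$.
   Context: Fourier transform: $\hat f(\xi)=\int_{\mathbb R^n} f(x)e^{-2\pi i x\cdot\xi}dx$; $\widehat{(-\Delta)^s f}(\xi)=(2\pi|\xi|)^{2s}\hat f(\xi)$. $\delta_0$ is the Dirac mass at the origin. A real-valued $\phi\in H^s(\mathbb R^n)\cap C(\mathbb R^n)$ is a weak solution if $\langle(-\Delta)^{s/2}\phi,(-\Delta)^{s/2}\psi\rangle+\omega\langle\phi,\psi\rangle-|\phi(0)|^{2\sigma}\phi(0)\psi(0)=0$ for all test functions $\psi$, where $\langle f,g\rangle=\int_{\mathbb R^n} fg\,dx$. *)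

(* Defs.v *)
From HB Require Import structures.
From mathcomp Require Import all_boot all_order all_algebra.
From mathcomp Require Import all_classical all_reals all_analysis.
From mathcomp.real_closed Require Import complex.

Set Implicit Arguments.
Unset Strict Implicit.
Unset Printing Implicit Defensive.

Import Order.TTheory GRing.Theory Num.Theory.
Import numFieldNormedType.Exports.

Local Open Scope classical_set_scope.
Local Open Scope ring_scope.

(* R^n is 'rV[R]_n with the sigma-algebra generated by the coordinates, i.e.
   the Borel sigma-algebra (compare the library's instance on tuples). *)
Section measurable_rV.
Variables (R : realType) (n : nat).

Let coors (i : 'I_n) (x : 'rV[R]_n) : R := x ord0 i.

Let rV_set0 : g_sigma_preimage coors set0.
Proof. exact: sigma_algebra0. Qed.

Let rV_setC A : g_sigma_preimage coors A -> g_sigma_preimage coors (~` A).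
Proof. exact: sigma_algebraC. Qed.

Let rV_bigcup (F : (set 'rV[R]_n)^nat) :
  (forall i, g_sigma_preimage coors (F i)) ->
  g_sigma_preimage coors (\bigcup_i (F i)).
Proof. exact: sigma_algebra_bigcup. Qed.

HB.instance Definition _ := @isMeasurable.Build default_measure_display
  'rV[R]_n (g_sigma_preimage coors) rV_set0 rV_setC rV_bigcup.

Lemma measurable_coord (i : 'I_n) :
  measurable_fun [set: 'rV[R]_n] (fun x : 'rV[R]_n => x ord0 i).
Proof.
move=> _ Y mY; rewrite setTI; apply: sub_sigma_algebra => /=.
rewrite -bigcup_seq/=; exists i => /=; first by rewrite mem_index_enum.
by exists Y => //; rewrite setTI.
Qed.

Lemma measurable_rV_box (A : 'I_n -> set R) :
  (forall i, measurable (A i)) ->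
  measurable [set v : 'rV[R]_n | forall i, A i (v ord0 i)].
Proof.
move=> mA.
rewrite (_ : [set _ | _] =
    \bigcap_(i in [set: 'I_n]) [set v : 'rV[R]_n | A i (v ord0 i)]).
  apply: fin_bigcap_measurable => // i _; rewrite -[X in measurable X]setTI.
  exact: measurable_coord.
by apply/seteqP; split=> [v H i _|v H i]; exact: H.
Qed.

Lemma measurable_fun_rVP d (T : measurableType d) (f : T -> 'rV[R]_n) :
  measurable_fun [set: T] f <->
  forall i, measurable_fun [set: T] (fun t => f t ord0 i).
Proof.
split=> [mf i|mf].
  exact: (measurableT_comp (measurable_coord i) mf).
have sub : g_sigma_preimage (fun i t => f t ord0 i) `<=` @measurable _ T.
  apply: smallest_sub; first exact: sigma_algebra_measurable.
  rewrite -bigcup_seq => A [i _] [B mB <-]; exact: mf.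
move=> _ A mA; rewrite setTI; apply: sub.
suff -> : g_sigma_preimage (fun i t => f t ord0 i) =
  preimage_set_system [set: T] f (g_sigma_preimage coors).
  by exists A => //; rewrite setTI.
exact: (@g_sigma_preimage_comp _ R n 'rV[R]_n coors T f).
Qed.

End measurable_rV.

Section cons_rV.
Variable R : realType.

Definition cons_rV n (p : measurableTypeR R * 'rV[R]_n) : 'rV[R]_n.+1 := row_mx p.1%:M p.2.

Lemma cons_rV0 n (p : measurableTypeR R * 'rV[R]_n) : cons_rV p ord0 ord0 = p.1.
Proof.
have -> : ord0 = lshift n ord0 :> 'I_(1 + n) by apply/val_inj.
by apply: etrans (row_mxEl _ _ _ _) _; rewrite mxE eqxx.
Qed.

Lemma cons_rVS n (p : measurableTypeR R * 'rV[R]_n) (i : 'I_n) :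
  cons_rV p ord0 (lift ord0 i) = p.2 ord0 i.
Proof. by rewrite -rshift1; exact: row_mxEr. Qed.

Lemma measurable_cons_rV n : measurable_fun setT (@cons_rV n).
Proof.
apply/measurable_fun_rVP => i; case: (unliftP ord0 i) => [j|] ->.
  apply: (eq_measurable_fun (fun p : measurableTypeR R * 'rV[R]_n => p.2 ord0 j)).
    by move=> p _; rewrite cons_rVS.
  exact: (measurableT_comp (measurable_coord j) measurable_snd).
apply: (eq_measurable_fun (@fst (measurableTypeR R) 'rV[R]_n)); last exact: measurable_fst.
by move=> p _; rewrite cons_rV0.
Qed.

Definition uncons_rV n (v : 'rV[R]_n.+1) : measurableTypeR R * 'rV[R]_n :=
  (v ord0 ord0, \row_i v ord0 (lift ord0 i)).

Lemma cons_rVK n : cancel (@cons_rV n) (@uncons_rV n).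
Proof.
move=> [x v]; rewrite /uncons_rV cons_rV0; congr pair.
by apply/rowP => i; rewrite mxE cons_rVS.
Qed.

Lemma uncons_rVK n : cancel (@uncons_rV n) (@cons_rV n).
Proof.
move=> v; apply/rowP => i; case: (unliftP ord0 i) => [j|] ->.
  by rewrite cons_rVS mxE.
by rewrite cons_rV0.
Qed.

Lemma measurable_uncons_rV n : measurable_fun setT (@uncons_rV n).
Proof.
apply: measurable_fun_pair; first exact: measurable_coord.
apply/measurable_fun_rVP => i.
apply: (eq_measurable_fun (fun v : 'rV[R]_n.+1 => v ord0 (lift ord0 i))).
  by move=> v _; rewrite mxE.
exact: measurable_coord.
Qed.

End cons_rV.

Section lebesgue_step.
Variables (R : realType) (n : nat).
Variable mu : {sigma_finite_measure set 'rV[R]_n -> \bar R}.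

Let prod : {measure set (measurableTypeR R * 'rV[R]_n) -> \bar R} := (lebesgue_measure \x mu)%E.

Definition lebesgue_step : set 'rV[R]_n.+1 -> \bar R :=
  pushforward (lebesgue_measure \x mu)%E (@cons_rV R n).

Let lebesgue_step0 : lebesgue_step set0 = 0%E.
Proof. by rewrite /lebesgue_step /pushforward preimage_set0 measure0. Qed.

Let lebesgue_step_ge0 A : (0 <= lebesgue_step A)%E.
Proof. exact: (measure_ge0 prod). Qed.

Let lebesgue_step_additive : semi_sigma_additive lebesgue_step.
Proof.
move=> F mF tF mUF; rewrite /lebesgue_step /pushforward preimage_bigcup.
have mpre A : measurable A -> measurable (@cons_rV R n @^-1` A).
  by move=> mA; rewrite -[X in measurable X]setTI; exact: measurable_cons_rV.
apply: (@measure_semi_sigma_additive _ _ _ prod (fun k => @cons_rV R n @^-1` F k)).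
- by move=> k; apply: mpre; exact: mF.
- apply/trivIsetP => /= i j _ _ ij; rewrite -preimage_setI.
  by move/trivIsetP : tF => /(_ _ _ _ _ ij) ->//; rewrite preimage_set0.
- by rewrite -preimage_bigcup; exact: mpre.
Qed.

HB.instance Definition _ := isMeasure.Build _ _ _ lebesgue_step
  lebesgue_step0 lebesgue_step_ge0 lebesgue_step_additive.

Let lebesgue_step_sigma_finite : sigma_finite setT lebesgue_step.
Proof.
have /sigma_finiteP[F [TF ndF Foo]] := sigma_finiteT (@lebesgue_measure R).
have /sigma_finiteP[G [TG ndG Goo]] := sigma_finiteT mu.
have FGT : \bigcup_k (F k `*` G k) = setT.
  rewrite -setXTT TF TG predeqE => -[x y]; split.
    by move=> [k _ []/= ? ?]; split; exists k.
  move=> [/= [k _ Fkx] [l _ Gly]]; exists (maxn k l) => //; split.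
  - by move: x Fkx; exact/subsetPset/ndF/leq_maxl.
  - by move: y Gly; exact/subsetPset/ndG/leq_maxr.
exists (fun k => @uncons_rV R n @^-1` (F k `*` G k)).
  by rewrite -preimage_bigcup FGT preimage_setT.
move=> k; have [mF Fk] := Foo k; have [mG Gk] := Goo k; split.
  rewrite -[X in measurable X]setTI; apply: measurable_uncons_rV => //.
  exact: measurableX.
rewrite /lebesgue_step /pushforward -comp_preimage.
rewrite (_ : _ \o _ = id); last by apply/funext => x /=; rewrite cons_rVK.
rewrite preimage_id.
by rewrite product_measure1E// lte_mul_pinfty// ge0_fin_numE.
Qed.

HB.instance Definition _ := Measure_isSigmaFinite.Build _ _ _ lebesgue_step
  lebesgue_step_sigma_finite.

End lebesgue_step.

Fixpoint lebesgue_rV (R : realType) (n : nat) :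
    {sigma_finite_measure set 'rV[R]_n -> \bar R} :=
  match n with
  | 0 => \d_(0 : 'rV[R]_0)
  | m.+1 => lebesgue_step (lebesgue_rV R m)
  end.

Lemma lebesgue_rV_box (R : realType) (n : nat) (A : 'I_n -> set R) :
  (forall i, measurable (A i)) ->
  lebesgue_rV R n [set v | forall i, A i (v ord0 i)] =
  (\prod_(i < n) lebesgue_measure (A i))%E.
Proof.
elim: n A => [|n IHn] A mA.
  by rewrite big_ord0 /= diracE mem_set//; case.
rewrite big_ord_recl /= /lebesgue_step /pushforward.
rewrite -IHn; last by move=> i; exact: mA.
have -> : @cons_rV R n @^-1` [set v : 'rV[R]_n.+1 | forall i, A i (v ord0 i)] =
    A ord0 `*` [set v : 'rV[R]_n | forall i, A (lift ord0 i) (v ord0 i)].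
  rewrite predeqE => -[x v]; split=> /= [H|[A0 AS] i].
    by split=> [|i]; [have := H ord0; rewrite cons_rV0|
                      have := H (lift ord0 i); rewrite cons_rVS].
  by case: (unliftP ord0 i) => [j|] ->; rewrite (cons_rVS, cons_rV0).
apply: product_measure1E; first exact: mA.
exact: (@measurable_rV_box R n (fun i => A (lift ord0 i)) (fun i => mA _)).
Qed.

(* The norm of the library on 'rV[R]_n is the sup norm. *)
Definition dot (R : realType) (n : nat) (x y : 'rV[R]_n) : R :=
  \sum_(i < n) x ord0 i * y ord0 i.

Definition enorm (R : realType) (n : nat) (x : 'rV[R]_n) : R :=
  Num.sqrt (dot x x).

Section fourier.
Variables (R : realType) (n : nat).
Let mu := lebesgue_rV R n.

Definition L2 (f : 'rV[R]_n -> R) : Prop := f \in Lfun mu 2%:E.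

Definition L2C (F : 'rV[R]_n -> R[i]) : Prop :=
  L2 (fun xi => complex.Re (F xi)) /\ L2 (fun xi => complex.Im (F xi)).

(* Integral of f(x) e^{-2 pi i x.xi} for real-valued f, with the exponential
   split into its real and imaginary parts; meaningful for integrable f. *)
Definition fourier (f : 'rV[R]_n -> R) (xi : 'rV[R]_n) : R[i] :=
  (\int[mu]_x (f x * cos (2 * pi * dot x xi)) -i*
   \int[mu]_x (f x * sin (2 * pi * dot x xi)))%C.

Definition truncate (f : 'rV[R]_n -> R) (r : R) (x : 'rV[R]_n) : R :=
  f x * \1_[set y | enorm y <= r] x.

(* F is a representative of the Fourier-Plancherel transform of the real-valued
   f in L^2, i.e. the L^2-limit of the transforms of the truncations of f
   (which are integrable). *)
Definition fourierL2 (f : 'rV[R]_n -> R) (F : 'rV[R]_n -> R[i]) : Prop :=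
  [/\ L2 f, L2C F &
    (\int[mu]_xi
       (ComplexField.Normc.normc (fourier (truncate f k%:R) xi - F xi)
          ^+ 2)%:E)%E @[k --> \oo] --> 0%E].

Definition Hs (s : R) (f : 'rV[R]_n -> R) : Prop :=
  exists2 F, fourierL2 f F &
    L2C (fun xi => ((1 + enorm xi ^+ 2) `^ (s / 2))%:C%C * F xi).

(* g represents (-Delta)^s f. *)
Definition frac_laplacian (s : R) (f g : 'rV[R]_n -> R) : Prop :=
  exists F G, [/\ fourierL2 f F, fourierL2 g G &
    {ae mu, forall xi, G xi = ((2 * pi * enorm xi) `^ (2 * s))%:C%C * F xi}].

Definition pairing (f g : 'rV[R]_n -> R) : R := \int[mu]_x (f x * g x).

Definition partial (i : 'I_n) (f : 'rV[R]_n -> R) : 'rV[R]_n -> R :=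
  'D_(delta_mx ord0 i) f.

(* C^infinity: every iterated partial derivative is (Frechet) differentiable. *)
Definition smooth (f : 'rV[R]_n -> R) : Prop :=
  forall (l : seq 'I_n) (x : 'rV[R]_n), differentiable (foldr partial f l) x.

Definition test_function (psi : 'rV[R]_n -> R) : Prop :=
  smooth psi /\ compact (closure [set x | psi x != 0]).

(* Weak form of (-Delta)^s phi + omega phi - |phi(0)|^(2 sigma) phi(0) delta_0
   = 0.  The fractional Laplacians are almost-everywhere classes known through
   representatives u and v; pairing u v does not depend on their choice. *)
Definition weak_solution (s sigma omega : R) (phi : 'rV[R]_n -> R) : Prop :=
  exists2 u, frac_laplacian (s / 2) phi u &
    forall psi, test_function psi ->
      exists2 v, frac_laplacian (s / 2) psi v &
        pairing u v + omega * pairing phi psi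
        - `|phi 0| `^ (2 * sigma) * phi 0 * psi 0 = 0.

End fourier.

(* Main.v *)
(** The difference [hartley] of the real and imaginary parts of the Fourier
    transform has the kernel [cas t = cos t + sin t]; it commutes with the real
    radial symbol [m = (2 pi |xi|)^s] of [(-Delta)^(s/2)] and satisfies
    Plancherel, so it can replace the complex transform.  Let [h] be the
    transform of [phi], [q = m^2 + omega] and [c = |phi 0|^(2 sigma) phi 0].
    Testing the equation against the translates [b (a - x)] of an even bump [b]
    gives [hartley (q h p) a = c b a], where [p] is the transform of [b].
    Hence [q h p = c p] by inversion, and [q h = c] almost everywhere because
    [p > 0] on a large cube when the support of [b] is small.  As [q] vanishes
    only on a null set and [phi <> 0], we get [c <> 0].  Finally
    [c (1 + |xi|^2)^(s/2) / q] is not square integrable at infinity if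
    [s <= n/2], at the origin if [omega = 0 < s - n/2], and near the sphere
    [q = 0] if [omega < 0].  So in fact the first alternative holds. *)

Require Import Defs.
From mathcomp Require Import all_boot all_order all_algebra.
From mathcomp Require Import all_classical all_reals all_analysis.
From mathcomp Require Import measurable_realfun.
From mathcomp Require Import ring lra zify.
From mathcomp.real_closed Require Import complex.

Set Implicit Arguments.
Unset Strict Implicit.
Unset Printing Implicit Defensive.

Import Order.TTheory GRing.Theory Num.Theory.
Import numFieldNormedType.Exports.

Local Open Scope classical_set_scope.
Local Open Scope ring_scope.

(** * Integrable and square integrable real functions *)

(** The main analytic work is Plancherel's identity for the transforms of [fourierL2], obtained by
    Abel summation. The weight [exp (- 2 pi e sum |x_i|)] is taken instead of a Gaussian because
    both it and its transform, a product of Poisson kernels, have elementary primitives: all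
    integrals reduce to one variable and to [expR], [cos] and [atan]. With [atan] explicit, Poisson
    integrals of box indicators visibly converge off the faces, so the limits are taken on boxes and
    Dynkin's theorem carries them to measurable sets. A real transform matches the real pairings of
    the weak form, but translation does not act by multiplication on [cas] transforms in general.
    Evenness of the bump restores this, and the factor [cas (2 pi a.xi)] left by a translate is
    exactly the kernel of the transform at [a]. The transform of one fixed bump may vanish
    somewhere, hence a sequence of radii instead of a single bump. No polar coordinates are needed
    for the divergent integrals: an integrable function cannot keep a fixed mass on shells that
    leave every point, and scaling alone gives the volumes of shells. *)

Section real_integrals.
Context d (T : measurableType d) (R : realType).
Variable mu : {measure set T -> \bar R}.
Implicit Types (f g h : T -> R) (A : set T).

Definition L1 f := mu.-integrable [set: T] (EFin \o f).

Lemma L1_measurable f : L1 f -> measurable_fun setT f.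
Proof. by move=> /measurable_int/measurable_EFinP. Qed.

Lemma L1D f g : L1 f -> L1 g -> L1 (f \+ g).
Proof. by move=> If Ig; exact: (integrableD measurableT If Ig). Qed.

Lemma L1B f g : L1 f -> L1 g -> L1 (f \- g).
Proof. by move=> If Ig; exact: (integrableB measurableT If Ig). Qed.

Lemma L1Z (r : R) f : L1 f -> L1 (fun x => r * f x).
Proof. by move=> If; exact: (integrableZl measurableT r If). Qed.

Lemma L1_norm f : L1 f -> L1 (fun x => `|f x|).
Proof. by move=> If; exact: (integrable_norm If). Qed.

Lemma L1_le f g : measurable_fun setT f -> (forall x, `|f x| <= g x) ->
  L1 g -> L1 f.
Proof.
move=> mf fg Ig; apply: (le_integrable measurableT _ _ Ig).
  exact/measurable_EFinP.
by move=> x _ /=; rewrite lee_fin (le_trans (fg x))// ler_norm.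
Qed.

Lemma L1_indic A : measurable A -> (mu A < +oo)%E -> L1 \1_A.
Proof.
move=> mA muA; apply/integrableP; split; first exact/measurable_EFinP.
under eq_integral do rewrite /= ger0_norm//.
by rewrite integral_indic// setIT.
Qed.

Lemma L1_bounded f g (M : R) : measurable_fun setT f -> (forall x, `|f x| <= M) ->
  L1 g -> L1 (fun x => f x * g x).
Proof.
move=> mf fM Ig; apply: (@L1_le _ (fun x => M * `|g x|)).
- by apply: measurable_funM => //; exact: L1_measurable.
- by move=> x; rewrite normrM ler_wpM2r.
- by apply: L1Z; exact: L1_norm.
Qed.

(** [Rintegral] is a [fine], with value 0 when the integral is infinite; integrability excludes that
    default. *)
Lemma EFin_Rint f : L1 f -> (\int[mu]_x f x)%:E = (\int[mu]_x (f x)%:E)%E.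
Proof. by move=> If; rewrite fineK//; exact: integrable_fin_num. Qed.

Lemma Rint_cvg (f_ : nat -> T -> R) f g :
  (forall k, measurable_fun setT (f_ k)) -> measurable_fun setT f ->
  {ae mu, forall x, f_ k x @[k --> \oo] --> f x} ->
  (forall k x, `|f_ k x| <= g x) -> L1 g ->
  L1 f /\ \int[mu]_x f_ k x @[k --> \oo] --> \int[mu]_x f x.
Proof.
move=> mf_ mf ff fg Ig.
have ff' : {ae mu, forall x, [set: T] x ->
    (EFin \o f_ k) x @[k --> \oo] --> (EFin \o f) x}.
  apply: filterS ff => x fx _; apply: cvg_EFin; first exact: nearW.
  exact: fx.
have fg' : {ae mu, forall x (k : nat), [set: T] x ->
    (`|(EFin \o f_ k) x| <= (EFin \o g) x)%E}.
  by apply/aeW => x k _ /=; rewrite lee_fin.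
have [If _ cf] := dominated_convergence measurableT
  (fun k => (measurable_EFinP _ _).2 (mf_ k)) ((measurable_EFinP _ _).2 mf) ff' Ig fg'.
by split => //; apply: fine_cvg; rewrite EFin_Rint//.
Qed.

Lemma ae_Rint_eq f g : measurable_fun setT f -> measurable_fun setT g ->
  {ae mu, forall x, f x = g x} -> \int[mu]_x f x = \int[mu]_x g x.
Proof.
move=> mf mg fg; congr fine; apply: ae_eq_integral => //.
- exact/measurable_EFinP.
- exact/measurable_EFinP.
- by apply: filterS fg => x -> _.
Qed.

Lemma ae_L1 f g : measurable_fun setT f -> measurable_fun setT g ->
  {ae mu, forall x, f x = g x} -> L1 f -> L1 g.
Proof.
move=> mf mg fg /integrableP[_ If]; apply/integrableP; split.
  exact/measurable_EFinP.
rewrite (_ : (\int[mu]_x _ = \int[mu]_x `|(EFin \o f) x|)%E)//.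
apply: ae_eq_integral => //.
- by apply: measurableT_comp => //; exact/measurable_EFinP.
- by apply: measurableT_comp => //; exact/measurable_EFinP.
- by apply: filterS fg => x /= -> _.
Qed.

Lemma Rint_eq0_ae f : L1 f -> (forall x, 0 <= f x) -> \int[mu]_x f x = 0 ->
  {ae mu, forall x, f x = 0}.
Proof.
move=> If f0 I0; have := EFin_Rint If; rewrite I0 => /esym E0.
have := ae_eq_integral_abs mu measurableT (measurable_int _ If).
case=> + _; case.
  by rewrite -[RHS]E0; apply: eq_integral => x _ /=; rewrite ger0_norm.
by move=> N [mN N0 sN]; exists N; split=> // x Nx; apply: sN => /= /(_ I) [].
Qed.

(** Square integrability in terms of the real integral, so that expansions of squares are [ring]
    identities. [sqL1_Lfun] is the bridge from the [Lfun] of the definitions. *)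
Definition sqL1 f := measurable_fun setT f /\ L1 (fun x => f x ^+ 2).

Lemma sqL1_Lfun f : f \in Lfun mu 2%:E -> sqL1 f.
Proof.
move=> f2; split; last exact: Lfun2_integrable_sqr.
by move: f2; rewrite inE => /andP[]; rewrite inE.
Qed.

Lemma sqL1M f g : sqL1 f -> sqL1 g -> L1 (fun x => f x * g x).
Proof.
move=> [mf If] [mg Ig].
apply: (@L1_le _ (fun x => 2^-1 * (f x ^+ 2 + g x ^+ 2))).
- exact: measurable_funM.
- move=> x; rewrite normrM -[f x ^+ 2]real_normK ?num_real// -[g x ^+ 2]real_normK ?num_real//.
  have := sqr_ge0 (`|f x| - `|g x|); nra.
- by apply: L1Z; exact: L1D.
Qed.

Lemma sqL1D f g : sqL1 f -> sqL1 g -> sqL1 (f \+ g).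
Proof.
move=> sf sg; split; first exact: measurable_funD sf.1 sg.1.
rewrite (_ : (fun _ => _) = ((fun x => f x ^+ 2) \+ (fun x => 2 * (f x * g x)))
   \+ (fun x => g x ^+ 2)); last by apply/funext => x /=; ring.
by apply: L1D sg.2; apply: L1D sf.2 _; apply: L1Z; exact: sqL1M.
Qed.

Lemma sqL1Z (r : R) f : sqL1 f -> sqL1 (fun x => r * f x).
Proof.
move=> [mf If]; split; first exact: measurable_funM.
by under [X in L1 X]funext do rewrite exprMn; exact: L1Z.
Qed.

Lemma sqL1B f g : sqL1 f -> sqL1 g -> sqL1 (f \- g).
Proof.
move=> sf sg; rewrite (_ : f \- g = f \+ (fun x => -1 * g x)).
  by apply: sqL1D => //; exact: sqL1Z.
by apply/funext => x /=; rewrite mulN1r.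
Qed.

Lemma sqL1_le f g : measurable_fun setT f -> (forall x, `|f x| <= `|g x|) ->
  sqL1 g -> sqL1 f.
Proof.
move=> mf fg [mg Ig]; split => //; apply: L1_le Ig; first exact: measurable_funX.
by move=> x; rewrite normrX -[leRHS]real_normK ?num_real// lerXn2r ?nnegrE.
Qed.

Definition nL2 f := Num.sqrt (\int[mu]_x (f x ^+ 2)).

Lemma nL2_ge0 f : 0 <= nL2 f. Proof. exact: sqrtr_ge0. Qed.

Lemma nL2_sqr f : nL2 f ^+ 2 = \int[mu]_x (f x ^+ 2).
Proof. by rewrite sqr_sqrtr//; apply: Rintegral_ge0 => x _; exact: sqr_ge0. Qed.

(** The quadratic [H] in [t], the integral of [(f + t g)^2], never becomes negative; the inequality
    is the sign of its discriminant. *)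
Lemma Cauchy_Schwarz f g : sqL1 f -> sqL1 g ->
  `|\int[mu]_x (f x * g x)| <= nL2 f * nL2 g.
Proof.
move=> sf sg.
set B := Rintegral _ _ _.
have H t : 0 <= nL2 f ^+ 2 + 2 * t * B + t ^+ 2 * nL2 g ^+ 2.
  have : 0 <= \int[mu]_x ((f x + t * g x) ^+ 2).
    by apply: Rintegral_ge0 => x _; exact: sqr_ge0.
  rewrite (_ : Rintegral _ _ _ = \int[mu]_x
     ((f x ^+ 2 + (2 * t) * (f x * g x)) + t ^+ 2 * g x ^+ 2)); last first.
    by congr Rintegral; apply/funext => x; ring.
  have I1 := sqL1M sf sg.
  rewrite RintegralD//; last 2 first.
  - by apply: L1D sf.2 _; exact: L1Z.
  - by apply: L1Z sg.2.
  rewrite RintegralD//; last 2 first.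
  - exact: sf.2.
  - exact: L1Z.
  rewrite RintegralZl// RintegralZl//; last exact: sg.2.
  by rewrite !nL2_sqr.
have a0 := nL2_ge0 f; have b0 := nL2_ge0 g.
rewrite -(@ler_pXn2r _ 2) ?nnegrE// ?mulr_ge0// real_normK ?num_real// exprMn.
have [b00|bn0] := eqVneq (nL2 g) 0.
  rewrite b00 expr0n mulr0; move: H; rewrite b00 expr0n/= => H.
  have [->|B0] := eqVneq B 0; first by rewrite expr0n.
  (* The quadratic is now affine in [t]; with slope [2 * B != 0] it would equal -1 at this [t]. *)
  have := H (- (nL2 f ^+ 2 + 1) / (2 * B)).
  rewrite (_ : 2 * (- (nL2 f ^+ 2 + 1) / (2 * B)) * B = - (nL2 f ^+ 2 + 1)); last by field.
  by lra.
(* The minimiser of the quadratic. *)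
have := H (- B / nL2 g ^+ 2).
rewrite (_ : _ + _ = (nL2 f ^+ 2 * nL2 g ^+ 2 - B ^+ 2) / nL2 g ^+ 2); last by field.
rewrite pmulr_lge0 ?invr_gt0 ?exprn_gt0 ?lt_def ?bn0//.
by rewrite subr_ge0.
Qed.

Definition cvgL2 (f_ : nat -> T -> R) f :=
  \int[mu]_x ((f_ k x - f x) ^+ 2) @[k --> \oo] --> 0.

Lemma nL2_cvg0 (f_ : nat -> T -> R) f : cvgL2 f_ f ->
  nL2 (f_ k \- f) @[k --> \oo] --> 0.
Proof.
by move=> /(continuous_cvg _ (@sqrt_continuous R 0)); rewrite sqrtr0.
Qed.

(** The error is split as [(f_k - f)(g_k - g) + (f_k - f) g + f (g_k - g)], and Cauchy-Schwarz
    bounds each term. *)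
Lemma cvgL2_Rint (f_ g_ : nat -> T -> R) f g :
  (forall k, sqL1 (f_ k)) -> sqL1 f -> (forall k, sqL1 (g_ k)) -> sqL1 g ->
  cvgL2 f_ f -> cvgL2 g_ g ->
  \int[mu]_x (f_ k x * g_ k x) @[k --> \oo] --> \int[mu]_x (f x * g x).
Proof.
move=> sf_ sf sg_ sg cf cg.
apply/subr_cvg0; apply/norm_cvg0P.
pose a k := nL2 (f_ k \- f); pose b k := nL2 (g_ k \- g).
apply: (@squeeze_cvgr _ _ _ _ (fun=> 0) (fun k => a k * b k + a k * nL2 g + nL2 f * b k)).
- apply: nearW => k; rewrite normr_ge0/=.
  have s1 := sqL1B (sf_ k) sf; have s2 := sqL1B (sg_ k) sg.
  have -> : \int[mu]_x (f_ k x * g_ k x) - \int[mu]_x (f x * g x) =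
     \int[mu]_x ((f_ k \- f) x * (g_ k \- g) x) + \int[mu]_x ((f_ k \- f) x * g x)
     + \int[mu]_x (f x * (g_ k \- g) x).
    rewrite -RintegralB//; last 2 first. exact: sqL1M. exact: sqL1M.
    rewrite -RintegralD//; last 2 first. exact: sqL1M. exact: sqL1M.
    rewrite -RintegralD//; last 2 first. by apply: L1D; exact: sqL1M. exact: sqL1M.
    by congr Rintegral; apply/funext => x /=; ring.
  rewrite (le_trans (ler_normD _ _))// lerD//.
    rewrite (le_trans (ler_normD _ _))// lerD//; exact: Cauchy_Schwarz.
  exact: Cauchy_Schwarz.
- exact: cvg_cst.
- rewrite (_ : 0 = 0 * 0 + 0 * nL2 g + nL2 f * 0); last by ring.
  have ca := nL2_cvg0 cf; have cb := nL2_cvg0 cg.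
  apply: cvgD; last by apply: cvgM => //; exact: cvg_cst.
  by apply: cvgD; apply: cvgM => //; exact: cvg_cst.
Qed.

End real_integrals.

(** * Fubini for real integrands dominated by a product *)

Section fubini_real.
Context d1 d2 (T1 : measurableType d1) (T2 : measurableType d2) (R : realType).
Variable m1 : {sigma_finite_measure set T1 -> \bar R}.
Variable m2 : {sigma_finite_measure set T2 -> \bar R}.
Variables (h : T1 * T2 -> R) (a : T1 -> R) (b : T2 -> R).
Hypotheses (mh : measurable_fun setT h) (Ia : L1 m1 a) (Ib : L1 m2 b).
Hypothesis hab : forall x y, `|h (x, y)| <= a x * b y.

Lemma L1_dominated2 x : L1 m2 (fun y => h (x, y)).
Proof.
apply: (@L1_le _ _ _ _ _ (fun y => a x * b y)) => //.
- exact: (measurable_fun_pair2 x mh).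
- exact: L1Z.
Qed.

Lemma L1_dominated1 y : L1 m1 (fun x => h (x, y)).
Proof.
apply: (@L1_le _ _ _ _ _ (fun x => b y * a x)).
- exact: (measurable_fun_pair1 y mh).
- by move=> x; rewrite mulrC.
- exact: L1Z.
Qed.

(** The bound [a x * b y] turns the iterated integral of the absolute value into a product of two
    finite integrals, which is Tonelli's criterion. *)
Lemma L1_dominated_prod : (m1 \x m2)%E.-integrable setT (EFin \o h).
Proof.
have mEh : measurable_fun setT (EFin \o h) by exact/measurable_EFinP.
apply/(integrable12ltyP _ _ mEh).
apply: (@le_lt_trans _ _ (\int[m1]_x (`|a x|%:E * \int[m2]_y `|b y|%:E))%E).
  apply: ge0_le_integral => //.
  - by move=> x _; exact: integral_ge0.
  - apply: (measurable_fun_fubini_tonelli_F (abse \o (EFin \o h))) => //=.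
    exact: measurableT_comp.
  - apply: emeasurable_funM => //; apply/measurable_EFinP.
    exact: measurableT_comp (L1_measurable Ia).
  - move=> x _; rewrite -ge0_integralZl//; last first.
      apply/measurable_EFinP; exact: measurableT_comp (L1_measurable Ib).
    apply: ge0_le_integral => //.
    + apply: measurableT_comp => //; apply/measurable_EFinP.
      exact: (measurable_fun_pair2 x mh).
    + apply: emeasurable_funM => //; apply/measurable_EFinP.
      exact: measurableT_comp (L1_measurable Ib).
    + move=> y _ /=; rewrite -EFinM lee_fin (le_trans (hab x y))//.
      by rewrite -normrM ler_norm.
have [_ /= Ia'] := integrableP _ _ _ Ia; have [_ /= Ib'] := integrableP _ _ _ Ib.
rewrite ge0_integralZr//; last 2 first.
- apply/measurable_EFinP; exact: measurableT_comp (L1_measurable Ia).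
- exact: integral_ge0.
rewrite lte_mul_pinfty//; first exact: integral_ge0.
by rewrite ge0_fin_numE//; exact: integral_ge0.
Qed.

Lemma L1_fubini1 : L1 m1 (fun x => \int[m2]_y h (x, y)).
Proof.
have := integrable_fubini_F L1_dominated_prod.
apply: eq_integrable => // x _; rewrite /fubini_F /= EFin_Rint//.
exact: L1_dominated2.
Qed.

Lemma Rint_prod : \int[m1]_x \int[m2]_y h (x, y) = fine (\int[m1 \x m2]_z (h z)%:E)%E.
Proof.
rewrite -(integral12_prod_meas1 L1_dominated_prod); congr fine.
by apply: eq_integral => x _; rewrite EFin_Rint//; exact: L1_dominated2.
Qed.

Lemma Rint_Fubini : \int[m1]_x \int[m2]_y h (x, y) = \int[m2]_y \int[m1]_x h (x, y).
Proof.
rewrite Rint_prod -(integral21_prod_meas1 L1_dominated_prod); congr fine.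
by apply: eq_integral => x _; rewrite EFin_Rint//; exact: L1_dominated1.
Qed.

End fubini_real.

(** * Iterated integrals for the recursively defined Lebesgue measure *)

Section lebesgue_rV_step.
Variables (R : realType) (n : nat).
Notation leb := (@lebesgue_measure R).
Notation mu := (lebesgue_rV R n).
Notation muS := (lebesgue_rV R n.+1).

Lemma ge0_integral_rVS (f : 'rV[R]_n.+1 -> \bar R) :
  measurable_fun setT f -> (forall v, 0 <= f v)%E ->
  (\int[muS]_v f v = \int[leb]_x \int[mu]_y f (cons_rV (x, y)))%E.
Proof.
move=> mf f0.
have mfc : measurable_fun setT (f \o @cons_rV R n).
  exact: measurableT_comp (@measurable_cons_rV R n).
rewrite -(@fubini_tonelli1 _ _ _ _ _ leb mu (f \o @cons_rV R n))//.
  exact: (@ge0_integral_pushforward _ _ _ _ _ _ (@measurable_cons_rV R n)).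
by move=> z; exact: f0.
Qed.

Lemma Rint_rVS (f : 'rV[R]_n.+1 -> R) (a : R -> R) (b : 'rV[R]_n -> R) :
  measurable_fun setT f -> L1 leb a -> L1 mu b ->
  (forall x y, `|f (cons_rV (x, y))| <= a x * b y) ->
  \int[muS]_v f v = \int[leb]_x \int[mu]_y f (cons_rV (x, y)).
Proof.
move=> mf Ia Ib fab.
have mfc : measurable_fun setT (f \o @cons_rV R n).
  exact: measurableT_comp (@measurable_cons_rV R n).
have H := Rint_prod mfc Ia Ib fab; rewrite /= in H; rewrite H; congr fine.
apply: (@integral_pushforward _ _ _ _ _ _ (@measurable_cons_rV R n)) => //.
  exact/measurable_EFinP.
exact: L1_dominated_prod mfc Ia Ib fab.
Qed.

End lebesgue_rV_step.

(** * Laplace and Poisson kernels *)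

Section one_dimensional_integrals.
Variable R : realType.
Notation leb := (@lebesgue_measure R).
Implicit Types (a b c e t x y z th : R).

(** All primitives below are functions of an affine argument; the [+ 0] in [Fcos] is there to match
    this shape. *)
Lemma is_derive_affine b c t : is_derive t 1 (fun t => b * t + c) b.
Proof.
have D := is_deriveD (is_deriveZ b (is_derive_id (t : R^o) 1)) (is_derive_cst (c : R^o) (t : R^o) 1).
by apply: (is_derive_eq D); rewrite addr0 -[_ *: _]/(_ * _) mulr1.
Qed.

(** The Poisson kernel of the upper half plane at height [e], a Cauchy density of total mass 1. *)
Definition poisson e z := e / (pi * (e ^+ 2 + z ^+ 2)).

Lemma is_derive_atan_poisson e x y (e0 : 0 < e) :
  is_derive y 1 (fun y => pi^-1 * atan (e^-1 * y + (- (e^-1 * x)))) (poisson e (x - y)).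
Proof.
have p0 : pi != 0 :> R by rewrite gt_eqF// pi_gt0.
have D := is_derive_affine e^-1 (- (e^-1 * x)) y.
have D2 := is_derive1_comp (is_derive1_atan _) D.
apply: (is_derive_eq (is_deriveZ pi^-1 D2)).
rewrite -[_ *: _]/(_ * _) /poisson.
have en : e != 0 by rewrite gt_eqF.
have d1 : e ^+ 2 + (x - y) ^+ 2 != 0.
  by rewrite gt_eqF// ltr_pwDl ?sqr_ge0 ?exprn_gt0.
have -> : 1 + (e^-1 * y - e^-1 * x) ^+ 2 = (e ^+ 2 + (x - y) ^+ 2) / e ^+ 2 by field.
by move: (pi : R) p0 => p p0; field; rewrite d1 p0 en.
Qed.

(* A primitive of [expR (- c * t) * (1 + cos (b * t + th))]; adding 1 makes the
   integrand nonnegative, so that improper integration is monotone convergence. *)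
Definition Fcos b c th t := - c^-1 * expR (- c * t + 0) +
    (c ^+ 2 + b ^+ 2)^-1 * (expR (- c * t + 0) * (b * sin (b * t + th) - c * cos (b * t + th))).

Lemma is_derive_Fcos b c th t : 0 < c ->
  is_derive t 1 (Fcos b c th) (expR (- c * t) * (1 + cos (b * t + th))).
Proof.
move=> c0; rewrite /Fcos.
have D1 := is_derive_affine (- c) 0 t.
have D2 := is_derive_affine b th t.
have E1 := is_derive1_comp (is_derive_expR _) D1.
have E2 := is_derive1_comp (is_derive_sin _) D2.
have E3 := is_derive1_comp (is_derive_cos _) D2.
have E4 := is_deriveM E1 (is_deriveB (is_deriveZ b E2) (is_deriveZ c E3)).
have E5 := is_deriveD (is_deriveZ (- c^-1) E1) (is_deriveZ (c ^+ 2 + b ^+ 2)^-1 E4).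
apply: (is_derive_eq E5).
rewrite -![_ *: _]/(_ * _) /= !addr0.
have cn : c != 0 by rewrite gt_eqF.
have d1 : c ^+ 2 + b ^+ 2 != 0 by rewrite gt_eqF// ltr_pwDl ?sqr_ge0 ?exprn_gt0.
rewrite -[(b \*: _ - _) t]/(b * sin (b * t + th) - c * cos (b * t + th)).
by move: (expR _) (sin _) (cos _) => E S C; field; rewrite cn d1.
Qed.

Lemma is_derive_continuous (F f : R -> R) :
  (forall x, is_derive x 1 F (f x)) -> continuous F.
Proof.
move=> dF x; apply/differentiable_continuous/derivable1_diffP.
by case: (dF x).
Qed.

Lemma ge0_integral_halves (f : R -> R) : (forall x, 0 <= f x) -> continuous f ->
  (\int[leb]_x (f x)%:E = \int[leb]_(x in `[0%R, +oo[) (f (- x))%:E +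
     \int[leb]_(x in `[0%R, +oo[) (f x)%:E)%E.
Proof.
move=> f0 cf; have mf : measurable_fun setT f by exact: continuous_measurable_fun.
have -> : [set: R] = `]-oo, 0%R] `|` `]0%R, +oo[.
  by apply/seteqP; split=> // x _ /=; rewrite !in_itv/= andbT; case: (leP x 0); [left|right].
rewrite ge0_integral_setU//=; last 3 first.
- by apply: measurable_funTS; exact/measurable_EFinP.
- by move=> x _; rewrite lee_fin.
- apply/disj_setPS => x [] /=; rewrite !in_itv/= andbT => x0 /lt_le_trans/(_ x0).
  by rewrite ltxx.
rewrite [X in (_ + X)%E]integral_itv_obnd_cbnd; last first.
  by apply: measurable_funTS; exact/measurable_EFinP.
rewrite -[X in `]-oo, X]]oppr0 ge0_integration_by_substitutionNy//.
exact: continuous_subspaceT.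
Qed.

(** Both halves of the line are treated on [[0, +oo[]. On the reflected half the primitive is
    [- F (- x)], whose limit is [- l2]. *)
Lemma ge0_integral_FTC (f F : R -> R) (l1 l2 : R) : (forall x, 0 <= f x) ->
  continuous f -> (forall x, is_derive x 1 F (f x)) ->
  F x @[x --> +oo] --> l1 -> F x @[x --> -oo] --> l2 ->
  (\int[leb]_x (f x)%:E = (l1 - l2)%:E)%E.
Proof.
move=> f0 cf dF Fl1 Fl2.
have cF := is_derive_continuous dF.
rewrite ge0_integral_halves//.
rewrite (@ge0_continuous_FTC2y _ _ (fun x => - F (- x)) 0 (- l2))//.
- rewrite (@ge0_continuous_FTC2y _ _ F 0 l1)//.
  + by rewrite -!EFinB -EFinD; congr EFin; rewrite oppr0; ring.
  + exact: continuous_subspaceT.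
  + by apply: cvg_at_right_filter; exact: cF.
  + by move=> x _; rewrite derive1E; exact: derive_val.
- apply: continuous_subspaceT => x; apply: continuous_comp; last exact: cf.
  exact: oppr_continuous.
- by apply: cvgN; apply/cvgNy_compNP.
- apply: cvg_at_right_filter; apply: cvgN; apply: continuous_comp; last exact: cF.
  exact: oppr_continuous.
- move=> x _; rewrite derive1E.
  have D := is_deriveN (is_derive1_comp (dF (- x)) (is_deriveN (is_derive_id (x : R^o) 1))).
  by rewrite (@derive_val _ _ _ _ _ _ _ D) /= mulrN1 opprK.
Qed.

Lemma poisson_ge0 e z : 0 < e -> 0 <= poisson e z.
Proof.
by move=> e0; rewrite divr_ge0 ?(ltW e0)// mulr_ge0 ?pi_ge0// addr_ge0 ?sqr_ge0.
Qed.

Lemma poissonN e z : poisson e (- z) = poisson e z.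
Proof. by rewrite /poisson sqrrN. Qed.

Lemma poisson_le e z : 0 < e -> poisson e z <= (pi * e)^-1.
Proof.
move=> e0; have p0 := pi_gt0 R.
have s0 := sqr_ge0 z; have e20 : 0 < e ^+ 2 by rewrite exprn_gt0.
have -> : poisson e z = (pi * e)^-1 * (e ^+ 2 / (e ^+ 2 + z ^+ 2)).
  rewrite /poisson; have : pi != 0 :> R by rewrite gt_eqF.
  by move: (pi : R) => p pn; field; rewrite pn !gt_eqF ?ltr_pwDl.
by rewrite ler_piMr ?invr_ge0 ?mulr_ge0 ?(ltW p0) ?(ltW e0)// ler_pdivrMr ?ltr_pwDl// mul1r lerDl.
Qed.

Lemma continuous_poisson e : 0 < e -> continuous (poisson e).
Proof.
move=> e0 z; apply: cvgM; first exact: cvg_cst.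
apply: cvgV; first by rewrite mulf_neq0// gt_eqF ?pi_gt0// ltr_pwDl ?sqr_ge0 ?exprn_gt0.
apply: cvgM; first exact: cvg_cst.
apply: cvgD; first exact: cvg_cst.
exact: exprn_continuous.
Qed.

Lemma continuous_poissonB e x : 0 < e -> continuous (fun y => poisson e (x - y)).
Proof.
move=> e0 y; apply: (@continuous_comp _ _ _ (fun y => x - y) (poisson e)).
  by apply: cvgB; [exact: cvg_cst|exact: cvg_id].
exact: continuous_poisson.
Qed.

Lemma cvg_affine_pinfty b c : 0 < b -> b * x + c @[x --> +oo] --> +oo.
Proof.
move=> b0; apply/cvgryPge => A; near=> x.
rewrite -lerBlDr -ler_pdivrMl//; near: x; exact: nbhs_pinfty_ge.
Unshelve. all: by end_near. Qed.

Lemma integral_poisson e x : 0 < e ->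
  (\int[leb]_y (poisson e (x - y))%:E = 1)%E.
Proof.
move=> e0; have p0 := pi_gt0 R.
have ei : 0 < e^-1 by rewrite invr_gt0.
rewrite (_ : 1%E = (2^-1 - - 2^-1)%:E); last by congr EFin; rewrite opprK -[2^-1]mul1r -splitr.
apply: (@ge0_integral_FTC _ (fun y => pi^-1 * atan (e^-1 * y + (- (e^-1 * x))))).
- by move=> y; exact: poisson_ge0.
- exact: continuous_poissonB.
- by move=> y; exact: is_derive_atan_poisson.
- rewrite (_ : 2^-1 = pi^-1 * (pi / 2)); last by rewrite mulKf ?gt_eqF.
  apply: cvgM; first exact: cvg_cst.
  exact: (cvg_comp _ _ (cvg_affine_pinfty _ ei) (@cvgy_atan R)).
- rewrite (_ : - 2^-1 = - (pi^-1 * (pi / 2))); last by rewrite mulKf ?gt_eqF.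
  apply/cvgNy_compNP.
  rewrite (_ : _ \o _ = - (fun y => pi^-1 * atan (e^-1 * y + e^-1 * x))); last first.
    apply/funext => y; rewrite /= -[RHS]mulrN -atanN; congr (_ * atan _); ring.
  apply: cvgN; apply: cvgM; first exact: cvg_cst.
  exact: (cvg_comp _ _ (cvg_affine_pinfty _ ei) (@cvgy_atan R)).
Qed.

Lemma integral_poisson_itv e x a b : 0 < e -> a <= b ->
  (\int[leb]_(y in `]a, b]) (poisson e (x - y))%:E =
   (pi^-1 * (atan (e^-1 * (b - x)) - atan (e^-1 * (a - x))))%:E)%E.
Proof.
move=> e0; rewrite le_eqVlt => /predU1P[->|ab].
  by rewrite set_itvoc0// integral_set0 subrr mulr0.
have cp := @continuous_poissonB e x e0.
rewrite integral_itv_obnd_cbnd; last first.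
  apply: measurable_funTS; apply/measurable_EFinP.
  exact: continuous_measurable_fun.
pose F y := pi^-1 * atan (e^-1 * y + (- (e^-1 * x))).
have dF y : is_derive y 1 F (poisson e (x - y)) by exact: is_derive_atan_poisson.
have cF := is_derive_continuous dF.
rewrite (@continuous_FTC2 _ _ F)//.
- by rewrite -EFinB /F -mulrBr !mulrBr.
- exact: continuous_subspaceT.
- split => [y _||]; first by case: (dF y).
  + by apply: cvg_at_right_filter; exact: cF.
  + by apply: cvg_at_left_filter; exact: cF.
- by move=> y _; rewrite derive1E; exact: derive_val.
Qed.

Lemma cos_ge0_add1 t : 0 <= 1 + cos t.
Proof. by have := cos_geN1 t; lra. Qed.

(** The primitive [Fcos] tends to 0 at infinity, so only [- Fcos b c th 0] remains. *)
Lemma integral_expR_cos_half b c th : 0 < c ->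
  (\int[leb]_(t in `[0%R, +oo[) (expR (- c * t) * (1 + cos (b * t + th)))%:E =
  (c^-1 + (c ^+ 2 + b ^+ 2)^-1 * (c * cos th - b * sin th))%:E)%E.
Proof.
move=> c0.
have cn : c != 0 by rewrite gt_eqF.
have d1 : c ^+ 2 + b ^+ 2 != 0 by rewrite gt_eqF// ltr_pwDl ?sqr_ge0 ?exprn_gt0.
have dF t := is_derive_Fcos b th t c0.
have cF := is_derive_continuous dF.
rewrite (@ge0_continuous_FTC2y _ _ (Fcos b c th) 0 0).
- rewrite -EFinB; congr EFin; rewrite /Fcos !mulr0 !add0r expR0; ring.
- by move=> t _; rewrite mulr_ge0 ?expR_ge0 ?cos_ge0_add1.
- apply: continuous_subspaceT => t; apply: cvgM.
    apply: continuous_comp; last exact: continuous_expR.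
    by apply: cvgM; [exact: cvg_cst|exact: cvg_id].
  apply: cvgD; first exact: cvg_cst.
  apply: continuous_comp; last exact: continuous_cos.
  by apply: cvgD; [apply: cvgM; [exact: cvg_cst|exact: cvg_id]|exact: cvg_cst].
(* [M] bounds the factor that multiplies the exponential in [Fcos]. *)
- pose M := c^-1 + (c ^+ 2 + b ^+ 2)^-1 * (`|b| + `|c|).
  have eE : expR (- c * t + 0) @[t --> +oo] --> (0 : R).
    rewrite (_ : (fun t => _) = (fun x => expR (- x)) \o (fun t => c * t + 0)); last first.
      by apply/funext => t /=; rewrite !addr0 mulNr.
    exact: (cvg_comp _ _ (cvg_affine_pinfty 0 c0) (@cvgr_expR R)).
  apply: norm_cvg0.
  apply: (@squeeze_cvgr _ _ _ _ (fun=> 0) (fun t => expR (- c * t + 0) * M)).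
  + apply: nearW => t; rewrite normr_ge0/= /Fcos.
    have E0 := expR_ge0 (- c * t + 0); set E := expR _ in E0 *.
    rewrite (_ : - c^-1 * E + _ = E * (- c^-1 + (c ^+ 2 + b ^+ 2)^-1 *
       (b * sin (b * t + th) - c * cos (b * t + th)))); last by ring.
    rewrite normrM (ger0_norm E0) ler_wpM2l// (le_trans (ler_normD _ _))//.
    rewrite normrN (@ger0_norm _ c^-1) ?invr_ge0 ?(ltW c0)// lerD2l normrM.
    rewrite ger0_norm ?invr_ge0 ?addr_ge0 ?sqr_ge0// ler_wpM2l ?invr_ge0 ?addr_ge0 ?sqr_ge0//.
    rewrite (le_trans (ler_normB _ _))// !normrM lerD// -[leRHS]mulr1 ler_wpM2l//.
      by rewrite ler_norml sin_geN1 sin_le1.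
    by rewrite ler_norml cos_geN1 cos_le1.
  + exact: cvg_cst.
  + by rewrite -[X in _ --> X](mul0r M); apply: cvgM => //; exact: cvg_cst.
- by move=> t _; case: (dF t).
- by apply: cvg_at_right_filter; exact: cF.
- by move=> t _; rewrite derive1E; exact: derive_val.
Qed.

(** The reflected half is the same integral with [- b], so the sine terms cancel. The phase [th]
    pays off twice: it absorbs further coordinates in an induction on the dimension, and it turns
    [cos] into [sin]. *)
Lemma integral_expR_cos1 b c th : 0 < c ->
  (\int[leb]_t (expR (- c * `|t|) * (1 + cos (b * t + th)))%:E =
  (2 * c^-1 + 2 * c * cos th / (c ^+ 2 + b ^+ 2))%:E)%E.
Proof.
move=> c0.
have cf : continuous (fun t => expR (- c * `|t|) * (1 + cos (b * t + th))).
  move=> t; apply: cvgM.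
    apply: (@continuous_comp _ _ _ (fun t => - c * `|t|)); last exact: continuous_expR.
    by apply: cvgM; [exact: cvg_cst|exact: norm_continuous].
  apply: cvgD; first exact: cvg_cst.
  apply: (@continuous_comp _ _ _ (fun t => b * t + th)); last exact: continuous_cos.
  by apply: cvgD; [apply: cvgM; [exact: cvg_cst|exact: cvg_id]|exact: cvg_cst].
have f0 t : 0 <= expR (- c * `|t|) * (1 + cos (b * t + th)).
  by rewrite mulr_ge0 ?expR_ge0 ?cos_ge0_add1.
rewrite ge0_integral_halves//.
transitivity ((\int[leb]_(t in `[0%R, +oo[) (expR (- c * t) * (1 + cos ((- b) * t + th)))%:E +
  \int[leb]_(t in `[0%R, +oo[) (expR (- c * t) * (1 + cos (b * t + th)))%:E)%E).
  congr (_ + _)%E; apply: eq_integral => t; rewrite inE/= in_itv/= andbT => t0.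
    by rewrite normrN ger0_norm// [b * - t]mulrN [- b * t]mulNr.
  by rewrite ger0_norm.
rewrite !integral_expR_cos_half// -EFinD; congr EFin.
have cn : c != 0 by rewrite gt_eqF.
have d1 : c ^+ 2 + b ^+ 2 != 0 by rewrite gt_eqF// ltr_pwDl ?sqr_ge0 ?exprn_gt0.
rewrite sqrrN; field; by rewrite d1 cn.
Qed.

(** The Abel summation weight; the rate [2 * pi * e] is the one that makes its Fourier transform
    [poisson e]. *)
Definition laplace e t := expR (- (2 * pi * e) * `|t|).

Lemma laplace_ge0 e t : 0 <= laplace e t. Proof. exact: expR_ge0. Qed.

Lemma continuous_laplace e : continuous (laplace e).
Proof.
move=> t; apply: (@continuous_comp _ _ _ (fun t => - (2 * pi * e) * `|t|)); last exact: continuous_expR.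
by apply: cvgM; [exact: cvg_cst|exact: norm_continuous].
Qed.

Lemma measurable_laplace e : measurable_fun setT (laplace e).
Proof. exact: continuous_measurable_fun (@continuous_laplace e). Qed.

Lemma laplace_L1 e : 0 < e -> L1 leb (laplace e).
Proof.
move=> e0; have c0 : 0 < 2 * pi * e by rewrite !mulr_gt0 ?pi_gt0.
apply/integrableP; split; first by apply/measurable_EFinP; exact: measurable_laplace.
(* With frequency 0 and a quarter-period phase the cosine vanishes, and the bare exponential is
   left. *)
have := integral_expR_cos1 0 (pi / 2) c0; rewrite /= => H.
rewrite (_ : (\int[leb]_x _)%E = (\int[leb]_t (expR (- (2 * pi * e) * `|t|) *
  (1 + cos (0 * t + pi / 2)))%:E)%E); first by rewrite H ltry.
apply: eq_integral => t _ /=.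
by rewrite ger0_norm ?expR_ge0// mul0r add0r cos_pihalf addr0 mulr1.
Qed.

Lemma Rint_laplace e : 0 < e -> \int[leb]_t laplace e t = (pi * e)^-1.
Proof.
move=> e0; have p0 := pi_gt0 R; have c0 : 0 < 2 * pi * e by rewrite !mulr_gt0 ?pi_gt0.
have := integral_expR_cos1 0 (pi / 2) c0; rewrite cos_pihalf !mulr0 mul0r addr0 => H.
rewrite /Rintegral (_ : (\int[leb]_x _)%E = (\int[leb]_t (expR (- (2 * pi * e) * `|t|) *
  (1 + cos (0 * t + pi / 2)))%:E)%E).
  rewrite H /= -!mulrA [in LHS]invfM mulrA divff// mul1r//.
apply: eq_integral => t _ /=.
by rewrite mul0r add0r cos_pihalf addr0 mulr1.
Qed.

(** Obtained from [integral_expR_cos1] by removing the mass of [laplace e], the share of the summand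
    1. *)
Lemma Rint_laplace_cos e z th : 0 < e ->
  \int[leb]_t (laplace e t * cos (2 * pi * z * t + th)) = cos th * poisson e z.
Proof.
move=> e0; have p0 := pi_gt0 R; have c0 : 0 < 2 * pi * e by rewrite !mulr_gt0 ?pi_gt0.
have Iw := laplace_L1 e0.
have mc : measurable_fun setT (fun t => cos (2 * pi * z * t + th)).
  apply: continuous_measurable_fun => t.
  apply: (@continuous_comp _ _ _ (fun t => 2 * pi * z * t + th)); last exact: continuous_cos.
  by apply: cvgD; [apply: cvgM; [exact: cvg_cst|exact: cvg_id]|exact: cvg_cst].
have Iwc : L1 leb (fun t => laplace e t * cos (2 * pi * z * t + th)).
  apply: L1_le Iw; first by apply: measurable_funM => //; exact: measurable_laplace.
  move=> t; rewrite normrM (ger0_norm (laplace_ge0 _ _)) -[leRHS]mulr1 ler_wpM2l ?laplace_ge0//.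
  by rewrite ler_norml cos_geN1 cos_le1.
have H : \int[leb]_t (laplace e t + laplace e t * cos (2 * pi * z * t + th)) =
    2 * (2 * pi * e)^-1 + 2 * (2 * pi * e) * cos th / ((2 * pi * e) ^+ 2 + (2 * pi * z) ^+ 2).
  have := integral_expR_cos1 (2 * pi * z) th c0.
  rewrite /Rintegral => E; rewrite -[RHS]/(fine (_%:E)) -E; congr fine.
  by apply: eq_integral => t _; rewrite [in RHS]mulrDr mulr1.
rewrite RintegralD// Rint_laplace// in H.
have -> : \int[leb]_t (laplace e t * cos (2 * pi * z * t + th)) =
   2 * (2 * pi * e)^-1 + 2 * (2 * pi * e) * cos th / ((2 * pi * e) ^+ 2 + (2 * pi * z) ^+ 2)
   - (pi * e)^-1 by rewrite -H; ring.
have en : e != 0 by rewrite gt_eqF.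
have d1 : e ^+ 2 + z ^+ 2 != 0 by rewrite gt_eqF// ltr_pwDl ?sqr_ge0 ?exprn_gt0.
have -> : (2 * pi * e) ^+ 2 + (2 * pi * z) ^+ 2 = (2 * pi) ^+ 2 * (e ^+ 2 + z ^+ 2) by ring.
rewrite /poisson; have : pi != 0 :> R by rewrite gt_eqF.
by move: (pi : R) => p pn; field; rewrite d1 pn en.
Qed.

End one_dimensional_integrals.

(** * Poisson integrals of intervals *)

Section poisson_itv.
Variable R : realType.
Notation leb := (@lebesgue_measure R).
Implicit Types (a b e x : R).

Definition poisson_itv e a b x := \int[leb]_(y in `]a, b]) poisson e (x - y).

Lemma measurable_poissonB e x : 0 < e -> measurable_fun [set: R] (fun y : R => poisson e (x - y)).
Proof. by move=> e0; apply: continuous_measurable_fun; exact: continuous_poissonB. Qed.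

Lemma integral_poisson_itv_le1 e a b x : 0 < e ->
  (\int[leb]_(y in `]a, b]) (poisson e (x - y))%:E <= 1)%E.
Proof.
move=> e0; rewrite -(integral_poisson x e0); apply: ge0_subset_integral => //.
- by apply/measurable_EFinP; exact: measurable_poissonB.
- by move=> y _; rewrite lee_fin poisson_ge0.
Qed.

Lemma integral_poisson_itv_ge0 e a b x : 0 < e ->
  (0 <= \int[leb]_(y in `]a, b]) (poisson e (x - y))%:E)%E.
Proof. by move=> e0; apply: integral_ge0 => y _; rewrite lee_fin poisson_ge0. Qed.

Lemma EFin_poisson_itv e a b x : 0 < e ->
  (poisson_itv e a b x)%:E = (\int[leb]_(y in `]a, b]) (poisson e (x - y))%:E)%E.
Proof.
move=> e0; rewrite /poisson_itv /Rintegral fineK// ge0_fin_numE.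
  by rewrite (le_lt_trans (integral_poisson_itv_le1 _ _ _ e0))// ltry.
exact: integral_poisson_itv_ge0.
Qed.

Lemma poisson_itv_ge0 e a b x : 0 < e -> 0 <= poisson_itv e a b x.
Proof. by move=> e0; rewrite -lee_fin EFin_poisson_itv// integral_poisson_itv_ge0. Qed.

Lemma poisson_itv_le1 e a b x : 0 < e -> poisson_itv e a b x <= 1.
Proof. by move=> e0; rewrite -lee_fin EFin_poisson_itv// integral_poisson_itv_le1. Qed.

Lemma cvg_atan_scale (c : R) : c != 0 ->
  atan ((k.+1%:R^-1)^-1 * c) @[k --> \oo] --> Num.sg c * (pi / 2).
Proof.
have P (d : R) : 0 < d -> atan ((k.+1%:R^-1)^-1 * d) @[k --> \oo] --> pi / 2.
  move=> d0; apply: (@cvg_comp _ _ _ (fun k => (k.+1%:R^-1)^-1 * d) atan) (@cvgy_atan R).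
  apply/cvgryPge => A; near=> k; rewrite invrK -ler_pdivrMr//.
  apply: (@le_trans _ _ k%:R); last by rewrite ler_nat.
  near: k; exact: nbhs_infty_ger.
rewrite neq_lt => /orP[c0|c0]; last by rewrite gtr0_sg// mul1r; exact: P.
rewrite ltr0_sg// mulN1r.
rewrite (_ : (fun k => _) = - (fun k => atan ((k.+1%:R^-1)^-1 * (- c)))); last first.
  by apply/funext => k /=; rewrite fctE mulrN atanN opprK.
by apply: cvgN; apply: P; rewrite oppr_gt0.
Unshelve. all: by end_near. Qed.

(** The Poisson integral is a difference of two arctangents, each tending to a multiple of [pi / 2].
    Endpoints are excluded because the limit there is 1/2 as soon as [a < b]. *)
Lemma cvg_poisson_itv a b x : x != a -> x != b ->
  poisson_itv k.+1%:R^-1 a b x @[k --> \oo] --> (\1_(`]a, b]%classic) x : R).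
Proof.
move=> xa xb; have [ba|ab] := ltP b a.
  have E : `]a, b]%classic = set0 by apply: set_itv_ge; rewrite bnd_simp -leNgt ltW.
  rewrite (_ : (fun k => _) = fun=> 0); last first.
    by apply/funext => k; rewrite /poisson_itv E Rintegral_set0.
  by rewrite E indic0; exact: cvg_cst.
have p0 := pi_gt0 R.
(* Off the endpoints the indicator is half the difference of the signs of [b - x] and [a - x], the
   form in which the arctangents converge. *)
have -> : \1_(`]a, b]%classic) x = pi^-1 * (Num.sg (b - x) * (pi / 2) - Num.sg (a - x) * (pi / 2)).
  have -> (u v : R) : pi^-1 * (u * (pi / 2) - v * (pi / 2)) = (u - v) / 2.
    have : pi != 0 :> R by rewrite gt_eqF.
    by move: (pi : R) => p pn; field.
  rewrite indicE mem_setE in_itv/=.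
  have [xa'|xa'|xa'] := ltgtP a x; last by rewrite xa' eqxx in xa.
  - rewrite (@ltr0_sg _ (a - x)) ?subr_lt0//.
    have [xb'|xb'|xb'] := ltgtP x b; last by rewrite xb' eqxx in xb.
      by rewrite gtr0_sg ?subr_gt0//= opprK divff.
    by rewrite ltr0_sg ?subr_lt0//= opprK addNr mul0r.
  - rewrite (@gtr0_sg _ (a - x)) ?subr_gt0// gtr0_sg ?subr_gt0 ?(lt_le_trans xa')//.
    by rewrite subrr mul0r.
rewrite (_ : (fun k => _) = fun k => pi^-1 * (atan ((k.+1%:R^-1)^-1 * (b - x)) - atan ((k.+1%:R^-1)^-1 * (a - x)))).
  apply: cvgM; first exact: cvg_cst.
  by apply: cvgB; apply: cvg_atan_scale; rewrite subr_eq0 eq_sym.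
by apply/funext => k; rewrite /poisson_itv /Rintegral integral_poisson_itv.
Qed.

End poisson_itv.

(** * Product kernels and boxes in several variables *)

Section product_kernels.
Variable R : realType.
Notation leb := (@lebesgue_measure R).
Notation mu := (lebesgue_rV R).

Lemma measurable_dot d (T : measurableType d) n (f g : T -> 'rV[R]_n) :
  measurable_fun setT f -> measurable_fun setT g ->
  measurable_fun setT (fun t => dot (f t) (g t)).
Proof.
move=> mf mg; apply: measurable_sum => i.
by apply: measurable_funM; exact: measurableT_comp (measurable_coord i) _.
Qed.

Lemma measurable_dotl n (z : 'rV[R]_n) : measurable_fun setT (fun x => dot x z).
Proof. by apply: measurable_dot => //; exact: measurable_id. Qed.

Lemma measurable_dotr n (z : 'rV[R]_n) : measurable_fun setT (dot z).
Proof. by apply: measurable_dot => //; exact: measurable_id. Qed.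

Lemma dotC n (x y : 'rV[R]_n) : dot x y = dot y x.
Proof. by apply: eq_bigr => i _; rewrite mulrC. Qed.

Lemma dotBl n (x y z : 'rV[R]_n) : dot (x - y) z = dot x z - dot y z.
Proof. by rewrite -sumrB; apply: eq_bigr => i _; rewrite !mxE mulrBl. Qed.

Lemma dotDl n (x y z : 'rV[R]_n) : dot (x + y) z = dot x z + dot y z.
Proof. by rewrite -big_split; apply: eq_bigr => i _; rewrite !mxE mulrDl. Qed.

Lemma dot_cons n (z : 'rV[R]_n.+1) x y :
  dot z (cons_rV (x, y)) = z ord0 ord0 * x + dot (uncons_rV z).2 y.
Proof.
rewrite /dot big_ord_recl cons_rV0; congr (_ + _).
by apply: eq_bigr => i _; rewrite cons_rVS mxE.
Qed.

Lemma measurable_prod_coord n (h : 'I_n -> R -> R) :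
  (forall i, measurable_fun setT (h i)) ->
  measurable_fun setT (fun v : 'rV[R]_n => \prod_i h i (v ord0 i)).
Proof.
move=> mh; apply: measurable_prod => i _.
exact: measurableT_comp (mh i) (measurable_coord i).
Qed.

Lemma ge0_integral_prod_coord n (h : 'I_n -> R -> R) :
  (forall i, measurable_fun setT (h i)) -> (forall i x, 0 <= h i x) ->
  (\int[mu n]_v (\prod_i h i (v ord0 i))%:E = \prod_i \int[leb]_x (h i x)%:E)%E.
Proof.
elim: n h => [|n IH] h mh h0.
  rewrite big_ord0 integral_dirac//; last first.
    by apply/measurable_EFinP; exact: (measurable_prod_coord mh).
  by rewrite diracT mul1e big_ord0.
have m1 : measurable_fun setT (fun v : 'rV[R]_n.+1 => (\prod_i h i (v ord0 i))%:E).
  by apply/measurable_EFinP; exact: measurable_prod_coord.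
rewrite ge0_integral_rVS//; last by move=> v; rewrite lee_fin prodr_ge0.
transitivity (\int[leb]_x ((h ord0 x)%:E * \prod_(i < n) \int[leb]_y (h (lift ord0 i) y)%:E))%E.
  apply: eq_integral => x _; rewrite -IH//.
  rewrite -ge0_integralZl//; last 3 first.
  - by apply/measurable_EFinP; exact: (measurable_prod_coord (h := fun i => h (lift ord0 i))).
  - by move=> v _; rewrite lee_fin prodr_ge0.
  - by rewrite lee_fin.
  apply: eq_integral => v _; rewrite -EFinM big_ord_recl cons_rV0; congr (_ * _)%:E.
  by apply: eq_bigr => i _; rewrite cons_rVS.
rewrite ge0_integralZr//.
- by rewrite big_ord_recl.
- by apply/measurable_EFinP; exact: mh.
- by move=> x _; rewrite lee_fin.
- by apply: prode_ge0 => i _; apply: integral_ge0 => x _; rewrite lee_fin.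
Qed.

(** Decays with the l1 norm rather than radially, so that integrals against it factor over the
    coordinates. *)
Definition laplace_rV n e (v : 'rV[R]_n) := \prod_i laplace e (v ord0 i).

Definition poisson_rV n e (v : 'rV[R]_n) := \prod_i poisson e (v ord0 i).

Lemma laplace_rV_ge0 n e (v : 'rV[R]_n) : 0 <= laplace_rV e v.
Proof. by apply: prodr_ge0 => i _; exact: laplace_ge0. Qed.

Lemma measurable_laplace_rV n e : measurable_fun setT (@laplace_rV n e).
Proof. by apply: (measurable_prod_coord (h := fun=> laplace e)) => i; exact: measurable_laplace. Qed.

Lemma laplace_rV_L1 n e : 0 < e -> L1 (mu n) (laplace_rV e).
Proof.
move=> e0; apply/integrableP; split.
  by apply/measurable_EFinP; exact: measurable_laplace_rV.
under eq_integral do rewrite /= ger0_norm ?laplace_rV_ge0//.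
rewrite (ge0_integral_prod_coord (h := fun=> laplace e)); last 2 first.
- by move=> i; exact: measurable_laplace.
- by move=> i x; exact: laplace_ge0.
under eq_bigr do rewrite -EFin_Rint ?laplace_L1//.
by rewrite prodEFin ltry.
Qed.

(** Induction on the dimension. The phase must be arbitrary, since the first coordinate is moved
    into it. *)
Lemma Rint_laplace_rV_cos n e (z : 'rV[R]_n) (th : R) : 0 < e ->
  \int[mu n]_v (laplace_rV e v * cos (2 * pi * dot z v + th)) = cos th * poisson_rV e z.
Proof.
move=> e0.
have mc m (z' : 'rV[R]_m) th' : measurable_fun setT (fun v => cos (2 * pi * dot z' v + th')).
  apply: measurableT_comp; first exact: continuous_measurable_fun (@continuous_cos R).
  by apply: measurable_funD => //; apply: measurable_funM => //; exact: measurable_dotr.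
elim: n z th => [|n IH] z th.
  rewrite /Rintegral integral_dirac//; last first.
    by apply/measurable_EFinP; apply: measurable_funM; [exact: measurable_laplace_rV|exact: mc].
  by rewrite diracT mul1e /= /laplace_rV /poisson_rV /dot !big_ord0 mulr0 add0r mul1r mulr1.
rewrite (@Rint_rVS _ _ _ (laplace e) (laplace_rV e)); last 4 first.
- by apply: measurable_funM; [exact: measurable_laplace_rV|exact: mc].
- exact: laplace_L1.
- exact: laplace_rV_L1.
- move=> x y; rewrite {1}/laplace_rV big_ord_recl cons_rV0.
  under eq_bigr do rewrite cons_rVS.
  rewrite normrM -[leRHS]mulr1 ler_pM//.
    by rewrite ger0_norm// mulr_ge0 ?laplace_ge0// laplace_rV_ge0.
  by rewrite ler_norml cos_geN1 cos_le1.
(* For fixed first coordinate [x] the inner integral is the induction hypothesis with phase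
   [2 * pi * z ord0 ord0 * x + th]. *)
transitivity (\int[leb]_x (laplace e x * cos (2 * pi * z ord0 ord0 * x + th) *
    poisson_rV e (uncons_rV z).2)).
  congr Rintegral; apply/funext => x; rewrite -mulrA -IH -RintegralZl//; last first.
    apply: L1_le (laplace_rV_L1 n e0); first by apply: measurable_funM; [exact: measurable_laplace_rV|exact: mc].
    move=> v; rewrite normrM (ger0_norm (laplace_rV_ge0 _ _)) -[leRHS]mulr1 ler_wpM2l ?laplace_rV_ge0//.
    by rewrite ler_norml cos_geN1 cos_le1.
  congr Rintegral; apply/funext => y; rewrite {1}/laplace_rV big_ord_recl cons_rV0.
  under eq_bigr do rewrite cons_rVS.
  rewrite dot_cons -mulrA; congr (_ * (_ * cos _)); ring.
rewrite RintegralZr//; last first.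
  apply: L1_le (laplace_L1 e0).
    apply: measurable_funM; first exact: measurable_laplace.
    apply: measurableT_comp; first exact: continuous_measurable_fun (@continuous_cos R).
    by apply: measurable_funD => //; apply: measurable_funM.
  move=> v; rewrite normrM (ger0_norm (laplace_ge0 _ _)) -[leRHS]mulr1 ler_wpM2l ?laplace_ge0//.
  by rewrite ler_norml cos_geN1 cos_le1.
rewrite Rint_laplace_cos// /poisson_rV big_ord_recl -mulrA; congr (_ * (_ * _)).
by apply: eq_bigr => i _; rewrite mxE.
Qed.

Lemma poisson_rV_ge0 n e (v : 'rV[R]_n) : 0 < e -> 0 <= poisson_rV e v.
Proof. by move=> e0; apply: prodr_ge0 => i _; exact: poisson_ge0. Qed.

Lemma poisson_rV_le n e (v : 'rV[R]_n) : 0 < e -> poisson_rV e v <= (pi * e)^-1 ^+ n.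
Proof.
move=> e0; rewrite /poisson_rV -[X in _ ^+ X]card_ord -prodr_const.
by apply: ler_prod => i _; rewrite poisson_ge0//= poisson_le.
Qed.

Lemma measurable_poisson_rVB d (T : measurableType d) n e (f g : T -> 'rV[R]_n) : 0 < e ->
  measurable_fun setT f -> measurable_fun setT g ->
  measurable_fun setT (fun t => poisson_rV e (f t - g t)).
Proof.
move=> e0 mf mg; apply: measurable_prod => i _.
apply: measurableT_comp; first exact: continuous_measurable_fun (continuous_poisson e0).
under eq_fun do rewrite !mxE.
by apply: measurable_funB; exact: measurableT_comp (measurable_coord i) _.
Qed.

Lemma poisson_rVC n e (x y : 'rV[R]_n) : poisson_rV e (x - y) = poisson_rV e (y - x).
Proof. by apply: eq_bigr => i _; rewrite !mxE -poissonN opprB. Qed.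

Lemma integral_poisson_rV n e (x : 'rV[R]_n) : 0 < e ->
  (\int[mu n]_y (poisson_rV e (x - y))%:E = 1)%E.
Proof.
move=> e0; under eq_integral.
  move=> y _; rewrite (_ : poisson_rV _ _ = \prod_i poisson e (x ord0 i - y ord0 i)); last first.
    by apply: eq_bigr => i _; rewrite !mxE.
  over.
rewrite (ge0_integral_prod_coord (h := fun i y => poisson e (x ord0 i - y))); last 2 first.
- by move=> i; exact: measurable_poissonB.
- by move=> i y; exact: poisson_ge0.
by apply: big1 => i _; exact: integral_poisson.
Qed.

Definition box n (a b : 'rV[R]_n) : set 'rV[R]_n :=
  [set v | forall i, `]a ord0 i, b ord0 i]%classic (v ord0 i)].

Lemma measurable_box n (a b : 'rV[R]_n) : measurable (box a b).
Proof. by apply: (@measurable_rV_box R n (fun i => `]a ord0 i, b ord0 i]%classic)). Qed.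

Lemma indic_box n (a b v : 'rV[R]_n) :
  \1_(box a b) v = \prod_i \1_(`]a ord0 i, b ord0 i]%classic) (v ord0 i) :> R.
Proof.
have [vB|] := pselect (box a b v).
  rewrite indicE mem_set// big1// => i _; rewrite indicE mem_set//; exact: vB.
move=> vB; rewrite indicE memNset//.
move/existsNP : vB => [i vi]; rewrite (bigD1 i)//= indicE memNset//.
by rewrite mul0r.
Qed.

Lemma integral_poisson_rV_box n e (x a b : 'rV[R]_n) : 0 < e ->
  (\int[mu n]_(y in box a b) (poisson_rV e (x - y))%:E =
   (\prod_i poisson_itv e (a ord0 i) (b ord0 i) (x ord0 i))%:E)%E.
Proof.
move=> e0; rewrite integral_mkcond.
transitivity (\int[mu n]_y (\prod_i (poisson e (x ord0 i - y ord0 i) *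
    \1_(`]a ord0 i, b ord0 i]%classic) (y ord0 i)))%:E)%E.
  apply: eq_integral => y _; rewrite big_split/= -indic_box patchE indicE.
  case: (y \in _); rewrite ?mulr1 ?mulr0//; congr EFin.
  by apply: eq_bigr => i _; rewrite !mxE.
rewrite (ge0_integral_prod_coord (h := fun i y => poisson e (x ord0 i - y) * \1_(`]a ord0 i, b ord0 i]%classic) y)).
- rewrite -prodEFin; apply: eq_bigr => i _; rewrite EFin_poisson_itv// [RHS]integral_mkcond.
  apply: eq_integral => y _; rewrite patchE indicE.
  by case: (y \in _); rewrite ?mulr1 ?mulr0.
- move=> i; apply: measurable_funM; first exact: measurable_poissonB.
  exact: measurable_indic.
- by move=> i y; rewrite mulr_ge0 ?poisson_ge0.
Qed.

(** The hyperplanes carrying the faces contain every point at which the Poisson integrals of the box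
    may miss its indicator. *)
Lemma box_bnd_null n (a b : 'rV[R]_n) :
  {ae mu n, forall v : 'rV[R]_n, forall i, v ord0 i != a ord0 i /\ v ord0 i != b ord0 i}.
Proof.
suff H i : {ae mu n, forall v : 'rV[R]_n, v ord0 i != a ord0 i /\ v ord0 i != b ord0 i}.
  exact: filter_forall.
have N c : {ae mu n, forall v : 'rV[R]_n, v ord0 i != c}.
  exists [set v : 'rV[R]_n | v ord0 i = c]; split.
  - rewrite -[X in measurable X]setTI.
    by apply: (measurable_coord i _ (measurable_set1 c)).
  (* A hyperplane is a box with one side reduced to a point and the others infinite; the zero factor
     annihilates the product. *)
  - pose A j : set R := if j == i then [set c] else setT.
    rewrite (_ : [set _ | _] = [set v : 'rV[R]_n | forall j, A j (v ord0 j)]).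
      rewrite lebesgue_rV_box; last by move=> j; rewrite /A; case: ifP.
      by rewrite (bigD1 i)//= /A eqxx lebesgue_measure_set1 mul0e.
    apply/seteqP; split => v /=.
      by move=> vi j; rewrite /A; case: ifP => // /eqP ->.
    by move=> /(_ i); rewrite /A eqxx.
  - by move=> v /= /negP; rewrite negbK => /eqP.
by apply: filterS2 (N (a ord0 i)) (N (b ord0 i)).
Qed.

Lemma cvg_poisson_rV_box n (a b : 'rV[R]_n) : {ae mu n, forall v : 'rV[R]_n,
  \prod_i poisson_itv k.+1%:R^-1 (a ord0 i) (b ord0 i) (v ord0 i) @[k --> \oo] --> (\1_(box a b) v : R)}.
Proof.
apply: filterS (box_bnd_null a b) => v vab; rewrite indic_box.
apply: cvg_big; first exact: mul_continuous.
by move=> i _; have [? ?] := vab i; exact: cvg_poisson_itv.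
Qed.

End product_kernels.

(** * The Hartley transform *)

Section hartley.
Variables (R : realType) (n : nat).
Notation mu := (lebesgue_rV R n).
Notation V := 'rV[R]_n.
Implicit Types (f g : V -> R) (x y xi : V) (e : R).

Definition cas (t : R) : R := cos t + sin t.

Lemma cas_le2 t : `|cas t| <= 2.
Proof.
rewrite (le_trans (ler_normD _ _))// -[leRHS](_ : 1 + 1 = 2)//.
by rewrite lerD// ler_norml ?cos_geN1 ?cos_le1 ?sin_geN1 ?sin_le1.
Qed.

(** The last term is [sin (s + t)] written as a cosine, so that [Rint_laplace_rV_cos] covers both
    terms and its factor [cos th] is 0 for the second. *)
Lemma casM s t : cas s * cas t = cos (s - t) + cos (s + t + - (pi / 2)).
Proof. by rewrite cosB cosD cosN sinN cos_pihalf sin_pihalf sinD /cas; ring. Qed.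

Lemma measurable_cas d (T : measurableType d) (u : T -> R) :
  measurable_fun setT u -> measurable_fun setT (fun t => cas (u t)).
Proof.
move=> mu'; apply: measurable_funD; apply: measurableT_comp mu'.
  exact: continuous_measurable_fun (@continuous_cos R).
exact: continuous_measurable_fun (@continuous_sin R).
Qed.

Lemma measurable_cas_dot d (T : measurableType d) (u v : T -> V) :
  measurable_fun setT u -> measurable_fun setT v ->
  measurable_fun setT (fun t => cas (2 * pi * dot (u t) (v t))).
Proof.
by move=> mu' mv; apply: measurable_cas; apply: measurable_funM => //; exact: measurable_dot.
Qed.

Definition hartley f xi := \int[mu]_x (f x * cas (2 * pi * dot x xi)).

Lemma L1_cas f xi : L1 mu f -> L1 mu (fun x => f x * cas (2 * pi * dot x xi)).
Proof.
move=> If; under [X in L1 _ X]eq_fun do rewrite mulrC.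
apply: (@L1_bounded _ _ _ _ _ _ 2) => //; last by move=> x; exact: cas_le2.
by apply: measurable_cas_dot; [exact: measurable_id|exact: measurable_cst].
Qed.

Lemma hartley_le f xi : L1 mu f -> `|hartley f xi| <= 2 * \int[mu]_x `|f x|.
Proof.
move=> If; have Ifc := L1_cas xi If; have If2 := L1_norm If.
rewrite (le_trans (le_normr_Rintegral _ Ifc))// -RintegralZl//.
apply: le_Rintegral => //; [exact: L1_norm|exact: L1Z|].
by move=> x _; rewrite normrM mulrC ler_wpM2r// cas_le2.
Qed.

Lemma hartleyD f g : L1 mu f -> L1 mu g -> hartley (f \+ g) = hartley f \+ hartley g.
Proof.
move=> If Ig; apply/funext => xi; rewrite /hartley /=.
rewrite -RintegralD//; [|exact: L1_cas|exact: L1_cas].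
by congr Rintegral; apply/funext => x; rewrite mulrDl.
Qed.

Lemma hartleyZ (r : R) f : L1 mu f -> hartley (fun x => r * f x) = fun xi => r * hartley f xi.
Proof.
move=> If; apply/funext => xi; rewrite /hartley -RintegralZl//; last exact: L1_cas.
by congr Rintegral; apply/funext => x; rewrite mulrA.
Qed.

Lemma hartleyB f g : L1 mu f -> L1 mu g -> hartley (f \- g) = hartley f \- hartley g.
Proof.
move=> If Ig; apply/funext => xi; rewrite /hartley /=.
rewrite -RintegralB//; [|exact: L1_cas|exact: L1_cas].
by congr Rintegral; apply/funext => x; rewrite mulrBl.
Qed.

Lemma L1_laplaceM e g (M : R) : 0 < e -> measurable_fun setT g -> (forall x, `|g x| <= M) ->
  L1 mu (fun x => laplace_rV e x * g x).
Proof.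
move=> e0 mg gM; under [X in L1 _ X]eq_fun do rewrite mulrC.
exact: L1_bounded mg gM (laplace_rV_L1 n e0).
Qed.

(** Fubini gives measurability only for integrals that are integrable in [xi]; a Laplace weight
    makes the transform so and is divided out afterwards. *)
Lemma measurable_hartley f : L1 mu f -> measurable_fun setT (hartley f).
Proof.
move=> If.
have e0 : 0 < 1 :> R by [].
have mw := @measurable_laplace_rV R n 1.
have : L1 mu (fun xi => \int[mu]_x (laplace_rV 1 xi * (f x * cas (2 * pi * dot x xi)))).
  apply: (@L1_fubini1 _ _ _ _ _ mu mu
     (fun z : V * V => laplace_rV 1 z.1 * (f z.2 * cas (2 * pi * dot z.2 z.1)))
     (laplace_rV 1) (fun x => `|f x| * 2)).
  - apply: measurable_funM; first exact: measurableT_comp mw measurable_fst.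
    apply: measurable_funM; first exact: measurableT_comp (L1_measurable If) measurable_snd.
    by apply: measurable_cas_dot; [exact: measurable_snd|exact: measurable_fst].
  - exact: laplace_rV_L1.
  - under [X in L1 _ X]eq_fun do rewrite mulrC.
    by apply: L1Z; exact: L1_norm.
  - move=> x y /=; rewrite normrM (ger0_norm (laplace_rV_ge0 _ _)).
    by rewrite ler_wpM2l ?laplace_rV_ge0// normrM ler_wpM2l// cas_le2.
move=> /L1_measurable m1.
(* [laplace_rV (-1)] is the pointwise inverse of [laplace_rV 1]. *)
rewrite (_ : hartley f = fun xi => laplace_rV (-1) xi *
   \int[mu]_x (laplace_rV 1 xi * (f x * cas (2 * pi * dot x xi)))).
  by apply: measurable_funM => //; exact: measurable_laplace_rV.
apply/funext => xi; rewrite RintegralZl//; last exact: L1_cas.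
rewrite mulrA -big_split/= big1 ?mul1r// => i _.
by rewrite /laplace -expRD mulrN1 mulr1 opprK mulNr subrr expR0.
Qed.

(** Damped inversion. After Fubini, [casM] splits the product of the two kernels: the cosine of the
    difference integrates to the Poisson kernel at [x - y], the sine of the sum to 0. *)
Lemma Rint_laplace_hartley e g x : 0 < e -> L1 mu g ->
  \int[mu]_xi (laplace_rV e xi * hartley g xi * cas (2 * pi * dot xi x)) =
  \int[mu]_y (g y * poisson_rV e (x - y)).
Proof.
move=> e0 Ig; have mw := @measurable_laplace_rV R n e; have Iw := laplace_rV_L1 n e0.
pose h (z : V * V) := laplace_rV e z.1 * cas (2 * pi * dot z.1 x) * (g z.2 * cas (2 * pi * dot z.2 z.1)).
transitivity (\int[mu]_xi \int[mu]_y h (xi, y)).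
  congr Rintegral; apply/funext => xi; rewrite /h /= RintegralZl//; last exact: L1_cas.
  by rewrite mulrAC.
rewrite (@Rint_Fubini _ _ _ _ _ mu mu h (fun xi => 2 * laplace_rV e xi) (fun y => 2 * `|g y|)).
- congr Rintegral; apply/funext => y.
  have Iwc th (z : V) : L1 mu (fun xi => laplace_rV e xi * cos (2 * pi * dot z xi + th)).
    apply: (@L1_laplaceM _ _ 1) => //; last by move=> xi; rewrite ler_norml cos_geN1 cos_le1.
    apply: measurableT_comp; first exact: continuous_measurable_fun (@continuous_cos R).
    by apply: measurable_funD => //; apply: measurable_funM => //; exact: measurable_dotr.
  rewrite (_ : (fun xi => _) = fun xi => g y * (laplace_rV e xi * cos (2 * pi * dot (x - y) xi + 0) +
      laplace_rV e xi * cos (2 * pi * dot (x + y) xi + - (pi / 2)))); last first.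
    apply/funext => xi; rewrite /h /= -mulrDr.
    have -> : 2 * pi * dot (x - y) xi + 0 = 2 * pi * dot x xi - 2 * pi * dot y xi.
      by rewrite dotBl; ring.
    have -> : 2 * pi * dot (x + y) xi = 2 * pi * dot x xi + 2 * pi * dot y xi.
      by rewrite dotDl; ring.
    rewrite -casM (dotC xi).
    by move: (cas _) (cas _) => c1 c2; ring.
  rewrite RintegralZl//; last by apply: L1D; exact: Iwc.
  rewrite RintegralD//; [|exact: Iwc|exact: Iwc].
  by rewrite !Rint_laplace_rV_cos// cos0 mul1r cosN cos_pihalf mul0r addr0.
- apply: measurable_funM; last apply: measurable_funM.
  + apply: measurable_funM; first exact: measurableT_comp mw measurable_fst.
    by apply: measurable_cas_dot; [exact: measurable_fst|exact: measurable_cst].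
  + exact: measurableT_comp (L1_measurable Ig) measurable_snd.
  + by apply: measurable_cas_dot; [exact: measurable_snd|exact: measurable_fst].
- exact: L1Z.
- by apply: L1Z; exact: L1_norm.
- move=> xi y; rewrite /h /= !normrM (ger0_norm (laplace_rV_ge0 _ _)).
  rewrite [2 * laplace_rV _ _]mulrC [2 * `|g y|]mulrC ler_pM//.
  + by rewrite mulr_ge0 ?laplace_rV_ge0.
  + by rewrite ler_wpM2l ?laplace_rV_ge0 ?cas_le2.
  + by rewrite ler_wpM2l ?cas_le2.
Qed.

(** Fubini, as the kernel is symmetric in its two variables. *)
Lemma Rint_multiplication f g : L1 mu f -> L1 mu g ->
  \int[mu]_xi (f xi * hartley g xi) = \int[mu]_x (g x * hartley f x).
Proof.
move=> If Ig.
pose h (z : V * V) := f z.1 * (g z.2 * cas (2 * pi * dot z.2 z.1)).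
transitivity (\int[mu]_xi \int[mu]_y h (xi, y)).
  congr Rintegral; apply/funext => xi; rewrite /h /= RintegralZl//; exact: L1_cas.
rewrite (@Rint_Fubini _ _ _ _ _ mu mu h (fun xi => `|f xi|) (fun y => 2 * `|g y|)).
- congr Rintegral; apply/funext => y; rewrite /h /= -RintegralZl//; last exact: L1_cas.
  by congr Rintegral; apply/funext => xi; rewrite dotC; ring.
- apply: measurable_funM; last apply: measurable_funM.
  + exact: measurableT_comp (L1_measurable If) measurable_fst.
  + exact: measurableT_comp (L1_measurable Ig) measurable_snd.
  + by apply: measurable_cas_dot; [exact: measurable_snd|exact: measurable_fst].
- exact: L1_norm.
- by apply: L1Z; exact: L1_norm.
- by move=> xi y; rewrite /h /= !normrM ler_wpM2l// mulrC ler_wpM2r// cas_le2.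
Qed.

Lemma L1_laplace_hartley e g : 0 < e -> L1 mu g -> L1 mu (fun xi => laplace_rV e xi * hartley g xi).
Proof.
move=> e0 Ig; apply: L1_laplaceM => //; first exact: measurable_hartley.
by move=> x; exact: hartley_le.
Qed.

(** Damped form of Parseval's identity; the limit [e -> 0] of its two sides drives all that follows,
    including the inversion theorem. *)
Lemma Rint_laplace_hartley2 e f g : 0 < e -> L1 mu f -> L1 mu g ->
  \int[mu]_xi (laplace_rV e xi * hartley g xi * hartley f xi) =
  \int[mu]_x (f x * \int[mu]_y (g y * poisson_rV e (x - y))).
Proof.
move=> e0 If Ig; rewrite Rint_multiplication//; last exact: L1_laplace_hartley.
congr Rintegral; apply/funext => x; congr (_ * _).
by rewrite -Rint_laplace_hartley.
Qed.

(** On this class the transform is an actual integral and Bessel's inequality holds. *)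
Definition L12 f := L1 mu f /\ sqL1 mu f.

Lemma L1_poisson e g x : 0 < e -> L1 mu g -> L1 mu (fun y => g y * poisson_rV e (x - y)).
Proof.
move=> e0 Ig; under [X in L1 _ X]eq_fun do rewrite mulrC.
apply: (@L1_bounded _ _ _ _ _ _ ((pi * e)^-1 ^+ n)) => //.
  exact: measurable_poisson_rVB.
by move=> y; rewrite ger0_norm ?poisson_rV_ge0// poisson_rV_le.
Qed.

(** Schur's test: [2 f x f y <= f x ^ 2 + f y ^ 2] is integrated against a kernel of mass 1 in each
    variable. [M] is the Poisson average of [f ^ 2]. *)
Lemma Rint_poisson2_le e f : 0 < e -> L12 f ->
  \int[mu]_x (f x * \int[mu]_y (f y * poisson_rV e (x - y))) <= \int[mu]_x (f x ^+ 2).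
Proof.
move=> e0 [If [mf If2]].
pose M x := \int[mu]_y (f y ^+ 2 * poisson_rV e (x - y)).
have M0 x : 0 <= M x.
  by apply: Rintegral_ge0 => y _; rewrite mulr_ge0 ?sqr_ge0 ?poisson_rV_ge0.
have mK : measurable_fun setT (fun z : V * V => poisson_rV e (z.1 - z.2)).
  exact: measurable_poisson_rVB.
have mf2K : measurable_fun setT (fun z : V * V => (f z.2 ^+ 2 * poisson_rV e (z.1 - z.2))%:E).
  apply/measurable_EFinP; apply: measurable_funM => //.
  by apply: measurable_funX; exact: measurableT_comp mf measurable_snd.
have f2K0 (z : V * V) : (0 <= (f z.2 ^+ 2 * poisson_rV e (z.1 - z.2))%:E)%E.
  by rewrite lee_fin mulr_ge0 ?sqr_ge0 ?poisson_rV_ge0.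
have ME x : (M x)%:E = (\int[mu]_y (f y ^+ 2 * poisson_rV e (x - y))%:E)%E.
  by rewrite EFin_Rint//; exact: L1_poisson.
have mM : measurable_fun setT M.
  apply/measurable_EFinP; rewrite (_ : EFin \o M = fun x => (\int[mu]_y (f y ^+ 2 * poisson_rV e (x - y))%:E)%E).
    exact: (measurable_fun_fubini_tonelli_F _ mf2K).
  by apply/funext => x /=; exact: ME.
(* Tonelli, and the mass of the kernel in its first variable, which is 1 by symmetry. *)
have IME : (\int[mu]_x (M x)%:E = \int[mu]_x (f x ^+ 2)%:E)%E.
  under eq_integral do rewrite ME.
  rewrite (fubini_tonelli _ mf2K)//.
  apply: eq_integral => y _ /=.
  under eq_integral do rewrite EFinM.
  rewrite ge0_integralZl ?lee_fin ?sqr_ge0//.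
  - under eq_integral do rewrite poisson_rVC.
    by rewrite integral_poisson_rV// mule1.
  - apply/measurable_EFinP.
    exact: measurable_poisson_rVB.
  - by move=> x _; rewrite lee_fin poisson_rV_ge0.
have IM : L1 mu M.
  apply/integrableP; split; first exact/measurable_EFinP.
  under eq_integral do rewrite /= ger0_norm//.
  by rewrite IME -EFin_Rint// ltry.
have RM : \int[mu]_x M x = \int[mu]_x (f x ^+ 2) by rewrite /Rintegral IME.
have -> : \int[mu]_x (f x ^+ 2) = \int[mu]_x (2^-1 * (f x ^+ 2 + M x)).
  rewrite RintegralZl//; last exact: L1D.
  by rewrite RintegralD// RM; field.
have pw x : f x * \int[mu]_y (f y * poisson_rV e (x - y)) <= 2^-1 * (f x ^+ 2 + M x).
  have IK : \int[mu]_y poisson_rV e (x - y) = 1 by rewrite /Rintegral integral_poisson_rV.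
  have LK : L1 mu (fun y => poisson_rV e (x - y)).
    apply/integrableP; split.
      apply/measurable_EFinP.
      exact: measurable_poisson_rVB.
    under eq_integral do rewrite /= ger0_norm ?poisson_rV_ge0//.
    by rewrite integral_poisson_rV// ltry.
  have -> : f x ^+ 2 + M x = \int[mu]_y (f x ^+ 2 * poisson_rV e (x - y) + f y ^+ 2 * poisson_rV e (x - y)).
    by rewrite RintegralD//; [rewrite RintegralZl// IK mulr1|exact: L1Z|exact: L1_poisson].
  rewrite -RintegralZl//; last exact: L1_poisson.
  rewrite -RintegralZl//; last by apply: L1D; [exact: L1Z|exact: L1_poisson].
  apply: le_Rintegral => //.
  - by apply: L1Z; exact: L1_poisson.
  - by apply: L1Z; apply: L1D; [exact: L1Z|exact: L1_poisson].
  - move=> y _; have := poisson_rV_ge0 (x - y) e0; have := sqr_ge0 (f x - f y).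
    move: (f x) (f y) (poisson_rV _ _) => a b c; nra.
(* The inner integral is the transform of an integrable function, hence bounded. *)
have IG : L1 mu (fun x => f x * \int[mu]_y (f y * poisson_rV e (x - y))).
  have GE x : \int[mu]_y (f y * poisson_rV e (x - y)) = hartley (fun xi => laplace_rV e xi * hartley f xi) x.
    by rewrite -Rint_laplace_hartley.
  have Iwh := L1_laplace_hartley e0 If.
  under [X in L1 _ X]eq_fun do rewrite GE mulrC.
  apply: L1_bounded If; first exact: measurable_hartley.
  by move=> x; exact: hartley_le.
apply: le_Rintegral => //.
by apply: L1Z; exact: L1D.
Qed.

Lemma laplace_rV_cvg xi : laplace_rV k.+1%:R^-1 xi @[k --> \oo] --> (1 : R).
Proof.
rewrite [X in _ --> X](_ : 1 = \prod_(i < n) (1 : R)); last by rewrite big1.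
apply: cvg_big; first exact: mul_continuous.
move=> i _; have H : - (2 * pi * k.+1%:R^-1) * `|xi ord0 i| @[k --> \oo] --> (0 : R).
  rewrite [X in _ --> X](_ : 0 = - (2 * pi * 0) * `|xi ord0 i|); last by rewrite mulr0 oppr0 mul0r.
  apply: cvgM; last exact: cvg_cst.
  by apply: cvgN; apply: cvgM; [exact: cvg_cst|exact: cvg_harmonic].
rewrite -[X in _ --> X](expR0 R).
exact: (continuous_cvg _ (@continuous_expR R 0) H).
Qed.

Lemma laplace_rV_nd xi (k m : nat) : (k <= m)%N ->
  laplace_rV k.+1%:R^-1 xi <= laplace_rV m.+1%:R^-1 xi.
Proof.
move=> km; apply: ler_prod => i _; rewrite laplace_ge0/= ler_expR !mulNr lerN2.
rewrite ler_wpM2r// ler_wpM2l ?mulr_ge0 ?pi_ge0// lef_pV2 ?posrE// ler_nat ltnS//.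
Qed.

Lemma laplace_rV_le1 (k : nat) xi : laplace_rV k.+1%:R^-1 xi <= 1.
Proof.
rewrite -[leRHS](_ : \prod_(i < n) (1 : R) = 1); last by rewrite big1.
apply: ler_prod => i _; rewrite laplace_ge0/= -expR0 ler_expR mulNr oppr_le0.
by rewrite !mulr_ge0 ?pi_ge0 ?invr_ge0.
Qed.

(** Monotone convergence: the weights increase to 1, and each damped integral is a Poisson form
    bounded by [Rint_poisson2_le]. The resulting L2 continuity of [hartley] is what lets Parseval's
    identity pass to limits. *)
Lemma Bessel f : L12 f -> sqL1 mu (hartley f) /\
  \int[mu]_xi (hartley f xi ^+ 2) <= \int[mu]_x (f x ^+ 2).
Proof.
move=> [If sf]; have mH := measurable_hartley If.
pose g (k : nat) xi := (laplace_rV k.+1%:R^-1 xi * hartley f xi ^+ 2)%:E.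
have g0 k xi : (0 <= g k xi)%E by rewrite lee_fin mulr_ge0 ?laplace_rV_ge0 ?sqr_ge0.
have mg k : measurable_fun setT (g k).
  apply/measurable_EFinP; apply: measurable_funM; first exact: measurable_laplace_rV.
  exact: measurable_funX.
have gnd xi : {homo g ^~ xi : k m / (k <= m)%N >-> (k <= m)%E}.
  by move=> k m km; rewrite lee_fin ler_wpM2r ?sqr_ge0// laplace_rV_nd.
have glim xi : (limn (g ^~ xi) = (hartley f xi ^+ 2)%:E)%E.
  apply/cvg_lim => //; apply: cvg_EFin; first exact: nearW.
  rewrite -[X in _ --> X]mul1r; apply: cvgM; last exact: cvg_cst.
  exact: laplace_rV_cvg.
have gle k : (\int[mu]_xi g k xi <= (\int[mu]_x (f x ^+ 2))%:E)%E.
  have e0 : 0 < k.+1%:R^-1 :> R by [].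
  have E : (fun xi => laplace_rV k.+1%:R^-1 xi * hartley f xi * hartley f xi) =
     (fun xi => laplace_rV k.+1%:R^-1 xi * hartley f xi ^+ 2).
    by apply/funext => xi; rewrite expr2 mulrA.
  have := Rint_laplace_hartley2 e0 If If; rewrite E => EI.
  rewrite -EFin_Rint; last first.
    apply: (@L1_laplaceM _ _ ((2 * \int[mu]_x `|f x|) ^+ 2)) => //; first exact: measurable_funX.
    by move=> xi; rewrite normrX lerXn2r ?nnegrE ?hartley_le// mulr_ge0// Rintegral_ge0.
  by rewrite lee_fin EI Rint_poisson2_le.
have C := @cvg_monotone_convergence _ _ _ mu _ measurableT g mg (fun k x _ => g0 k x) (fun x _ => gnd x).
have le : (\int[mu]_xi (hartley f xi ^+ 2)%:E <= (\int[mu]_x (f x ^+ 2))%:E)%E.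
  under eq_integral do rewrite -glim.
  rewrite -(cvg_lim _ C)//; apply: lime_le; first by apply/cvg_ex; eexists; exact: C.
  exact: nearW.
have I2 : L1 mu (fun xi => hartley f xi ^+ 2).
  apply/integrableP; split; first by apply/measurable_EFinP; exact: measurable_funX.
  under eq_integral do rewrite /= ger0_norm ?sqr_ge0//.
  by rewrite (le_lt_trans le)// ltry.
by split; [split|rewrite -lee_fin EFin_Rint].
Qed.

Lemma L12D f g : L12 f -> L12 g -> L12 (f \+ g).
Proof. by move=> [? ?] [? ?]; split; [exact: L1D|exact: sqL1D]. Qed.

Lemma L12B f g : L12 f -> L12 g -> L12 (f \- g).
Proof. by move=> [? ?] [? ?]; split; [exact: L1B|exact: sqL1B]. Qed.

Lemma L12Z (r : R) f : L12 f -> L12 (fun x => r * f x).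
Proof. by move=> [? ?]; split; [exact: L1Z|exact: sqL1Z]. Qed.

Lemma L12_le f g : measurable_fun setT f -> (forall x, `|f x| <= `|g x|) -> L12 g -> L12 f.
Proof.
move=> mf fg [Ig sg]; split; last exact: sqL1_le sg.
by apply: L1_le (L1_norm Ig).
Qed.

Lemma cvgL2_hartley (f_ : nat -> V -> R) f : (forall k, L12 (f_ k)) -> L12 f ->
  cvgL2 mu f_ f -> cvgL2 mu (fun k => hartley (f_ k)) (hartley f).
Proof.
move=> Lf_ Lf; apply: squeeze_cvgr (cvg_cst 0).
apply: nearW => k; apply/andP; split.
  by apply: Rintegral_ge0 => x _; exact: sqr_ge0.
have := (Bessel (L12B (Lf_ k) Lf)).2.
by rewrite hartleyB//; [exact: (Lf_ k).1|exact: Lf.1].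
Qed.

Definition parseval f g := \int[mu]_xi (hartley f xi * hartley g xi) = \int[mu]_x (f x * g x).

(** Both sides are L2 continuous in [g]: the right one directly, the left one through Bessel's
    inequality. *)
Lemma parseval_lim f (g_ : nat -> V -> R) g : L12 f -> (forall k, L12 (g_ k)) -> L12 g ->
  (forall k, parseval f (g_ k)) -> cvgL2 mu g_ g -> parseval f g.
Proof.
move=> Lf Lg_ Lg Pg cg.
have c0 (h : V -> R) : cvgL2 mu (fun=> h) h.
  rewrite /cvgL2; under eq_fun do under eq_Rintegral do rewrite subrr expr0n/=.
  rewrite (_ : (fun _ : nat => _) = fun=> 0); first exact: cvg_cst.
  by apply/funext => k; rewrite Rintegral_cst// mul0r.
have H1 := @cvgL2_Rint _ _ _ mu (fun=> hartley f) (fun k => hartley (g_ k)) (hartley f) (hartley g)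
   (fun=> (Bessel Lf).1) (Bessel Lf).1 (fun k => (Bessel (Lg_ k)).1) (Bessel Lg).1
   (c0 _) (cvgL2_hartley Lg_ Lg cg).
have H2 := @cvgL2_Rint _ _ _ mu (fun=> f) g_ f g (fun=> Lf.2) Lf.2 (fun k => (Lg_ k).2) Lg.2 (c0 _) cg.
move: H1; under eq_fun do rewrite Pg.
by move=> H1; exact: (cvg_unique _ H1 H2).
Qed.

Lemma parsevalD f g h : L12 f -> L12 g -> L12 h -> parseval f g -> parseval f h -> parseval f (g \+ h).
Proof.
move=> Lf Lg Lh Pg Ph; rewrite /parseval hartleyD; [|exact: Lg.1|exact: Lh.1].
under eq_Rintegral do rewrite mulrDr.
under [RHS]eq_Rintegral do rewrite mulrDr.
rewrite RintegralD//; last 2 first.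
- by apply: sqL1M; exact: (Bessel _).1.
- by apply: sqL1M; exact: (Bessel _).1.
by rewrite RintegralD//; [rewrite Pg Ph|apply: sqL1M; [exact: Lf.2|exact: Lg.2]
  |apply: sqL1M; [exact: Lf.2|exact: Lh.2]].
Qed.

Lemma parsevalZ f (r : R) g : L12 f -> L12 g -> parseval f g -> parseval f (fun x => r * g x).
Proof.
move=> Lf Lg Pg; rewrite /parseval hartleyZ; last exact: Lg.1.
under eq_Rintegral do rewrite mulrCA.
under [RHS]eq_Rintegral do rewrite mulrCA.
rewrite RintegralZl//; last by apply: sqL1M; exact: (Bessel _).1.
by rewrite RintegralZl//; [rewrite Pg|apply: sqL1M; [exact: Lf.2|exact: Lg.2]].
Qed.

Lemma box_lty (a b : V) : (mu (box a b) < +oo)%E.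
Proof.
rewrite (@lebesgue_rV_box R n (fun i => `]a ord0 i, b ord0 i]%classic))//.
have fin i : lebesgue_measure `]a ord0 i, b ord0 i]%classic \is a fin_num.
  by rewrite lebesgue_measure_itv; case: ifP.
under eq_bigr do rewrite -(fineK (fin _)).
by rewrite prodEFin ltry.
Qed.

Lemma L12_indic (A : set V) : measurable A -> (mu A < +oo)%E -> L12 \1_A.
Proof.
move=> mA Aoo; split; first exact: L1_indic.
split; first exact: measurable_indic.
rewrite (_ : (fun x => _) = \1_A); first exact: L1_indic.
by apply/funext => x; rewrite indicE; case: (x \in A); rewrite ?expr1n ?expr0n.
Qed.

Lemma L12_indic_box (a b : V) (A : set V) : measurable A -> L12 \1_(A `&` box a b).
Proof.
move=> mA; have mAb : measurable (A `&` box a b) by apply: measurableI => //; exact: measurable_box.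
apply: L12_indic => //.
apply: le_lt_trans (box_lty a b); apply: le_measure; rewrite ?inE//; exact: measurable_box.
Qed.

End hartley.

(** * Parseval's identity for indicators *)

Section parseval_identity.
Variables (R : realType) (n : nat).
Notation mu := (lebesgue_rV R n).
Notation V := 'rV[R]_n.
Implicit Types (f g : V -> R) (x y xi : V) (e : R).

Lemma Rint_laplaceM_cvg f : L1 mu f ->
  \int[mu]_xi (laplace_rV k.+1%:R^-1 xi * f xi) @[k --> \oo] --> \int[mu]_xi f xi.
Proof.
move=> If; have mf := L1_measurable If.
apply: (@Rint_cvg _ _ _ mu (fun k xi => laplace_rV k.+1%:R^-1 xi * f xi) f
  (fun xi => `|f xi|) _ _ _ _ (L1_norm If)).2 => //.
- by move=> k; apply: measurable_funM => //; exact: measurable_laplace_rV.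
- apply: aeW => xi; rewrite -[X in _ --> X]mul1r; apply: cvgM; last exact: cvg_cst.
  exact: laplace_rV_cvg.
- move=> k xi; rewrite normrM (ger0_norm (laplace_rV_ge0 _ _)) -[leRHS]mul1r.
  by rewrite ler_wpM2r// laplace_rV_le1.
Qed.

Lemma Rint_indic_poisson e (a b x : V) : 0 < e ->
  \int[mu]_y (\1_(box a b) y * poisson_rV e (x - y)) =
  \prod_i poisson_itv e (a ord0 i) (b ord0 i) (x ord0 i).
Proof.
move=> e0; rewrite -[RHS]/(fine _%:E) -integral_poisson_rV_box// [in RHS]integral_mkcond.
congr fine; apply: eq_integral => y _; rewrite patchE indicE.
by case: (y \in _); rewrite ?mul1r ?mul0r.
Qed.

(** Dominated convergence: the Poisson integral of a box indicator lies in [[0, 1]] and converges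
    off the faces. *)
Lemma Rint_poissonM_cvg f (a b : V) : L1 mu f ->
  \int[mu]_x (f x * \int[mu]_y (\1_(box a b) y * poisson_rV k.+1%:R^-1 (x - y))) @[k --> \oo]
    --> \int[mu]_x (f x * \1_(box a b) x).
Proof.
move=> If; have mf := L1_measurable If.
have Lb : L12 (\1_(box a b) : V -> R).
  by rewrite -[box a b]setTI; exact: L12_indic_box.
apply: (@Rint_cvg _ _ _ mu (fun k x => f x * \int[mu]_y (\1_(box a b) y * poisson_rV k.+1%:R^-1 (x - y)))
  (fun x => f x * \1_(box a b) x) (fun x => `|f x|) _ _ _ _ (L1_norm If)).2.
- move=> k; apply: measurable_funM => //.
  (* Measurability is read off from the identification of the Poisson integral with a transform. *)
  rewrite (_ : (fun x => _) = hartley (fun xi => laplace_rV k.+1%:R^-1 xi * hartley \1_(box a b) xi)).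
    by apply: measurable_hartley; apply: L1_laplace_hartley => //; exact: Lb.1.
  by apply/funext => x; rewrite -Rint_laplace_hartley//; exact: Lb.1.
- by apply: measurable_funM => //; apply: measurable_indic; exact: measurable_box.
- apply: filterS (cvg_poisson_rV_box a b) => x cx; apply: cvgM; first exact: cvg_cst.
  by under eq_fun do rewrite Rint_indic_poisson//; exact: cx.
- move=> k x; rewrite Rint_indic_poisson// normrM -[leRHS]mulr1 ler_wpM2l//.
  rewrite ger0_norm ?prodr_ge0//; last by move=> i _; exact: poisson_itv_ge0.
  rewrite -[leRHS](_ : \prod_(i < n) (1 : R) = 1); last by rewrite big1.
  by apply: ler_prod => i _; rewrite poisson_itv_ge0//= poisson_itv_le1.
Qed.

(** The two sides of [Rint_laplace_hartley2] converge to the two sides of Parseval's identity, the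
    Poisson side because the second function is a box indicator. *)
Lemma parseval_box f (a b : V) : L12 f -> parseval f \1_(box a b).
Proof.
move=> Lf.
have Lb : L12 (\1_(box a b) : V -> R).
  by rewrite -[box a b]setTI; exact: L12_indic_box.
have I1 : L1 mu (fun xi => hartley \1_(box a b) xi * hartley f xi).
  by apply: sqL1M; exact: (Bessel _).1.
have C1 := Rint_laplaceM_cvg I1.
have C2 := @Rint_poissonM_cvg f a b Lf.1.
rewrite /parseval; under eq_Rintegral do rewrite mulrC.
have E : (fun k => \int[mu]_x (f x * \int[mu]_y (\1_(box a b) y * poisson_rV k.+1%:R^-1 (x - y)))) =
    (fun k => \int[mu]_xi (laplace_rV k.+1%:R^-1 xi * (hartley \1_(box a b) xi * hartley f xi))).
  apply/funext => k; rewrite -Rint_laplace_hartley2//; [|exact: Lf.1|exact: Lb.1].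
  by congr Rintegral; apply/funext => xi; rewrite mulrA.
rewrite E in C2; exact: (cvg_unique _ C1 C2).
Qed.

Definition boxes : set (set V) := [set B | exists a b, B = box a b].

Lemma boxI (a b a' b' : V) : box a b `&` box a' b' =
  box (\row_i Num.max (a ord0 i) (a' ord0 i)) (\row_i Num.min (b ord0 i) (b' ord0 i)).
Proof.
apply/seteqP; split=> v /=.
  move=> [H H'] i; have := H i; have := H' i; rewrite /= !in_itv/= !mxE.
  by move=> /andP[? ?] /andP[? ?]; rewrite gt_max le_min; apply/andP; split; apply/andP; split.
move=> H; split=> i; have := H i; rewrite /= !in_itv/= !mxE gt_max le_min.
  by move=> /andP[/andP[-> _] /andP[-> _]].
by move=> /andP[/andP[_ ->] /andP[_ ->]].
Qed.

Lemma boxes_setI : setI_closed boxes.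
Proof. by move=> _ _ [a [b ->]] [a' [b' ->]]; rewrite boxI; eexists; eexists. Qed.

(** Needed for Dynkin's theorem and for the uniqueness of measures: the sigma-algebra was given by
    coordinates, and these are measurable for the one generated by boxes. *)
Lemma measurable_boxesE : @measurable _ V = <<s boxes >>.
Proof.
apply/seteqP; split; last first.
  apply: smallest_sub; first exact: sigma_algebra_measurable.
  by move=> _ [a [b ->]]; exact: measurable_box.
pose T := g_sigma_algebraType boxes.
have mcoor (i : 'I_n) : measurable_fun [set: T] (fun t : T => (t : V) ord0 i).
  apply: (measurability _ (RGenOInfty.measurableE R)) => // _ [_ [a ->] <-]; rewrite setTI.
  (* The half space [a < v_i] is exhausted by boxes with lower side [a] in direction [i] and sides
     [-k], [k] otherwise. *)
  rewrite (_ : _ @^-1` _ = \bigcup_k box (\row_j if j == i then a else - k%:R) (const_mx k%:R)).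
    apply: (@bigcup_measurable _ T) => k _.
    by apply: sub_sigma_algebra; eexists; eexists.
  apply/seteqP; split=> v /=; last first.
    by move=> [k _ /(_ i)]; rewrite /= !in_itv/= !mxE eqxx => /andP[-> _].
  rewrite in_itv/= andbT => vi; pose M := \sum_j `|v ord0 j|.
  exists (Num.truncn M).+1 => // j; rewrite /= in_itv/= !mxE.
  have vM : `|v ord0 j| < (Num.truncn M).+1%:R.
    apply: (le_lt_trans _ (truncnS_gt M)).
    by rewrite /M (bigD1 j)//= lerDl sumr_ge0.
  move: vM; rewrite ltr_norml => /andP[vl /ltW ->]; rewrite andbT.
  by case: eqP => [->|].
have mid : measurable_fun [set: T] (idfun : T -> V) by exact/measurable_fun_rVP.
by move=> A mA; have := mid measurableT A mA; rewrite setTI.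
Qed.

Lemma bigcup_box : \bigcup_k box (const_mx (- k%:R)) (const_mx k%:R) = [set: V].
Proof.
apply/seteqP; split=> // v _; pose M := \sum_j `|v ord0 j|.
exists (Num.truncn M).+1 => // j; rewrite /= in_itv/= !mxE.
have vM : `|v ord0 j| < (Num.truncn M).+1%:R.
  apply: (le_lt_trans _ (truncnS_gt M)).
  by rewrite /M (bigD1 j)//= lerDl sumr_ge0.
by move: vM; rewrite ltr_norml => /andP[-> /ltW].
Qed.

Lemma box_nd (k m : nat) : (k <= m)%N ->
  box (const_mx (- k%:R)) (const_mx k%:R) `<=` box (const_mx (- m%:R)) (const_mx m%:R : V).
Proof.
move=> km v H i; have := H i; rewrite /= !in_itv/= !mxE => /andP[h1 h2].
have km' : k%:R <= m%:R :> R by rewrite ler_nat.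
by rewrite (le_lt_trans _ h1) ?lerN2// (le_trans h2).
Qed.

Lemma cvgL2_dominated (g_ : nat -> V -> R) g :
  (forall k, L12 (g_ k)) -> L12 g -> (forall k x, `|g_ k x| <= `|g x|) ->
  (forall x, g_ k x @[k --> \oo] --> g x) -> cvgL2 mu g_ g.
Proof.
move=> Lg_ Lg gle gc.
have mg_ k := L1_measurable (Lg_ k).1; have mg := L1_measurable Lg.1.
rewrite /cvgL2 [X in _ --> X](_ : 0 = \int[mu]_x 0); last by rewrite Rintegral_cst// mul0r.
apply: (@Rint_cvg _ _ _ mu (fun k x => (g_ k x - g x) ^+ 2) (fun=> 0)
  (fun x => 4 * g x ^+ 2) _ _ _ _ _).2.
- by move=> k; apply: measurable_funX; exact: measurable_funB.
- exact: measurable_cst.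
- apply: aeW => x; rewrite [X in _ --> X](_ : 0 = (g x - g x) ^+ 2); last by rewrite subrr expr0n.
  apply: (continuous_cvg _ (@exprn_continuous R 2 _)).
  by apply: cvgB; [exact: gc|exact: cvg_cst].
- move=> k x; rewrite normrX -[g x ^+ 2]real_normK ?num_real//.
  have : `|g_ k x - g x| <= 2 * `|g x|.
    by rewrite (le_trans (ler_normB _ _))// mulr2n mulrDl mul1r lerD2r.
  move=> h; rewrite (_ : 4 * _ = (2 * `|g x|) ^+ 2); last by ring.
  by rewrite lerXn2r ?nnegrE// mulr_ge0.
- by apply: L1Z; exact: Lg.2.2.
Qed.

(* Indicators of boxes form a pi-system; cutting by a fixed box keeps the
   complements integrable in the Dynkin argument. *)
Lemma parseval_indic f (a b : V) (A : set V) : L12 f -> measurable A ->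
  parseval f \1_(A `&` box a b).
Proof.
move=> Lf mA; pose P := [set A : set V | parseval f \1_(A `&` box a b)].
have mB := measurable_box a b.
apply: (@dynkin_induction _ V boxes P measurable_boxesE boxes_setI) => //.
- by rewrite /P /= setTI; exact: parseval_box.
- by move=> _ [a' [b' ->]]; rewrite /P /= boxI; exact: parseval_box.
- move=> S mS PS; rewrite /P /=.
  (* The complement is taken relative to the box, as a difference of two functions already
     covered. *)
  rewrite (_ : \1_(~` S `&` box a b) = \1_(box a b) \+ (fun x => -1 * \1_(S `&` box a b) x)).
    apply: parsevalD => //.
    + by rewrite -[box a b]setTI; exact: L12_indic_box.
    + by apply: L12Z; exact: L12_indic_box.
    + exact: parseval_box.
    + by apply: parsevalZ => //; exact: L12_indic_box.
  apply/funext => x /=; rewrite !indicE !in_setI in_setC.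
  by case: (x \in S); case: (x \in box a b); rewrite /= ?mulr1 ?mulr0 ?subrr ?addr0 ?mulrN1 ?subrr.
- move=> F mF tF PF; rewrite /P /=.
  have fin k : parseval f \1_((\big[setU/set0]_(i < k) F i) `&` box a b).
    elim: k => [|k IH].
      rewrite big_ord0 set0I (_ : \1_set0 = fun x => 0 * \1_(box a b) x).
        apply: parsevalZ => //; last exact: parseval_box.
        by rewrite -[box a b]setTI; exact: L12_indic_box.
      by apply/funext => x; rewrite indic0 mul0r.
    rewrite big_ord_recr/=.
    rewrite (_ : \1_(_ `&` _) = \1_((\big[setU/set0]_(i < k) F i) `&` box a b) \+ \1_(F k `&` box a b)).
      apply: (parsevalD Lf _ _ IH (PF k)); apply: L12_indic_box => //.
      exact: bigsetU_measurable.
    apply/funext => x /=; rewrite !indicE !in_setI in_setU.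
    have : ~~ ((x \in \big[setU/set0]_(i < k) F i) && (x \in F k)).
      apply/negP => /andP[/set_mem + /set_mem Fk]; rewrite -bigcup_mkord => -[j /= jk Fj].
      have jkE := tF j k Logic.I Logic.I (ex_intro _ x (conj Fj Fk)).
      by rewrite jkE ltnn in jk.
    by case: (_ \in _); case: (x \in F k); case: (x \in box a b); rewrite //= ?addr0 ?add0r.
  have mFk k : measurable (\big[setU/set0]_(i < k) F i) by exact: bigsetU_measurable.
  have mUF : measurable (\bigcup_k F k) by exact: bigcup_measurable.
  (* Finite disjoint unions are additive by [fin]; the countable one is their L2 limit within the
     box. *)
  apply: (@parseval_lim _ _ f (fun k => \1_((\big[setU/set0]_(i < k) F i) `&` box a b))) => //.
  + by move=> k; exact: L12_indic_box.
  + exact: L12_indic_box.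
  apply: cvgL2_dominated.
  + by move=> k; exact: L12_indic_box.
  + exact: L12_indic_box.
  + move=> k x; rewrite !ger0_norm// !indicE ler_nat !in_setI.
    have [xF|//] := boolP (x \in \big[setU/set0]_(i < k) F i).
    rewrite (@mem_set _ (\bigcup_k F k))//.
    by move: xF => /set_mem; rewrite -bigcup_mkord => -[j _ Fj]; exists j.
  + move=> x; have [[j _ Fj]|nF] := pselect ((\bigcup_k F k) x).
      apply: cvg_near_cst; exists j.+1 => //= k /= jk.
      rewrite !indicE !in_setI; congr (nat_of_bool (_ && _))%:R.
      by rewrite !mem_set//; [exists j|rewrite -bigcup_mkord; exists j].
    apply: cvg_near_cst; apply: nearW => k; rewrite !indicE !in_setI.
    congr (nat_of_bool (_ && _))%:R; rewrite !memNset// -bigcup_mkord => -[j _ Fj].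
    by apply: nF; exists j.
- by rewrite -measurable_boxesE.
Qed.

End parseval_identity.

(** * Plancherel's identity on L2 *)

Section plancherel.
Variables (R : realType) (n : nat).
Notation mu := (lebesgue_rV R n).
Notation V := 'rV[R]_n.
Implicit Types (f g h : V -> R) (x y xi : V) (e : R).

Import HBNNSimple.

Lemma parseval_sum_indic f (a b : V) (s : seq R) (A : R -> set V) : L12 f ->
  (forall r, measurable (A r)) ->
  L12 (fun x => \sum_(r <- s) r * \1_(A r `&` box a b) x) /\
  parseval f (fun x => \sum_(r <- s) r * \1_(A r `&` box a b) x).
Proof.
move=> Lf mA; have LA r : L12 (\1_(A r `&` box a b) : V -> R) by exact: L12_indic_box.
elim: s => [|r s [LI PI]].
  rewrite (_ : (fun x => _) = fun x => 0 * \1_(A 0 `&` box a b) x); last first.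
    by apply/funext => x; rewrite big_nil mul0r.
  by split; [exact: L12Z|apply: parsevalZ => //; exact: parseval_indic].
rewrite (_ : (fun x => _) = (fun x => r * \1_(A r `&` box a b) x) \+
   (fun x => \sum_(r <- s) r * \1_(A r `&` box a b) x)); last first.
  by apply/funext => x; rewrite big_cons.
have Lr := L12Z r (LA r).
split; first exact: L12D.
by apply: parsevalD => //; apply: parsevalZ => //; exact: parseval_indic.
Qed.

Lemma parseval_nnsfun f (a b : V) (h : {nnsfun V >-> R}) : L12 f ->
  L12 (fun x => h x * \1_(box a b) x) /\ parseval f (fun x => h x * \1_(box a b) x).
Proof.
move=> Lf; have mh r : measurable (h @^-1` [set r]).
  exact: measurable_funPTI.
rewrite (_ : (fun x => _) = fun x => \sum_(r <- finmap.enum_fset (fset_set (range h)))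
    r * \1_(h @^-1` [set r] `&` box a b) x); first exact: parseval_sum_indic.
apply/funext => x; rewrite fimfunE fsbig_finite//= mulr_suml.
by apply: eq_bigr => r _; rewrite indicI -mulrA.
Qed.

Lemma cvg_indic_box x : \1_(box (const_mx (- k%:R)) (const_mx k%:R) : set V) x @[k --> \oo] --> (1 : R).
Proof.
have : (\bigcup_k box (const_mx (- k%:R)) (const_mx k%:R) : set V) x by rewrite bigcup_box.
move=> [k _ kx]; apply: cvg_near_cst; exists k => //= m km.
by rewrite indicE mem_set//; exact: box_nd kx.
Qed.

(** Simple functions increasing to [g] need not have level sets of finite measure, so each is also
    cut by a cube; the products stay below [g] and converge to it. *)
Lemma parseval_ge0 f g : L12 f -> L12 g -> (forall x, 0 <= g x) -> parseval f g.
Proof.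
move=> Lf Lg g0; have mg := L1_measurable Lg.1.
have mEg : measurable_fun [set: V] (EFin \o g) by exact/measurable_EFinP.
have Eg0 x : [set: V] x -> (0 <= (EFin \o g) x)%E by rewrite lee_fin.
pose h := nnsfun_approx measurableT mEg.
have ch x : h k x @[k --> \oo] --> g x.
  have := cvg_nnsfun_approx measurableT mEg Eg0 (Logic.I : [set: V] x).
  by move=> /fine_cvg.
have hle k x : h k x <= g x.
  have nd : nondecreasing_seq (fun k => h k x).
    by move=> i j ij; have /lefP := nd_nnsfun_approx measurableT mEg ij; exact.
  rewrite -(cvg_lim _ (ch x))//; apply: nondecreasing_cvgn_le => //.
  by apply/cvg_ex; exists (g x); exact: ch.
pose q k : V -> R := \1_(box (const_mx (- k%:R)) (const_mx k%:R)).
have Pq k := parseval_nnsfun (const_mx (- k%:R)) (const_mx k%:R) (h k) Lf.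
apply: (@parseval_lim _ _ f (fun k x => h k x * q k x)) => //.
- by move=> k; exact: (Pq k).1.
- by move=> k; exact: (Pq k).2.
apply: cvgL2_dominated => //.
- by move=> k; exact: (Pq k).1.
- move=> k x; rewrite !ger0_norm//; last by rewrite mulr_ge0.
  by rewrite -[leRHS]mulr1 ler_pM// /q indicE lern1 leq_b1.
- by move=> x; rewrite -[X in _ --> X]mulr1; apply: cvgM; [exact: ch|exact: cvg_indic_box].
Qed.

Lemma parseval_L12 f g : L12 f -> L12 g -> parseval f g.
Proof.
move=> Lf Lg; have mg := L1_measurable Lg.1.
pose gp x := (`|g x| + g x) / 2; pose gm x := (`|g x| - g x) / 2.
have Lp : L12 gp.
  apply: L12_le Lg; first by apply: measurable_funM => //; apply: measurable_funD => //; exact: measurableT_comp.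
  move=> x; rewrite /gp normrM [X in _ * X]ger0_norm// ler_pdivrMr// mulr2n mulrDr !mulr1.
  by rewrite (le_trans (ler_normD _ _))// normr_id.
have Lm : L12 gm.
  apply: L12_le Lg; first by apply: measurable_funM => //; apply: measurable_funB => //; exact: measurableT_comp.
  move=> x; rewrite /gm normrM [X in _ * X]ger0_norm// ler_pdivrMr// mulr2n mulrDr !mulr1.
  by rewrite (le_trans (ler_normB _ _))// normr_id.
have -> : g = gp \+ (fun x => -1 * gm x).
  by apply/funext => x; rewrite /gp /gm /=; field.
apply: parsevalD => //; first exact: L12Z.
  apply: parseval_ge0 => // x; rewrite /gp divr_ge0//.
  by have := ler_norm (- g x); rewrite normrN; lra.
apply: parsevalZ => //; apply: parseval_ge0 => // x; rewrite /gm divr_ge0//.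
by have := ler_norm (g x); lra.
Qed.

(** The integral of a nonnegative function is a supremum over simple functions below it, hence
    monotone without measurability. This serves the modulus of a complex difference in
    [fourierL2]. *)
Lemma ge0_le_integralT d (T : measurableType d) (nu : {measure set T -> \bar R})
    (f1 f2 : T -> \bar R) : (forall x : T, 0 <= f1 x)%E -> (forall x : T, f1 x <= f2 x)%E ->
  (\int[nu]_x f1 x <= \int[nu]_x f2 x)%E.
Proof.
move=> f10 f12.
have f20 (x : T) : (0 <= f2 x)%E := le_trans (f10 x) (f12 x).
rewrite !ge0_integralTE//; apply: ereal_sup_le => _ [h hf <-]; exists h => //= x.
exact: le_trans (hf x) (f12 x).
Qed.

(* A scalar L2 transform of the real-valued f: the difference of the real and
   imaginary parts of its Fourier-Plancherel transform. *)
Definition hartleyL2 f h := [/\ sqL1 mu f, sqL1 mu h,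
  (forall k : nat, L12 (truncate f k%:R)) &
  cvgL2 mu (fun k => hartley (truncate f k%:R)) h].

Lemma enorm_ge0 x : 0 <= enorm x. Proof. exact: sqrtr_ge0. Qed.

Lemma dotxx_ge0 x : 0 <= dot x x.
Proof. by apply: sumr_ge0 => i _; rewrite -expr2 sqr_ge0. Qed.

Lemma enorm_sqr x : enorm x ^+ 2 = dot x x.
Proof. by rewrite sqr_sqrtr ?dotxx_ge0. Qed.

Lemma coord_le_enorm x i : `|x ord0 i| <= enorm x.
Proof.
rewrite -(@ler_pXn2r _ 2) ?nnegrE ?enorm_ge0// enorm_sqr real_normK ?num_real//.
rewrite /dot (bigD1 i)//= expr2 lerDl.
by apply: sumr_ge0 => j _; rewrite -expr2 sqr_ge0.
Qed.

Lemma measurable_enorm : measurable_fun setT (@enorm R n).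
Proof.
apply: measurableT_comp; last by apply: measurable_dot; exact: measurable_id.
exact: continuous_measurable_fun (@sqrt_continuous R).
Qed.

Lemma measurable_enorm_ball (r : R) : measurable [set y : V | enorm y <= r].
Proof.
have := measurable_enorm measurableT (measurable_itv `]-oo, r]); rewrite setTI.
by congr measurable; apply/seteqP; split => y /=; rewrite in_itv.
Qed.

Lemma enorm_ball_lty (r : R) : (mu [set y : V | (enorm y <= r)%R] < +oo)%E.
Proof.
apply: le_lt_trans (box_lty (const_mx (- r - 1)) (const_mx r)).
apply: le_measure; rewrite ?inE//; first exact: measurable_enorm_ball.
  exact: measurable_box.
move=> y /= yr i; have := le_trans (coord_le_enorm y i) yr.
by rewrite /= in_itv/= !mxE ler_norml => /andP[yi ->]; rewrite andbT; lra.
Qed.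

Lemma L12_truncate f (r : R) : sqL1 mu f -> L12 (truncate f r).
Proof.
move=> sf; have mB := measurable_enorm_ball r.
have mt : measurable_fun setT (truncate f r).
  by apply: measurable_funM; [exact: sf.1|exact: measurable_indic].
have tf x : `|truncate f r x| <= `|f x|.
  by rewrite /truncate normrM -[leRHS]mulr1 ler_wpM2l// indicE normr_nat lern1 leq_b1.
split; last exact: sqL1_le sf.
have s1 := (L12_indic mB (enorm_ball_lty r)).2.
exact: sqL1M sf s1.
Qed.

Lemma cvgL2_truncate f : sqL1 mu f -> cvgL2 mu (fun k : nat => truncate f k%:R) f.
Proof.
move=> sf; have Lt (k : nat) := L12_truncate k%:R sf.
rewrite /cvgL2 [X in _ --> X](_ : 0 = \int[mu]_x 0); last by rewrite Rintegral_cst// mul0r.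
apply: (@Rint_cvg _ _ _ mu (fun (k : nat) x => (truncate f k%:R x - f x) ^+ 2) (fun=> 0)
  (fun x => f x ^+ 2) _ _ _ _ _).2.
- move=> k; apply: measurable_funX; apply: measurable_funB; last exact: sf.1.
  exact: L1_measurable (Lt k).1.
- exact: measurable_cst.
- apply: aeW => x; apply: cvg_near_cst; exists (Num.truncn (enorm x)).+1 => //= k /= kx.
  rewrite /truncate indicE mem_set ?mulr1 ?subrr ?expr0n//=.
  rewrite (le_trans (ltW (truncnS_gt _)))// ler_nat//.
- move=> k x; rewrite normrX -[f x ^+ 2]real_normK ?num_real// lerXn2r ?nnegrE//.
  rewrite /truncate indicE; case: (_ \in _); rewrite ?mulr1 ?mulr0 ?subrr ?normr0//.
  by rewrite sub0r normrN.
- exact: sf.2.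
Qed.

(** Parseval's identity for the truncations; both sides pass to the limit by [cvgL2_Rint]. *)
Lemma Plancherel f g h k : hartleyL2 f h -> hartleyL2 g k ->
  \int[mu]_x (f x * g x) = \int[mu]_xi (h xi * k xi).
Proof.
move=> [sf sh Lf cf] [sg sk Lg cg].
have C1 := cvgL2_Rint (fun j => (Lf j).2) sf (fun j => (Lg j).2) sg (cvgL2_truncate sf) (cvgL2_truncate sg).
have C2 := cvgL2_Rint (fun j => (Bessel (Lf j)).1) sh (fun j => (Bessel (Lg j)).1) sk cf cg.
move: C2; under eq_fun do rewrite parseval_L12//.
by move=> C2; exact: (cvg_unique _ C1 C2).
Qed.

Lemma hartley_fourier f xi : L1 mu f ->
  hartley f xi = complex.Re (fourier f xi) - complex.Im (fourier f xi).
Proof.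
move=> If; rewrite /fourier /= opprK /hartley.
have mc : measurable_fun [set: V] (fun x => cos (2 * pi * dot x xi)).
  apply: measurableT_comp; first exact: continuous_measurable_fun (@continuous_cos R).
  by apply: measurable_funM => //; exact: measurable_dotl.
have ms : measurable_fun [set: V] (fun x => sin (2 * pi * dot x xi)).
  apply: measurableT_comp; first exact: continuous_measurable_fun (@continuous_sin R).
  by apply: measurable_funM => //; exact: measurable_dotl.
have Ic : L1 mu (fun x => f x * cos (2 * pi * dot x xi)).
  under [X in L1 _ X]eq_fun do rewrite mulrC.
  by apply: (@L1_bounded _ _ _ _ _ _ 1) => // x; rewrite ler_norml cos_geN1 cos_le1.
have Is : L1 mu (fun x => f x * sin (2 * pi * dot x xi)).
  under [X in L1 _ X]eq_fun do rewrite mulrC.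
  by apply: (@L1_bounded _ _ _ _ _ _ 1) => // x; rewrite ler_norml sin_geN1 sin_le1.
rewrite -RintegralD//.
by congr Rintegral; apply/funext => x; rewrite mulrDr.
Qed.

Lemma fourierL2_hartleyL2 f (F : V -> R[i]) : fourierL2 f F ->
  hartleyL2 f (fun xi => complex.Re (F xi) - complex.Im (F xi)).
Proof.
move=> [Lf [LRe LIm] cF].
have sf := sqL1_Lfun Lf.
have sh : sqL1 mu (fun xi => complex.Re (F xi) - complex.Im (F xi)).
  exact: sqL1B (sqL1_Lfun LRe) (sqL1_Lfun LIm).
have Lt (k : nat) := L12_truncate k%:R sf.
split => //.
set h := (fun xi => _) in sh *.
pose X (k : nat) := (\int[mu]_xi (ComplexField.Normc.normc (fourier (truncate f k%:R) xi - F xi) ^+ 2)%:E)%E.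
pose Y (k : nat) := \int[mu]_xi ((hartley (truncate f k%:R) xi - h xi) ^+ 2).
have le k : ((2^-1 * Y k)%:E <= X k)%E.
  have IY : L1 mu (fun xi => (hartley (truncate f k%:R) xi - h xi) ^+ 2).
    exact: (sqL1B (Bessel (Lt k)).1 sh).2.
  rewrite /Y -RintegralZl// EFin_Rint; last exact: L1Z.
  apply: ge0_le_integralT => xi; rewrite lee_fin; first by rewrite mulr_ge0 ?sqr_ge0.
  rewrite hartley_fourier; last exact: (Lt k).1.
  rewrite /h; case: (fourier _ xi) (F xi) => [a b] [c d] /=.
  rewrite sqr_sqrtr ?addr_ge0 ?sqr_ge0//.
  (* [(u - v)^2 <= 2 (u^2 + v^2)], the difference of the sides being [(u + v)^2]. *)
  by have := sqr_ge0 ((a - c) + (b - d)); nra.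
have C : (2^-1 * Y k)%:E @[k --> \oo] --> 0%:E.
  apply: (@squeeze_cvge _ _ _ _ (fun=> 0%E) _ X) => //; last exact: cvg_cst.
  apply: nearW => k; rewrite le andbT lee_fin mulr_ge0//.
  by apply: Rintegral_ge0 => xi _; exact: sqr_ge0.
rewrite /cvgL2 -[X in _ --> X](mulr0 2).
rewrite (_ : (fun k : nat => _) = fun k => 2 * (2^-1 * Y k)); last first.
  by apply/funext => k; rewrite mulrA divff// mul1r.
by apply: cvgM; [exact: cvg_cst|exact: (fine_cvg C)].
Qed.

(** Pairing the sequence with [h - k] gives two limits, whose difference is the squared norm of
    [h - k]. *)
Lemma cvgL2_unique (h_ : nat -> V -> R) h k : (forall j, sqL1 mu (h_ j)) ->
  sqL1 mu h -> sqL1 mu k -> cvgL2 mu h_ h -> cvgL2 mu h_ k -> {ae mu, forall x, h x = k x}.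
Proof.
move=> sh_ sh sk ch ck.
have sd := sqL1B sh sk.
have cd : cvgL2 mu (fun=> h \- k) (h \- k).
  rewrite /cvgL2 [X in _ --> X](_ : 0 = \int[mu]_x (((h \- k) x - (h \- k) x) ^+ 2)); first exact: cvg_cst.
  under eq_Rintegral do rewrite subrr expr0n.
  by rewrite Rintegral_cst// mul0r.
have C1 := cvgL2_Rint sh_ sh (fun=> sd) sd ch cd.
have C2 := cvgL2_Rint sh_ sk (fun=> sd) sd ck cd.
have E := cvg_unique _ C1 C2.
have : \int[mu]_x ((h \- k) x ^+ 2) = 0.
  transitivity (\int[mu]_x (h x * (h \- k) x) - \int[mu]_x (k x * (h \- k) x)).
    rewrite -RintegralB//; [|exact: sqL1M|exact: sqL1M].
    by congr Rintegral; apply/funext => x /=; ring.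
  by apply/eqP; rewrite subr_eq0; apply/eqP; exact: E.
move=> /(Rint_eq0_ae sd.2 (fun x => sqr_ge0 _)).
by apply: filterS => x /= /eqP; rewrite sqrf_eq0 subr_eq0 => /eqP.
Qed.

Lemma hartleyL2_unique f h k : hartleyL2 f h -> hartleyL2 f k -> {ae mu, forall x, h x = k x}.
Proof.
move=> [_ sh Lf ch] [_ sk _ ck].
exact: cvgL2_unique (fun j => (Bessel (Lf j)).1) sh sk ch ck.
Qed.

(** The transforms of the truncations also converge to [hartley f], by Bessel's inequality. *)
Lemma hartleyL2_L12 f h : L12 f -> hartleyL2 f h -> {ae mu, forall xi, h xi = hartley f xi}.
Proof.
move=> Lf [_ sh Lt ch].
apply: cvgL2_unique (fun j => (Bessel (Lt j)).1) sh (Bessel Lf).1 ch _.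
apply: cvgL2_hartley => //; exact: cvgL2_truncate Lf.2.
Qed.

(** * Reflections, and functions with zero integral on every box *)

Definition rV_refl (a x : V) : V := a - x.

Lemma measurable_rV_refl a : measurable_fun setT (rV_refl a).
Proof.
apply/measurable_fun_rVP => i; under eq_fun do rewrite /rV_refl !mxE.
by apply: measurable_funB => //; exact: measurable_coord.
Qed.

Definition lebesgue_refl (a : V) : {measure set V -> \bar R}.
Proof.
by refine (pushforward mu (rV_refl a) : {measure set V -> \bar R}); exact: measurable_rV_refl.
Defined.

Lemma lebesgue_rV_refl (a : V) (A : set V) : measurable A -> mu A = lebesgue_refl a A.
Proof.
apply: (measure_unique (@boxes R n) (fun k => box (const_mx (- k%:R)) (const_mx k%:R))).
- exact: measurable_boxesE.
- exact: boxes_setI.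
- by move=> k; eexists; eexists.
- exact: bigcup_box.
- move=> _ [b [c ->]]; rewrite /= /pushforward.
  (* A reflection swaps the closed and open ends of each side and keeps its length. *)
  rewrite (_ : _ @^-1` _ = [set v : V | forall i, `[a ord0 i - c ord0 i, a ord0 i - b ord0 i[%classic (v ord0 i)]).
    rewrite [RHS](@lebesgue_rV_box R n (fun i => `[a ord0 i - c ord0 i, a ord0 i - b ord0 i[%classic))//.
    rewrite [LHS](@lebesgue_rV_box R n (fun i => `]b ord0 i, c ord0 i]%classic))//.
    apply: eq_bigr => i _; rewrite !lebesgue_measure_itv /= !lte_fin ltrD2l ltrN2.
    case: ifP => // _; rewrite -!EFinB; congr EFin; ring.
  apply/seteqP; split=> v /= H i; have := H i; rewrite /= /rV_refl !in_itv/= !mxE => /andP[h1 h2]; apply/andP; split; lra.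
- by move=> k; exact: box_lty.
Qed.

Lemma Rint_refl (a : V) f : L1 mu f ->
  L1 mu (fun x => f (a - x)) /\ \int[mu]_x f (a - x) = \int[mu]_x f x.
Proof.
move=> If; have mf := L1_measurable If.
have mfa : measurable_fun setT (fun x => f (a - x)).
  exact: measurableT_comp mf (measurable_rV_refl a).
have mE : measurable_fun setT (EFin \o f) by exact/measurable_EFinP.
have mr := measurable_rV_refl a.
have I1 : L1 mu (fun x => f (a - x)).
  apply/integrableP; split; first exact/measurable_EFinP.
  have [_] := integrableP _ _ _ If; congr (_ < _)%E.
  rewrite (eq_measure_integral (lebesgue_refl a)); last by move=> A mA _; exact: lebesgue_rV_refl.
  by rewrite [LHS](ge0_integral_pushforward mr)//; exact: measurableT_comp.
split=> //; congr fine; symmetry.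
rewrite (eq_measure_integral (lebesgue_refl a)); last by move=> A mA _; exact: lebesgue_rV_refl.
exact: (integral_pushforward mr mE I1).
Qed.

(** Dynkin's theorem extends the vanishing from boxes to measurable subsets of a box. Splitting a
    cube by the sign of [h] then kills the integral of the absolute value. *)
Lemma ae0_box h : (forall a b, L1 mu (fun x => h x * \1_(box a b) x)) -> measurable_fun setT h ->
  (forall a b, \int[mu]_x (h x * \1_(box a b) x) = 0) -> {ae mu, forall x, h x = 0}.
Proof.
move=> Ih mh h0.
have I1 (A : set V) a b : measurable A -> L1 mu (fun x => h x * \1_(A `&` box a b) x).
  move=> mA; apply: L1_le (L1_norm (Ih a b)).
    by apply: measurable_funM => //; apply: measurable_indic; apply: measurableI => //; exact: measurable_box.
  move=> x; rewrite !normrM ler_wpM2l// indicI /= normrM -[leRHS]mul1r ler_wpM2r//.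
  by rewrite indicE normr_nat lern1 leq_b1.
have H a b (A : set V) : measurable A -> \int[mu]_x (h x * \1_(A `&` box a b) x) = 0.
  move=> mA; pose P := [set A : set V | \int[mu]_x (h x * \1_(A `&` box a b) x) = 0].
  have mB := measurable_box a b.
  apply: (@dynkin_induction _ V (@boxes R n) P (@measurable_boxesE R n) (@boxes_setI R n)) => //.
  - by rewrite /P /= setTI.
  - by move=> _ [a' [b' ->]]; rewrite /P /= boxI.
  - move=> S mS PS; rewrite /P /=.
    transitivity (\int[mu]_x (h x * \1_(box a b) x) - \int[mu]_x (h x * \1_(S `&` box a b) x)).
      rewrite -RintegralB//; [|exact: Ih|exact: I1].
      congr Rintegral; apply/funext => x; rewrite -mulrBr; congr (_ * _).
      rewrite !indicE !in_setI in_setC.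
      by case: (x \in S); case: (x \in box a b); rewrite /= ?subrr ?subr0.
    by rewrite h0 PS subrr.
  - move=> F mF tF PF; rewrite /P /=.
    have fin k : \int[mu]_x (h x * \1_((\big[setU/set0]_(i < k) F i) `&` box a b) x) = 0.
      elim: k => [|k IH].
        rewrite big_ord0 set0I.
        by under eq_Rintegral do rewrite indic0 mulr0; rewrite Rintegral_cst// mul0r.
      rewrite big_ord_recr/=.
      transitivity (\int[mu]_x (h x * \1_((\big[setU/set0]_(i < k) F i) `&` box a b) x) +
         \int[mu]_x (h x * \1_(F k `&` box a b) x)).
        rewrite -RintegralD//; [|by apply: I1; exact: bigsetU_measurable|exact: I1].
        congr Rintegral; apply/funext => x; rewrite -mulrDr; congr (_ * _).
        rewrite !indicE !in_setI in_setU.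
        have : ~~ ((x \in \big[setU/set0]_(i < k) F i) && (x \in F k)).
          apply/negP => /andP[/set_mem + /set_mem Fk]; rewrite -bigcup_mkord => -[j /= jk Fj].
          have jkE := tF j k Logic.I Logic.I (ex_intro _ x (conj Fj Fk)).
          by rewrite jkE ltnn in jk.
        by case: (_ \in _); case: (x \in F k); case: (x \in box a b); rewrite //= ?addr0 ?add0r.
      by rewrite IH PF addr0.
    have mFk k : measurable (\big[setU/set0]_(i < k) F i) by exact: bigsetU_measurable.
    have mUF : measurable (\bigcup_k F k) by exact: bigcup_measurable.
    have C : \int[mu]_x (h x * \1_((\big[setU/set0]_(i < k) F i) `&` box a b) x) @[k --> \oo] -->
        \int[mu]_x (h x * \1_(\bigcup_k F k `&` box a b) x).
      apply: (@Rint_cvg _ _ _ mu (fun k x => h x * \1_((\big[setU/set0]_(i < k) F i) `&` box a b) x)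
         _ (fun x => `|h x * \1_(box a b) x|) _ _ _ _ _).2.
      + by move=> k; exact: L1_measurable (I1 _ a b (mFk k)).
      + exact: L1_measurable (I1 _ a b mUF).
      + apply: aeW => x; have [[j _ Fj]|nF] := pselect ((\bigcup_k F k) x).
          apply: cvg_near_cst; exists j.+1 => //= k /= jk.
          rewrite !indicE !in_setI; congr (_ * (nat_of_bool (_ && _))%:R).
          by rewrite !mem_set//; [exists j|rewrite -bigcup_mkord; exists j].
        apply: cvg_near_cst; apply: nearW => k; rewrite !indicE !in_setI.
        congr (_ * (nat_of_bool (_ && _))%:R); rewrite !memNset// -bigcup_mkord => -[j _ Fj].
        by apply: nF; exists j.
      + move=> k x; rewrite !normrM ler_wpM2l// indicI /= normrM -[leRHS]mul1r ler_wpM2r//.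
        by rewrite indicE normr_nat lern1 leq_b1.
      + exact: L1_norm.
    move: C; under eq_fun do rewrite fin.
    by move=> C; exact: (cvg_unique _ C (cvg_cst _)).
  - by rewrite -measurable_boxesE.
have K (k : nat) : {ae mu, forall x, h x * \1_(box (const_mx (- k%:R)) (const_mx k%:R)) x = 0}.
  set B := box _ _.
  pose A := [set x | 0 <= h x].
  have mA : measurable A.
    have := mh measurableT _ (measurable_itv `[0, +oo[); rewrite setTI.
    by congr measurable; apply/seteqP; split => y /=; rewrite in_itv/= andbT.
  have E : \int[mu]_x `|h x * \1_B x| = 0.
    transitivity (\int[mu]_x (h x * \1_(A `&` B) x) - \int[mu]_x (h x * \1_(~` A `&` B) x)).
      rewrite -RintegralB//; [|exact: I1|by apply: I1; exact: measurableC].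
      congr Rintegral; apply/funext => x; rewrite -mulrBr normrM.
      rewrite !indicE !in_setI in_setC normr_nat.
      have [xA|xA] := boolP (x \in A); rewrite ?mul1n ?subr0 ?sub0r ?mulrN.
        by rewrite ger0_norm//; move: xA; rewrite inE.
      rewrite ltr0_norm ?mulNr// ltNge; apply/negP => h0x; move/negP: xA; apply.
      by rewrite inE.
    by rewrite H// H ?subrr//; exact: measurableC.
  have := Rint_eq0_ae (L1_norm (Ih _ _)) (fun x => normr_ge0 _) E.
  by apply: filterS => x /eqP; rewrite normr_eq0 => /eqP.
have : {ae mu, forall x, forall k : nat, h x * \1_(box (const_mx (- k%:R)) (const_mx k%:R)) x = 0}.
  exact: ae_foralln.
apply: filterS => x hx.
have [k _ kx] : (\bigcup_k box (const_mx (- k%:R)) (const_mx k%:R) : set V) x by rewrite bigcup_box.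
by have := hx k; rewrite indicE mem_set// mulr1.
Qed.

End plancherel.

(** * Smooth bump functions *)

Section flat_functions.
Variable R : realType.
Implicit Types (t : R) (k : nat).

(** The classical flat function [exp (-1/t)] with the extra poles that differentiation produces. *)
Definition flat k t : R := if 0 < t then t^-1 ^+ k * expR (- t^-1) else 0.

Lemma flat_ge0 k t : 0 <= flat k t.
Proof.
by rewrite /flat; case: ifP => // t0; rewrite mulr_ge0 ?expR_ge0// exprn_ge0// invr_ge0 ltW.
Qed.

(** The term of degree [k + 2] in the exponential series at [1 / t] beats the pole and leaves
    [t ^ 2]. This order is what gives a zero derivative at the origin. *)
Lemma flat_le k t : flat k t <= (k.+2)`!%:R * t ^+ 2.
Proof.
rewrite /flat; case: ifPn => [t0|_]; last by rewrite mulr_ge0 ?sqr_ge0.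
have x0 : 0 <= t^-1 by rewrite invr_ge0 ltW.
have tn : t != 0 by rewrite gt_eqF.
have := expR_ge1Dxn k.+1 x0.
rewrite expRN; have := expR_gt0 t^-1; move: (expR _) => E E0 H.
rewrite ler_pdivrMr//.
have {}H : t^-1 ^+ k.+2 <= (k.+2)`!%:R * E.
  rewrite -ler_pdivrMl ?ltr0n ?fact_gt0// mulrC; lra.
have -> : t^-1 ^+ k = t^-1 ^+ k.+2 * t ^+ 2.
  by rewrite -addn2 exprD -mulrA -exprMn mulVf// expr1n mulr1.
by rewrite [leRHS]mulrAC ler_wpM2r ?sqr_ge0.
Qed.

Lemma is_derive_flat k t : is_derive t 1 (flat k) (flat k.+2 t - k%:R * flat k.+1 t).
Proof.
have [t0|t0|->] := ltgtP t 0.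
- have E j : flat j t = 0 by rewrite /flat ltNge ltW.
  rewrite !E mulr0 subr0.
  have H : \near t, cst (0 : R) t = flat k t.
    near=> x; rewrite /flat ltNge (_ : x <= 0)//.
    by rewrite ltW//; near: x; apply: lt_nbhsl.
  exact: (near_eq_is_derive H (is_derive_cst (0 : R) (t : R^o) 1)).
- have tn : t != 0 by rewrite gt_eqF.
  have D : is_derive t 1 (fun x : R => x^-1) (- t^-1 ^+ 2).
    apply: (is_derive_eq (is_deriveV tn (is_derive_id (t : R^o) 1))).
    by rewrite -[_ *: _]/(_ * _) mulr1 exprVn.
  have D1 := is_derive1_comp (is_derive_expR _) (is_deriveN D).
  have D2 := is_deriveX k D.
  have D3 := is_deriveM D2 D1.
  have XE m (x : R) : ((fun x : R => x^-1) ^+ m) x = x^-1 ^+ m.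
    by elim: m => // m IH; rewrite !exprS -IH.
  have H : \near t, ((fun x : R => x^-1) ^+ k * (expR \o (fun x : R => - x^-1))) t = flat k t.
    near=> x; rewrite /flat (_ : 0 < x); last by near: x; apply: lt_nbhsr.
    by rewrite -XE.
  apply: (is_derive_eq (near_eq_is_derive H D3)).
  transitivity (t^-1 ^+ k * (expR (- t^-1) * t^-1 ^+ 2) + expR (- t^-1) * (k%:R * t^-1 ^+ k.-1 * - t^-1 ^+ 2)).
    by rewrite -![_ *: _]/(_ * _) XE opprK.
  rewrite /flat t0.
  move: (expR (- t^-1)) (t^-1) => u v; case: (k) => [|j] /=; first by ring.
  by rewrite !exprS; ring.
- have E j : flat j 0 = 0 :> R by rewrite /flat ltxx.
  rewrite !E mulr0 subr0.
  (* By [flat_le] the difference quotient is at most [(k + 2)! |h|]. *)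
  have C : h^-1 *: ((flat k \o shift 0) (h *: (1 : R)) - flat k 0) @[h --> (0 : R)^'] --> (0 : R).
    apply: norm_cvg0.
    apply: (@squeeze_cvgr _ _ _ _ (fun=> 0) (fun h => (k.+2)`!%:R * `|h|)).
    + near=> h; rewrite normr_ge0/= addr0 E subr0 -![_ *: _]/(_ * _) mulr1.
      have hn : h != 0 by near: h; exact: nbhs_dnbhs_neq.
      rewrite normrM normfV ler_pdivrMl ?normr_gt0// ger0_norm ?flat_ge0//.
      by rewrite mulrCA -expr2 real_normK ?num_real// flat_le.
    + exact: cvg_cst.
    + rewrite -[X in _ --> X](mulr0 (k.+2)`!%:R); apply: cvgM; first exact: cvg_cst.
      by apply: cvg_within_filter; have := @norm_continuous _ R 0; rewrite /continuous_at normr0.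
  apply: DeriveDef; first by apply/cvg_ex; exists 0.
  exact: cvg_lim C.
Unshelve. all: by end_near. Qed.

Lemma continuous_flat k : continuous (flat k).
Proof. exact: is_derive_continuous (is_derive_flat k). Qed.

End flat_functions.

(** * Bumps as test functions and their transforms *)

Section test_functions.
Variables (R : realType) (n : nat).
Notation V := 'rV[R]_n.

(* A class of smooth functions closed under partial derivatives: the derivative
   of [flat k] is a combination of [flat k.+1] and [flat k.+2]. *)
Inductive smooth_expr : (V -> R) -> Prop :=
| smooth_cst c : smooth_expr (fun=> c)
| smooth_coord i : smooth_expr (fun x => x ord0 i)
| smooth_add f g : smooth_expr f -> smooth_expr g -> smooth_expr (f + g)
| smooth_mul f g : smooth_expr f -> smooth_expr g -> smooth_expr (f * g)
| smooth_flat k g : smooth_expr g -> smooth_expr (flat k \o g).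

Lemma smooth_expr_diff f : smooth_expr f ->
  (forall x, differentiable f x) /\ (forall i, smooth_expr (partial i f)).
Proof.
elim=> [c|j|{}f g Sf [df pf] Sg [dg pg]|{}f g Sf [df pf] Sg [dg pg]|k g Sg [dg pg]].
- split=> [x|i]; first exact: differentiable_cst.
  rewrite (_ : partial i _ = fun=> 0); first exact: smooth_cst.
  by apply/funext => x; exact: derive_cst.
- split=> [x|i]; first exact: differentiable_coord.
  rewrite (_ : partial i _ = fun=> (delta_mx ord0 i : V) ord0 j); first exact: smooth_cst.
  apply/funext => x; rewrite /partial.
  rewrite /derive; apply: cvg_lim => //; apply: cvg_near_cst; near=> h.
  rewrite /= !mxE addrK -[_ *: _]/(_ * _) mulKf//.
  by near: h; exact: nbhs_dnbhs_neq.
- split=> [x|i]; first exact: differentiableD.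
  rewrite (_ : partial i _ = partial i f + partial i g); first exact: smooth_add.
  by apply/funext => x; rewrite /partial deriveD//; exact: diff_derivable.
- split=> [x|i]; first exact: differentiableM.
  rewrite (_ : partial i _ = f * partial i g + g * partial i f).
    by apply: smooth_add; apply: smooth_mul.
  by apply/funext => x; rewrite /partial deriveM//; exact: diff_derivable.
- have dflat (j : nat) t : differentiable (@flat R j) t.
    by apply/derivable1_diffP; case: (is_derive_flat j t).
  split=> [x|i]; first exact: differentiable_comp.
  rewrite (_ : partial i _ = ((flat k.+2 \o g) + (fun=> - k%:R) * (flat k.+1 \o g)) * partial i g).
    apply: smooth_mul => //; apply: smooth_add; first exact: smooth_flat.
    by apply: smooth_mul; [exact: smooth_cst|exact: smooth_flat].
  apply/funext => x; rewrite /partial deriveE; last exact: differentiable_comp.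
  rewrite diff_comp//= -deriveE// -deriveE//.
  (* The direction here is the scalar [partial i g x]; seen as a multiple of 1, linearity of the
     differential yields the ordinary derivative of [flat k]. *)
  rewrite -[X in 'D_X _ _]mulr1.
  rewrite deriveE// -[_ * 1]/(_ *: 1) linearZ -deriveE//= (@derive_val _ _ _ _ _ _ _ (is_derive_flat k (g x))).
  by rewrite -[_ *: _]/(_ * _) mulrC mulNr.
Unshelve. all: by end_near. Qed.

Lemma smooth_exprP f : smooth_expr f -> smooth f.
Proof.
move=> Sf l; have : smooth_expr (foldr (@partial R n) f l).
  by elim: l => [|i l IH] //=; exact: (smooth_expr_diff IH).2.
by move=> /smooth_expr_diff[].
Qed.

Lemma smooth_sum (I : Type) (s : seq I) (F : I -> V -> R) :
  (forall i, smooth_expr (F i)) -> smooth_expr (fun x => \sum_(i <- s) F i x).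
Proof.
move=> SF; elim: s => [|i s IH].
  by under eq_fun do rewrite big_nil; exact: smooth_cst.
under eq_fun do rewrite big_cons.
exact: smooth_add (SF i) IH.
Qed.

(** The usual bump [exp (-1 / (r^2 - |x|^2))]. It uses the polynomial [dot x x], as [enorm] is not
    smooth at 0; [r] may have either sign. *)
Definition bump (r : R) (x : V) : R := flat 0 (r ^+ 2 - dot x x).

Lemma smooth_bump (r : R) (a : V) : smooth (fun x => bump r (a - x)).
Proof.
apply: smooth_exprP; apply: (@smooth_flat 0 (fun x => r ^+ 2 - dot (a - x) (a - x))).
rewrite (_ : (fun x => _) = (fun=> r ^+ 2) + (fun=> -1) * (fun x => dot (a - x) (a - x))).
  apply: smooth_add; first exact: smooth_cst.
  apply: smooth_mul; first exact: smooth_cst.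
  apply: smooth_sum => i.
  have S : smooth_expr (fun x : V => (a - x) ord0 i).
    rewrite (_ : (fun x => _) = (fun=> a ord0 i) + (fun=> -1) * (fun x : V => x ord0 i)).
      apply: smooth_add; first exact: smooth_cst.
      by apply: smooth_mul; [exact: smooth_cst|exact: smooth_coord].
    by apply/funext => x; rewrite !mxE -[RHS]/(_ + _ * _) mulN1r.
  exact: (smooth_mul S S).
by apply/funext => x; rewrite -[RHS]/(_ + _ * _) mulN1r.
Qed.

Lemma bump_ge0 r x : 0 <= bump r x. Proof. exact: flat_ge0. Qed.

Lemma bump_gt0 r x : enorm x < `|r| -> 0 < bump r x.
Proof.
move=> xr; have t0 : 0 < r ^+ 2 - dot x x.
  rewrite subr_gt0 -enorm_sqr -[ltRHS]real_normK ?num_real// ltrXn2r ?nnegrE ?enorm_ge0//.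
by rewrite /bump /flat t0 expr0 mul1r expR_gt0.
Qed.

Lemma bump_eq0 r x : `|r| <= enorm x -> bump r x = 0.
Proof.
move=> rx; rewrite /bump /flat ltNge (_ : _ <= 0)//.
rewrite subr_le0 -enorm_sqr -[leLHS]real_normK ?num_real// lerXn2r ?nnegrE ?enorm_ge0//.
Qed.

Lemma bumpN r x : bump r (- x) = bump r x.
Proof. by rewrite /bump /dot; congr flat; congr (_ - _); apply: eq_bigr => i _; rewrite !mxE mulrNN. Qed.

Lemma test_function_bump (r : R) (a : V) : test_function (fun x => bump r (a - x)).
Proof.
split; first exact: smooth_bump.
(* A closed cube around [a] containing the support. *)
pose K := [set v : V | forall i, `[a ord0 i - `|r|, a ord0 i + `|r|]%classic (v ord0 i)].
have cK : compact K.
  by apply: (@rV_compact _ n (fun i => `[a ord0 i - `|r|, a ord0 i + `|r|]%classic)) => i; exact: segment_compact.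
have clK : closed K by apply: compact_closed => //; exact: norm_hausdorff.
apply: (subclosed_compact _ cK); first exact: closed_closure.
rewrite closureE => x; apply; split => // y /= By i.
have : enorm (a - y) < `|r| by rewrite ltNge; apply: contra By => /bump_eq0 ->.
move=> /(le_lt_trans (coord_le_enorm _ i)); rewrite !mxE ltr_norml => /andP[h1 h2].
by rewrite /= in_itv/=; apply/andP; split; lra.
Qed.

Lemma measurable_bump r (a : V) : measurable_fun [set: V] (fun x : V => bump r (a - x)).
Proof.
apply: (@measurableT_comp _ _ _ _ _ _ (@flat R 0)).
  apply: continuous_measurable_fun; exact: continuous_flat.
apply: measurable_funB => //.
by apply: measurable_dot; exact: measurable_rV_refl.
Qed.

Notation mu := (lebesgue_rV R n).

Lemma L12_refl (f : V -> R) (a : V) : L12 f -> L12 (fun x => f (a - x)).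
Proof.
move=> [If [mf If2]]; split; first exact: (Rint_refl a If).1.
split; last exact: (Rint_refl a If2).1.
exact: L1_measurable (Rint_refl a If).1.
Qed.

Lemma bump_L12 (r : R) : L12 (bump r).
Proof.
have mB := @measurable_enorm_ball R n `|r|.
have mb : measurable_fun setT (bump r).
  rewrite (_ : bump r = fun x => bump r (0 - x)); first exact: measurable_bump.
  by apply/funext => x; rewrite sub0r bumpN.
(* The constant is [flat_le] for [k = 0] at an argument between 0 and [r ^+ 2]. *)
apply: (L12_le mb _ (L12Z (2 * (r ^+ 2) ^+ 2) (L12_indic mB (@enorm_ball_lty R n `|r|)))).
move=> x; rewrite ger0_norm ?bump_ge0// indicE.
have [xr|xr] := leP (enorm x) `|r|; last by rewrite bump_eq0 ?normr_ge0// ltW.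
have R2 : 0 <= r ^+ 2 by exact: sqr_ge0.
have R0 : 0 <= 2 * (r ^+ 2) ^+ 2 by apply: mulr_ge0 => //; exact: sqr_ge0.
rewrite mem_set//= mulr1 (ger0_norm R0).
rewrite /bump; have [t0|t0] := ltP 0 (r ^+ 2 - dot x x); last by rewrite /flat ltNge t0.
apply: (le_trans (flat_le _ _)); rewrite ler_wpM2l// lerXn2r ?nnegrE//; first exact: ltW.
by rewrite gerBl dotxx_ge0.
Qed.

Definition bump_hat (r : R) (xi : V) := \int[mu]_x (bump r x * cos (2 * pi * dot x xi)).

Lemma measurable_trig_dot (xi : V) (u : R -> R) : continuous u ->
  measurable_fun setT (fun x : V => u (2 * pi * dot x xi)).
Proof.
move=> cu; apply: measurableT_comp; first exact: continuous_measurable_fun cu.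
by apply: measurable_funM => //; exact: measurable_dotl.
Qed.

Lemma L1_bump_trig (r : R) (xi : V) (u : R -> R) : continuous u -> (forall t, `|u t| <= 1) ->
  L1 mu (fun x => bump r x * u (2 * pi * dot x xi)).
Proof.
move=> cu u1; under [X in L1 _ X]eq_fun do rewrite mulrC.
apply: (@L1_bounded _ _ _ _ _ _ 1) => //; last exact: (bump_L12 r).1.
exact: measurable_trig_dot.
Qed.

Lemma cos_norm_le1 (t : R) : `|cos t| <= 1.
Proof. by rewrite ler_norml cos_geN1 cos_le1. Qed.

Lemma sin_norm_le1 (t : R) : `|sin t| <= 1.
Proof. by rewrite ler_norml sin_geN1 sin_le1. Qed.

(** Expanding [cas] of the difference gives [cas] times a cosine plus a remainder times a sine; the
    sine integral is 0 as the bump is even. So the reflected translate acts by a factor. *)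
Lemma hartley_bump (r : R) (a xi : V) :
  hartley (fun x => bump r (a - x)) xi = bump_hat r xi * cas (2 * pi * dot a xi).
Proof.
have Ic := L1_bump_trig r xi (@continuous_cos R) cos_norm_le1.
have Is := L1_bump_trig r xi (@continuous_sin R) sin_norm_le1.
have S0 : \int[mu]_x (bump r x * sin (2 * pi * dot x xi)) = 0.
  (* Reflection through the origin changes the sign of this integral. *)
  have [_ E] := Rint_refl 0 Is.
  have EN : \int[mu]_x (bump r (0 - x) * sin (2 * pi * dot (0 - x) xi)) =
     -1 * \int[mu]_x (bump r x * sin (2 * pi * dot x xi)).
    rewrite -RintegralZl//; congr Rintegral; apply/funext => x.
    rewrite sub0r bumpN (_ : dot (- x) xi = - dot x xi).
      by rewrite mulrN sinN; ring.
    by rewrite /dot -sumrN; apply: eq_bigr => i _; rewrite !mxE mulNr.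
  by rewrite EN in E; lra.
have IT : L1 mu (fun x => bump r x * cas (2 * pi * dot (a - x) xi)).
  under [X in L1 _ X]eq_fun do rewrite mulrC.
  apply: (@L1_bounded _ _ _ _ _ _ 2) => //; last exact: (bump_L12 r).1.
    by apply: measurable_cas_dot; [exact: measurable_rV_refl|exact: measurable_cst].
  by move=> x; exact: cas_le2.
have [_ E] := Rint_refl a IT.
rewrite /hartley; transitivity (\int[mu]_x (bump r (a - x) * cas (2 * pi * dot (a - (a - x)) xi))).
  by congr Rintegral; apply/funext => x; rewrite subKr.
rewrite E.
transitivity (\int[mu]_x (cas (2 * pi * dot a xi) * (bump r x * cos (2 * pi * dot x xi)) +
   (sin (2 * pi * dot a xi) - cos (2 * pi * dot a xi)) * (bump r x * sin (2 * pi * dot x xi)))).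
  congr Rintegral; apply/funext => x; rewrite dotBl mulrBr /cas cosB sinB.
  by move: (cos _) (sin _) (cos _) (sin _) (bump _ _) => *; ring.
rewrite RintegralD//; [|exact: L1Z|exact: L1Z].
by rewrite !RintegralZl// S0 mulr0 addr0 mulrC.
Qed.

Lemma box_gt0 (a b : V) : (forall i, a ord0 i < b ord0 i) -> (0 < mu (box a b))%E.
Proof.
move=> ab; rewrite (@lebesgue_rV_box R n (fun i => `]a ord0 i, b ord0 i]%classic))//.
under eq_bigr do rewrite lebesgue_measure_itv/= lte_fin ab -EFinB.
by rewrite prodEFin lte_fin; apply: prodr_gt0 => i _; rewrite subr_gt0.
Qed.

Lemma ae_box_ex (a b : V) (P : V -> Prop) : (forall i, a ord0 i < b ord0 i) ->
  {ae mu, forall x, P x} -> exists2 x, box a b x & P x.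
Proof.
move=> ab [N [mN N0 sN]]; apply: contrapT => H.
have : box a b `<=` N.
  move=> x Bx; apply: sN => /= Px; apply: H; by exists x.
move=> BN; have : (mu (box a b) <= mu N)%E.
  by apply: le_measure; rewrite ?inE//; exact: measurable_box.
by apply/negP; rewrite -ltNge [ltLHS]N0 box_gt0.
Qed.

(** On the support [|x.xi| <= n r k < 1/4], so the angle stays below a quarter period and the cosine
    is positive. *)
Lemma bump_hat_gt0 (r k : R) (xi : V) : 0 < r -> 4 * (n%:R * (r * k)) < 1 ->
  (forall i, `|xi ord0 i| <= k) -> 0 < bump_hat r xi.
Proof.
move=> r0 rk xik.
have Ic := L1_bump_trig r xi (@continuous_cos R) cos_norm_le1.
have cpos (x : V) : enorm x < r -> 0 < cos (2 * pi * dot x xi).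
  move=> xr; apply: cos_gt0_pihalf; rewrite -ltr_norml.
  have D : `|dot x xi| <= n%:R * (r * k).
    rewrite (le_trans (ler_norm_sum _ _ _))//.
    rewrite [leRHS](_ : _ = \sum_(i < n) (r * k)); last by rewrite sumr_const card_ord mulr_natl.
    apply: ler_sum => i _; rewrite normrM ler_pM//.
    by rewrite (le_trans (coord_le_enorm x i))// ltW.
  have p0 := pi_gt0 R; rewrite !normrM (ger0_norm (ltW p0)) ger0_norm//.
  have : pi * `|dot x xi| <= pi * (n%:R * (r * k)) by rewrite ler_wpM2l// ltW.
  by have : pi * (4 * (n%:R * (r * k))) < pi * 1; [rewrite ltr_pM2l|lra].
have pos x : 0 <= bump r x * cos (2 * pi * dot x xi).
  have [xr|xr] := ltP (enorm x) r; first by rewrite mulr_ge0 ?bump_ge0// ltW// cpos.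
  by rewrite bump_eq0 ?mul0r// gtr0_norm.
rewrite lt_neqAle; apply/andP; split; last by apply: Rintegral_ge0 => x _; exact: pos.
 apply/eqP => /esym /(Rint_eq0_ae Ic pos) H.
(* The cube of half side [rho] has positive measure and lies in the ball of radius [r], as
   [n < (n + 1)^2]; the integrand cannot vanish almost everywhere on it. *)
pose rho := r / n.+1%:R.
have rho0 : 0 < rho by rewrite divr_gt0.
have [|x Bx] := @ae_box_ex (const_mx (- rho)) (const_mx rho) _ _ H.
  by move=> i; rewrite !mxE; lra.
have xr : enorm x < r.
  rewrite -(@ltr_pXn2r _ 2) ?nnegrE ?enorm_ge0// ?ltW// enorm_sqr.
  apply: (@le_lt_trans _ _ (n%:R * rho ^+ 2)).
    rewrite /dot [leRHS](_ : _ = \sum_(i < n) rho ^+ 2); last by rewrite sumr_const card_ord mulr_natl.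
    apply: ler_sum => i _; have := Bx i; rewrite /= in_itv/= !mxE => /andP[h1 h2].
    have h : `|x ord0 i| <= rho by rewrite ler_norml (ltW h1).
    by rewrite -expr2 -[leLHS]real_normK ?num_real// lerXn2r ?nnegrE// ltW.
  rewrite /rho expr_div_n mulrA ltr_pdivrMr ?exprn_gt0// mulrC ltr_pM2l ?exprn_gt0//.
  by rewrite -natrX ltr_nat expnS; lia.
have := mulr_gt0 (bump_gt0 (r := r) (x := x) _) (cpos x xr).
by move=> + E; rewrite E ltxx gtr0_norm// => /(_ xr).
Qed.

End test_functions.

(** * Volumes of spherical shells *)

Section shells.
Variables (R : realType) (n : nat).
Notation mu := (lebesgue_rV R n).
Notation V := 'rV[R]_n.
Implicit Types (x y xi : V) (a b t : R).

Lemma dotZZ t x : dot (t *: x) (t *: x) = t ^+ 2 * dot x x.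
Proof. by rewrite /dot mulr_sumr; apply: eq_bigr => i _; rewrite !mxE; ring. Qed.

Lemma enormZ t x : enorm (t *: x) = `|t| * enorm x.
Proof. by rewrite /enorm dotZZ sqrtrM ?sqr_ge0// sqrtr_sqr. Qed.

Lemma measurable_scale t : measurable_fun setT (fun x : V => t *: x).
Proof.
apply/measurable_fun_rVP => i; under eq_fun do rewrite !mxE.
by apply: measurable_funM => //; exact: measurable_coord.
Qed.

Definition lebesgue_scale t : {measure set V -> \bar R}.
Proof.
by refine (pushforward mu (fun x : V => t *: x) : {measure set V -> \bar R}); exact: measurable_scale.
Defined.

(** Two measures that agree on boxes coincide; a box scales side by side. *)
Lemma lebesgue_rV_scale (t : {posnum R}) (A : set V) : measurable A ->
  ((t%:num ^+ n)%:E * mu A)%E = mu [set x | A (t%:num^-1 *: x)].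
Proof.
move=> mA; have tn0 : 0 <= t%:num ^+ n by rewrite exprn_ge0.
pose r : {nonneg R} := NngNum tn0.
transitivity (mscale r mu A); first by [].
transitivity (lebesgue_scale t%:num^-1 A); last by [].
move: A mA; apply: (measure_unique (@boxes R n) (fun k => box (const_mx (- k%:R)) (const_mx k%:R))).
- exact: measurable_boxesE.
- exact: boxes_setI.
- by move=> k; eexists; eexists.
- exact: bigcup_box.
- move=> _ [b [c ->]]; rewrite /= /pushforward /mscale /=.
  have t0 : 0 < t%:num by [].
  rewrite (_ : _ @^-1` _ = [set v : V | forall i, `]t%:num * b ord0 i, t%:num * c ord0 i]%classic (v ord0 i)]).
    rewrite [RHS](@lebesgue_rV_box R n (fun i => `]t%:num * b ord0 i, t%:num * c ord0 i]%classic))//.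
    rewrite [X in (_ * X)%E](@lebesgue_rV_box R n (fun i => `]b ord0 i, c ord0 i]%classic))//.
    rewrite [X in (X%:E * _)%E](_ : _ = \prod_(i < n) t%:num); last by rewrite prodr_const card_ord.
    rewrite -prodEFin -big_split/=; apply: eq_bigr => i _.
    rewrite !lebesgue_measure_itv/= !lte_fin ltr_pM2l//.
    by case: ifP => _; rewrite ?mule0// -!EFinB -EFinM mulrBr.
  apply/seteqP; split=> v /= H i; have := H i; rewrite /= !in_itv/= !mxE.
    by rewrite ltr_pdivlMl// ler_pdivrMl.
  by rewrite ltr_pdivlMl// ler_pdivrMl.
- move=> k; rewrite /= /mscale /=.
  by rewrite lte_mul_pinfty// ?ge0_fin_numE ?box_lty// lee_fin.
Qed.

Definition ball_volume : R := fine (mu [set x | enorm x <= 1]).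

Lemma ball_volumeE : (ball_volume%:E = mu [set x | (enorm x <= 1)%R])%E.
Proof. by rewrite fineK// ge0_fin_numE// enorm_ball_lty. Qed.

Lemma ball_volume_gt0 : 0 < ball_volume.
Proof.
rewrite -lte_fin ball_volumeE.
have n0 : 0 < n.+1%:R^-1 :> R by [].
(* This cube lies in the unit ball: [n] squares, each at most [1 / (n + 1)], add up to at most 1. *)
apply: (@lt_le_trans _ _ (mu (box (const_mx (- n.+1%:R^-1)) (const_mx n.+1%:R^-1)))).
  by apply: box_gt0 => i; rewrite !mxE (lt_trans _ n0)// oppr_lt0.
apply: le_measure; rewrite ?inE; [exact: measurable_box|exact: measurable_enorm_ball|].
move=> x Bx /=; rewrite -(@ler_pXn2r _ 2) ?nnegrE ?enorm_ge0// enorm_sqr expr1n.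
apply: (@le_trans _ _ (\sum_(i < n) n.+1%:R^-1)).
  apply: ler_sum => i _; have := Bx i; rewrite /= in_itv/= !mxE => /andP[h1 h2].
  have h : `|x ord0 i| <= n.+1%:R^-1 by rewrite ler_norml (ltW h1).
  rewrite -expr2 -real_normK ?num_real// expr2.
  apply: (le_trans (ler_wpM2l _ h)) => //; apply: (le_trans (ler_wpM2r _ h)) => //.
  by rewrite -expr2 ler_piMr// invf_le1// ler1n.
by rewrite sumr_const card_ord -[leLHS]mulr_natl ler_pdivrMr ?ltr0n// mul1r ler_nat.
Qed.

Lemma enorm_ball_volume t : 0 < t -> mu [set x | enorm x <= t] = (t ^+ n * ball_volume)%:E.
Proof.
move=> t0; rewrite EFinM ball_volumeE.
have := lebesgue_rV_scale (PosNum t0) (@measurable_enorm_ball R n 1) => /= ->.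
congr (mu _); apply/seteqP; split=> x /=; rewrite enormZ ger0_norm ?invr_ge0 ?(ltW t0)//.
  by rewrite ler_pdivrMl// mulr1.
by rewrite ler_pdivrMl// mulr1.
Qed.

Definition shell a b : set V := [set x | a < enorm x <= b].

Lemma shellE a b : shell a b = [set x | enorm x <= b] `\` [set x | enorm x <= a].
Proof.
apply/seteqP; split=> x /=; first by move=> /andP[ax xb]; split => //; apply/negP; rewrite -ltNge.
by move=> [xb /negP ax]; apply/andP; split => //; rewrite ltNge.
Qed.

Lemma measurable_shell a b : measurable (shell a b).
Proof. by rewrite shellE; apply: measurableD; exact: measurable_enorm_ball. Qed.

Lemma shell_volume a b : 0 < a -> a <= b -> mu (shell a b) = ((b ^+ n - a ^+ n) * ball_volume)%:E.
Proof.
move=> a0 ab; have b0 := lt_le_trans a0 ab.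
rewrite shellE measureD; [|exact: measurable_enorm_ball|exact: measurable_enorm_ball|exact: enorm_ball_lty].
rewrite setIidr; last by move=> x /= /le_trans; apply.
have := enorm_ball_volume a0; have := enorm_ball_volume b0 => /= -> ->.
by rewrite -EFinB mulrBl.
Qed.

Lemma shell_lty a b : (mu (shell a b) < +oo)%E.
Proof.
apply: le_lt_trans (@enorm_ball_lty R n b); apply: le_measure; rewrite ?inE.
- exact: measurable_shell.
- exact: measurable_enorm_ball.
- by move=> x /andP[].
Qed.

(** A sphere sits in arbitrarily thin shells, whose volumes tend to 0. *)
Lemma ae_enorm_neq t : (0 < n)%N -> {ae mu, forall x, enorm x != t}.
Proof.
move=> n0; have [t0|t0|->] := ltgtP t 0.
- by apply: aeW => x; rewrite gt_eqF// (lt_le_trans t0)// enorm_ge0.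
- have mS : measurable [set x : V | enorm x = t].
    have := (@measurable_enorm R n) measurableT _ (measurable_set1 t); rewrite setTI.
    by congr measurable.
  exists [set x | enorm x = t]; split => //; last by move=> x /= /negP; rewrite negbK => /eqP.
  (* With [k.+2] the inner radius is positive already for [k = 0], as [shell_volume] requires. *)
  pose u (k : nat) : R := (t ^+ n - ((1 - k.+2%:R^-1) * t) ^+ n) * ball_volume.
  have le k : (mu [set x | enorm x = t] <= (u k)%:E)%E.
    have k1 : 0 < 1 - k.+2%:R^-1 :> R by rewrite subr_gt0 invf_lt1// ltr1n.
    rewrite -shell_volume ?mulr_gt0//; last first.
      by rewrite ler_piMl ?ltW// gtrBl.
    apply: le_measure; rewrite ?inE//; first exact: measurable_shell.
    move=> x /= xt; rewrite /shell /= xt lexx andbT mulrBl mul1r gtrBl.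
    by rewrite mulr_gt0 ?invr_gt0 ?ltr0n.
  have cu : u k @[k --> \oo] --> (0 : R).
    rewrite [X in _ --> X](_ : 0 = (t ^+ n - ((1 - 0) * t) ^+ n) * ball_volume); last first.
      by rewrite subr0 mul1r subrr mul0r.
    apply: cvgM; last exact: cvg_cst.
    apply: cvgB; first exact: cvg_cst.
    apply: (continuous_cvg _ (@exprn_continuous R n _)).
    apply: cvgM; last exact: cvg_cst.
    apply: cvgB; first exact: cvg_cst.
    have := @cvg_harmonic R; rewrite -(cvg_shiftS (@harmonic R)).
    exact.
  apply/eqP; rewrite eq_le measure_ge0 andbT.
  have cE : (u k)%:E @[k --> \oo] --> 0%:E by apply: cvg_EFin => //; exact: nearW.
  rewrite -[X in (_ <= X)%E](cvg_lim _ cE)//; apply: lime_ge; first by apply/cvg_ex; eexists; exact: cE.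
  exact: nearW.
(* The origin lies on a coordinate hyperplane, one existing since [n > 0]. *)
- have := @box_bnd_null R n 0 0; apply: filterS => x H.
  apply/eqP => x0; have [] := H (Ordinal n0); rewrite mxE => /eqP + _; apply.
  by apply/eqP; rewrite -normr_eq0 -(eqP (_ : enorm x == 0)) ?x0// eq_le -{1}x0 coord_le_enorm/=.
Qed.

(* The masses of g on shells that escape every point must tend to 0. *)
Lemma shell_nonintegrable (g : V -> R) (a b vol : nat -> R) (l : R) :
  L1 mu g -> (forall x, 0 <= g x) -> (forall k, 0 < a k) -> (forall k, a k <= b k) -> (forall k, 0 < vol k) ->
  (forall k, vol k <= b k ^+ n - a k ^+ n) ->
  (forall x, \1_(shell (a k) (b k)) x @[k --> \oo] --> (0 : R)) -> 0 < l ->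
  (forall k, {ae mu, forall x, shell (a k) (b k) x -> l / vol k <= g x}) -> False.
Proof.
move=> Ig g0 a0 ab v0 vle c0 l0 gl.
have mg := L1_measurable Ig.
have ms k := measurable_shell (a k) (b k).
have mi k : measurable_fun setT (\1_(shell (a k) (b k)) : V -> R) by exact: measurable_indic.
have C := (@Rint_cvg _ _ _ mu (fun k x => g x * \1_(shell (a k) (b k)) x) (fun=> 0)
  (fun x => `|g x|) (fun k => measurable_funM mg (mi k)) (measurable_cst _) _ _ (L1_norm Ig)).2.
have {}C : \int[mu]_x (g x * \1_(shell (a k) (b k)) x) @[k --> \oo] --> (0 : R).
  have := C; rewrite Rintegral_cst// mul0r; apply.
    by apply: aeW => x; rewrite -[X in _ --> X](mulr0 (g x)); apply: cvgM; [exact: cvg_cst|exact: c0].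
  move=> k x; rewrite normrM -[leRHS]mulr1 ler_wpM2l//.
  by rewrite indicE normr_nat lern1 leq_b1.
(* Height [l / vol k] on a shell of volume at least [vol k * ball_volume]: the mass does not depend
   on [k]. *)
have le k : l * ball_volume <= \int[mu]_x (g x * \1_(shell (a k) (b k)) x).
  have IgS : L1 mu (fun x => g x * \1_(shell (a k) (b k)) x).
    apply: L1_le (L1_norm Ig); first exact: measurable_funM.
    move=> x; rewrite normrM -[leRHS]mulr1 ler_wpM2l//.
    by rewrite indicE normr_nat lern1 leq_b1.
  have I1 : L1 mu (\1_(shell (a k) (b k)) : V -> R) by apply: L1_indic => //; exact: shell_lty.
  apply: (@le_trans _ _ (\int[mu]_x (l / vol k * \1_(shell (a k) (b k)) x))).
    rewrite RintegralZl// [X in _ <= _ * X](_ : _ = (b k ^+ n - a k ^+ n) * ball_volume); last first.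
      by rewrite /Rintegral integral_indic// setIT; have := shell_volume (a0 k) (ab k) => /= ->.
    rewrite -mulrA ler_wpM2l ?(ltW l0)// mulrA ler_peMl ?(ltW ball_volume_gt0)//.
    by rewrite ler_pdivlMl// mulr1.
  rewrite -lee_fin !EFin_Rint//; last exact: L1Z.
  apply: ae_ge0_le_integral => //.
  - by move=> x _; rewrite lee_fin mulr_ge0// divr_ge0// ltW.
  - by apply/measurable_EFinP; apply: measurable_funM.
  - by move=> x _; rewrite lee_fin mulr_ge0.
  - by apply/measurable_EFinP; apply: measurable_funM.
  - apply: filterS (gl k) => x H _; rewrite lee_fin indicE.
    by case: (boolP (_ \in _)) => [/set_mem /H|_]; rewrite ?mulr0// !mulr1.
have : l * ball_volume <= 0.
  rewrite -(cvg_lim _ C)//; apply: limr_ge; first by apply/cvg_ex; eexists; exact: C.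
  exact: nearW.
by rewrite leNgt mulr_gt0// ball_volume_gt0.
Qed.

End shells.

(** * The equation on the transform side *)

Section hartley_inversion.
Variables (R : realType) (n : nat).
Notation mu := (lebesgue_rV R n).
Notation V := 'rV[R]_n.
Implicit Types (f g G : V -> R) (x xi : V).

Lemma Rint_hartley_box G g (a b : V) : L1 mu G -> L1 mu g -> (forall x, hartley G x = g x) ->
  \int[mu]_x (G x * \1_(box a b) x) = \int[mu]_x (hartley g x * \1_(box a b) x).
Proof.
move=> IG Ig Gg.
have I1 : L1 mu (\1_(box a b) : V -> R) by apply: L1_indic; [exact: measurable_box|exact: box_lty].
have mH := measurable_hartley I1.
have IH : L1 mu (fun xi => hartley (\1_(box a b) : V -> R) xi * g xi).
  apply: L1_le (L1Z (2 * \int[mu]_x `|\1_(box a b) x|) (L1_norm Ig)).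
    by apply: measurable_funM => //; exact: L1_measurable Ig.
  by move=> x; rewrite normrM ler_wpM2r// hartley_le.
have := Rint_laplaceM_cvg IH; rewrite (_ : (fun k : nat => _) = (fun k : nat => \int[mu]_x
    (G x * \int[mu]_y (\1_(box a b) y * poisson_rV k.+1%:R^-1 (x - y))))); last first.
  apply/funext => k; rewrite -Rint_laplace_hartley2//.
  by congr Rintegral; apply/funext => x; rewrite Gg mulrA.
move=> C; have C' := Rint_poissonM_cvg (a := a) (b := b) IG.
rewrite -(cvg_lim _ C')// (cvg_lim _ C)//.
transitivity (\int[mu]_xi (g xi * hartley (\1_(box a b) : V -> R) xi)).
  by congr Rintegral; apply/funext => x; rewrite mulrC.
rewrite Rint_multiplication//.
by congr Rintegral; apply/funext => x; rewrite mulrC.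
Qed.

Lemma hartley_inversion G g : L1 mu G -> L1 mu g -> (forall x, hartley G x = g x) ->
  {ae mu, forall x, G x = hartley g x}.
Proof.
move=> IG Ig Gg.
have mh : measurable_fun setT (G \- hartley g).
  by apply: measurable_funB; [exact: L1_measurable IG|exact: measurable_hartley].
have I1 (a b : V) : L1 mu (\1_(box a b) : V -> R).
  by apply: L1_indic; [exact: measurable_box|exact: box_lty].
have IG1 (a b : V) : L1 mu (fun x => G x * \1_(box a b) x).
  apply: L1_le (L1_norm IG).
    by apply: measurable_funM; [exact: L1_measurable IG|exact: L1_measurable (I1 a b)].
  by move=> x; rewrite normrM -[leRHS]mulr1 ler_wpM2l// indicE normr_nat lern1 leq_b1.
have Ig1 (a b : V) : L1 mu (fun x => hartley g x * \1_(box a b) x).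
  apply: L1_le (L1Z (2 * \int[mu]_x `|g x|) (I1 a b)).
    by apply: measurable_funM; [exact: measurable_hartley|exact: L1_measurable (I1 a b)].
  by move=> x; rewrite normrM [X in _ * X]ger0_norm ?indicE// ler_wpM2r// hartley_le.
have E (a b : V) : (fun x => (G \- hartley g) x * \1_(box a b) x) =
    (fun x => G x * \1_(box a b) x) \- (fun x => hartley g x * \1_(box a b) x).
  by apply/funext => x /=; rewrite mulrBl.
suff : {ae mu, forall x, (G \- hartley g) x = 0} by apply: filterS => x /= /subr0_eq.
apply: ae0_box => // a b; rewrite E; first exact: L1B.
rewrite RintegralB; [|by []|exact: IG1|exact: Ig1].
by apply/eqP; rewrite subr_eq0; apply/eqP; exact: Rint_hartley_box.
Qed.

End hartley_inversion.

(** * From the weak equation to [q h = c] almost everywhere *)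

Section weak_solution.
Variables (R : realType) (n : nat).
Notation mu := (lebesgue_rV R n).
Notation V := 'rV[R]_n.
Implicit Types (f g h : V -> R) (x a xi : V) (r s : R).

Lemma Re_subC_Im_scale (t : R) (z : R[i]) :
  complex.Re (t%:C%C * z) - complex.Im (t%:C%C * z) = t * (complex.Re z - complex.Im z).
Proof. by case: z => u v /=; ring. Qed.

Lemma frac_laplacian_hartley s f g : frac_laplacian s f g ->
  exists h k, [/\ hartleyL2 f h, hartleyL2 g k &
    {ae mu, forall xi, k xi = (2 * pi * enorm xi) `^ (2 * s) * h xi}].
Proof.
move=> [F [G [fF gG GF]]].
exists (fun xi => complex.Re (F xi) - complex.Im (F xi)).
exists (fun xi => complex.Re (G xi) - complex.Im (G xi)).
split; [exact: fourierL2_hartleyL2|exact: fourierL2_hartleyL2|].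
by apply: filterS GF => xi ->; rewrite Re_subC_Im_scale.
Qed.

Lemma Hs_hartley s f : Hs s f -> exists2 h, hartleyL2 f h &
  sqL1 mu (fun xi => (1 + enorm xi ^+ 2) `^ (s / 2) * h xi).
Proof.
move=> [F fF [WR WI]]; exists (fun xi => complex.Re (F xi) - complex.Im (F xi)).
  exact: fourierL2_hartleyL2.
have := sqL1B (sqL1_Lfun WR) (sqL1_Lfun WI).
by congr sqL1; apply/funext => xi; rewrite -Re_subC_Im_scale.
Qed.

Lemma bump_refl_L12 r a : L12 (fun x : V => bump r (a - x)).
Proof. exact/L12_refl/bump_L12. Qed.

Lemma dot0v x : dot 0 x = 0.
Proof. by rewrite /dot big1// => i _; rewrite mxE mul0r. Qed.

Lemma bump_hatE r : bump_hat r = hartley (fun x : V => bump r (0 - x)).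
Proof.
by apply/funext => xi; rewrite hartley_bump dot0v mulr0 /cas cos0 sin0 addr0 mulr1.
Qed.

Lemma measurable_bump_hat r : measurable_fun setT (@bump_hat R n r).
Proof. by rewrite bump_hatE; apply: measurable_hartley; case: (bump_refl_L12 r 0). Qed.

Lemma hartleyL2_bump r a h : hartleyL2 (fun x => bump r (a - x)) h ->
  {ae mu, forall xi, h xi = bump_hat r xi * cas (2 * pi * dot a xi)}.
Proof.
move=> H; have := hartleyL2_L12 (bump_refl_L12 r a) H.
by apply: filterS => xi ->; rewrite hartley_bump.
Qed.

Lemma measurable_frac_symbol s : measurable_fun setT (fun xi : V => (2 * pi * enorm xi) `^ s).
Proof.
apply: (measurableT_comp (measurable_powR _)).
by apply: measurable_funM => //; exact: measurable_enorm.
Qed.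

(** The bump is tested in the form [x -> bump r (a - x)], whose value at the origin is [bump r a].
    By evenness this is [bump r (0 - a)], the function that [bump_hatE] transforms. *)
Lemma weak_solution_hartley s sigma omega (phi : V -> R) h :
  weak_solution s sigma omega phi -> hartleyL2 phi h ->
  forall r, let G := fun xi => (((2 * pi * enorm xi) `^ s) ^+ 2 + omega) * h xi * bump_hat r xi in
  L1 mu G /\ forall a, hartley G a = `|phi 0| `^ (2 * sigma) * phi 0 * bump r (0 - a).
Proof.
move=> [u phiu sol] phih r G.
have [h0 [hu [phih0 uhu huE]]] := frac_laplacian_hartley phiu.
have [_ [mh Ih] _ _] := phih.
have hE := hartleyL2_unique phih0 phih.
have mG : measurable_fun setT G.
  apply: measurable_funM; last exact: measurable_bump_hat.
  apply: measurable_funM => //; apply: measurable_funD => //.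
  by apply: measurable_funX; exact: measurable_frac_symbol.
have mGc a : measurable_fun setT (fun xi => G xi * cas (2 * pi * dot xi a)).
  by apply: measurable_funM => //; exact: measurable_cas_dot.
have key a : L1 mu (fun xi => G xi * cas (2 * pi * dot xi a)) /\
    hartley G a = `|phi 0| `^ (2 * sigma) * phi 0 * bump r (0 - a).
  have [v psiv eq] := sol _ (test_function_bump r a).
  have [hp [hv [psihp vhv hvE]]] := frac_laplacian_hartley psiv.
  have hpE := hartleyL2_bump psihp.
  have [_ shu _ _] := uhu; have [_ shv _ _] := vhv; have [_ shp _ _] := psihp.
  have Iuv := sqL1M shu shv; have Ihp := L1Z omega (sqL1M (conj mh Ih) shp).
  have Is := L1D Iuv Ihp.
  (* Each fractional Laplacian contributes [(2 pi |xi|)^s], giving the square in [G]; the [cas]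
     factor of the translate becomes the kernel at [a]. *)
  have E : {ae mu, forall xi, (hu xi * hv xi + omega * (h xi * hp xi)) =
      G xi * cas (2 * pi * dot xi a)}.
    near=> xi.
    have e1 : hu xi = (2 * pi * enorm xi) `^ (2 * (s / 2)) * h0 xi by near: xi.
    have e2 : hv xi = (2 * pi * enorm xi) `^ (2 * (s / 2)) * hp xi by near: xi.
    have e3 : hp xi = bump_hat r xi * cas (2 * pi * dot a xi) by near: xi.
    have e4 : h0 xi = h xi by near: xi.
    rewrite e1 e2 e3 e4 /G (dotC xi) (_ : 2 * (s / 2) = s); last by lra.
    by ring.
  split; first exact: ae_L1 (L1_measurable Is) (mGc a) E Is.
  rewrite /hartley -(ae_Rint_eq (L1_measurable Is) (mGc a) E).
  have -> : \int[mu]_x (hu x * hv x + omega * (h x * hp x)) = pairing u v + omega * pairing phi (fun x => bump r (a - x)).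
    rewrite /pairing (Plancherel uhu vhv) (Plancherel phih psihp).
    by rewrite RintegralD// RintegralZl//; exact: sqL1M.
  move: eq; rewrite subr0 sub0r bumpN => /eqP; rewrite subr_eq0 => /eqP ->//.
split; last by move=> a; exact: (key a).2.
(* At [a = 0] the kernel is 1, so [key] yields the integrability of [G] itself. *)
have := (key 0).1; congr (is_true (L1 _ _)); apply/funext => xi.
by rewrite dotC dot0v mulr0 /cas cos0 sin0 addr0 mulr1.
Unshelve. all: end_near.
Qed.

(** Inversion gives the equation times [bump_hat]; at each frequency some radius makes that factor
    positive, and it is cancelled. *)
Lemma weak_solution_symbol s sigma omega (phi : V -> R) h :
  weak_solution s sigma omega phi -> hartleyL2 phi h ->
  {ae mu, forall xi, (((2 * pi * enorm xi) `^ s) ^+ 2 + omega) * h xi =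
    `|phi 0| `^ (2 * sigma) * phi 0}.
Proof.
move=> sol phih; set c := _ * phi 0.
(* Chosen so that [4 n r k = n k / (n k + 1) < 1], the condition of [bump_hat_gt0]; the [+ 1] also
   keeps the radius meaningful at [k = 0]. *)
pose r (k : nat) : R := (4 * (n%:R * k%:R + 1))^-1.
have r0 k : 0 < r k by rewrite invr_gt0 mulr_gt0// ltr_wpDl// mulr_ge0.
have H k : {ae mu, forall xi, (((2 * pi * enorm xi) `^ s) ^+ 2 + omega) * h xi * bump_hat (r k) xi =
    c * bump_hat (r k) xi}.
  have [IG HG] := weak_solution_hartley sol phih (r k).
  have [Ib _] := bump_refl_L12 (r k) 0.
  have := hartley_inversion IG (L1Z c Ib) HG.
  by apply: filterS => xi ->; rewrite hartleyZ// bump_hatE.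
(* Countably many radii share one null set, so the radius may depend on [xi]. *)
have {}H := ae_foralln H.
apply: filterS H => xi H.
pose k := Num.truncn (enorm xi).
have p0 : 0 < bump_hat (r k.+1) xi.
  apply: (@bump_hat_gt0 _ _ _ k.+1%:R) => //.
    rewrite /r invfM; rewrite [X in X < _](_ : _ = n%:R * k.+1%:R / (n%:R * k.+1%:R + 1)).
      by rewrite ltr_pdivrMr ?mul1r ?ltrDl// ltr_wpDl// mulr_ge0.
    by field; apply: lt0r_neq0; rewrite ltr_wpDl// mulr_ge0.
  move=> i; apply: (le_trans (coord_le_enorm _ _)).
  by apply/ltW; rewrite truncnS_gt.
exact: (mulIf (lt0r_neq0 p0) (H k.+1)).
Qed.

End weak_solution.

(** * Non-integrability at infinity, at the origin and near a sphere *)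

Section square_integrable_quotient.
Variables (R : realType) (n : nat).
Notation mu := (lebesgue_rV R n).
Notation V := 'rV[R]_n.
Variables (s omega c : R) (h : V -> R).
Hypotheses (n0 : (0 < n)%N) (s0 : 0 < s) (c0 : c != 0).

Let q (xi : V) : R := ((2 * pi * enorm xi) `^ s) ^+ 2 + omega.
Let W (xi : V) : R := (1 + enorm xi ^+ 2) `^ (s / 2).

Hypothesis Wh : sqL1 mu (fun xi => W xi * h xi).
Hypothesis qh : {ae mu, forall xi, q xi * h xi = c}.

Let W_ge1 xi : 1 <= W xi.
Proof.
apply: (@le_trans _ _ (1 `^ (s / 2))); first by rewrite powR1.
rewrite ge0_ler_powR ?nnegrE ?divr_ge0 ?(ltW s0) ?addr_ge0 ?sqr_ge0//.
by rewrite lerDl sqr_ge0.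
Qed.

(* Squaring the equation [q h = c] bounds [|h|] from below wherever [q] is
   bounded from above. *)
Lemma ae_quotient_lower (S : set V) (Q w : R) : 0 < Q ->
  (forall xi, S xi -> q xi ^+ 2 * w <= Q * W xi ^+ 2) ->
  {ae mu, forall xi, S xi -> c ^+ 2 * w / Q <= (W xi * h xi) ^+ 2}.
Proof.
move=> Q0 HS; apply: filterS qh => xi qc Sxi.
rewrite ler_pdivrMr// -qc.
have := ler_wpM2l (sqr_ge0 (h xi)) (HS _ Sxi).
by congr (_ <= _); ring.
Qed.

Lemma cvg_indic_shell (a b : nat -> R) (x : V) :
  (\forall k \near \oo, ~ shell (a k) (b k) x) ->
  \1_(shell (a k) (b k)) x @[k --> \oo] --> (0 : R).
Proof.
move=> H; apply: cvg_near_cst; apply: filterS H => k H.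
by rewrite indicE memNset.
Qed.

Lemma dyadic_volume (t : R) : 0 < t -> t ^+ n <= (2 * t) ^+ n - t ^+ n.
Proof.
move=> t0; rewrite exprMn lerBrDr -mulr2n -[leLHS]mulr_natl ler_wpM2r ?exprn_ge0 ?(ltW t0)//.
by rewrite -[leLHS]expr1 ler_eXn2l// ltr1n.
Qed.

Lemma powR_sqr_half (x : R) : 0 <= x -> (x ^+ 2) `^ (s / 2) = x `^ s.
Proof. by move=> x0; rewrite -powR_mulrn// -powRrM; congr (_ `^ _); field. Qed.

(** The weight of the Sobolev space dominates [|xi|^s], and it is at least 1, which absorbs
    [omega]. *)
Lemma symbol_le xi : `|q xi| <= ((2 * pi) `^ s ^+ 2 + `|omega|) * W xi ^+ 2.
Proof.
have p0 : 0 <= 2 * pi :> R by rewrite mulr_ge0// pi_ge0.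
have eW : enorm xi `^ s <= W xi.
  rewrite -powR_sqr_half ?enorm_ge0// /W.
  by rewrite ge0_ler_powR ?nnegrE ?divr_ge0 ?(ltW s0) ?addr_ge0 ?sqr_ge0// lerDr.
apply: (le_trans (ler_normD _ _)).
rewrite [leRHS]mulrDl lerD//; last first.
  by rewrite ler_peMr// exprn_ege1.
rewrite powRM ?enorm_ge0// ger0_norm ?sqr_ge0// exprMn ler_wpM2l ?sqr_ge0//.
by rewrite ler_pXn2r ?nnegrE ?powR_ge0// (le_trans ler01).
Qed.

(** Otherwise, on the dyadic shell of radius [a = 2^k], [(W h)^2 = c^2 W^2 / q^2] is at least of
    order [W^-2], hence of order [a^-n] when [2 s <= n], while the volume is of order [a^n]. *)
Lemma quotient_order_gt : n%:R / 2 < s.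
Proof.
rewrite ltNge; apply/negP => sn.
pose A : R := ((2 * pi) `^ s) ^+ 2 + `|omega|.
have A0 : 0 < A by rewrite ltr_wpDr// exprn_gt0// powR_gt0// mulr_gt0// pi_gt0.
have c20 : 0 < c ^+ 2 by rewrite exprn_even_gt0.
pose a (k : nat) : R := 2 ^+ k.
have a0 k : 0 < a k by rewrite exprn_gt0.
have B0 : 0 < A ^+ 2 * 3 ^+ n by rewrite mulr_gt0 ?exprn_gt0.
apply: (@shell_nonintegrable R n _ a (fun k => 2 * a k) (fun k => a k ^+ n)
  (c ^+ 2 / (A ^+ 2 * 3 ^+ n)) Wh.2).
- by move=> x; exact: sqr_ge0.
- exact: a0.
- by move=> k; rewrite ler_peMl ?ler1n// ltW.
- by move=> k; rewrite exprn_gt0.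
- by move=> k; exact: dyadic_volume.
- move=> x; apply: cvg_indic_shell.
  exists (Num.truncn (enorm x)).+1 => // k /= xk /andP[+ _]; apply/negP; rewrite -leNgt.
  apply: (le_trans (ltW (truncnS_gt _))); rewrite /a -natrX ler_nat.
  by apply: (leq_trans xk); apply/ltnW/ltn_expl.
- by rewrite divr_gt0.
move=> k; have := @ae_quotient_lower (shell (a k) (2 * a k)) (A ^+ 2 * 3 ^+ n * a k ^+ n) 1.
rewrite (_ : c ^+ 2 * 1 / _ = c ^+ 2 / (A ^+ 2 * 3 ^+ n) / a k ^+ n); last first.
  by rewrite mulr1 [in LHS]invfM mulrA.
apply; first by rewrite mulr_gt0// exprn_gt0.
move=> xi /andP[ax xb]; rewrite mulr1.
have W0 := lt_le_trans ltr01 (W_ge1 xi).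
have a1 : 1 <= a k by rewrite exprn_ege1// ler1n.
(* [1 + (2 a)^2 <= (3 a)^2] since [a >= 1], so [W^2 <= (3 a)^(2 s) <= (3 a)^n]. *)
have Wle : W xi ^+ 2 <= 3 ^+ n * a k ^+ n.
  have Y1 : 1 <= 3 * a k by lra.
  have Y0 := le_trans ler01 Y1.
  apply: (@le_trans _ _ ((3 * a k) `^ s ^+ 2)).
    rewrite ler_pXn2r ?nnegrE ?powR_ge0 ?(ltW W0)//.
    rewrite -powR_sqr_half// ge0_ler_powR ?nnegrE ?divr_ge0 ?addr_ge0 ?sqr_ge0 ?(ltW s0)//.
    have := enorm_ge0 xi; rewrite exprMn; nra.
  rewrite -exprMn -[leRHS]powR_mulrn// (_ : n%:R = n%:R / 2 * 2); last by field.
  by rewrite powRrM powR_mulrn ?powR_ge0// ler_pXn2r ?nnegrE ?powR_ge0// ler_powR.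
have := symbol_le xi; rewrite -/A => qA.
have {}qA : q xi ^+ 2 <= (A * W xi ^+ 2) ^+ 2.
  by rewrite -real_normK ?num_real// ler_pXn2r ?nnegrE// (le_trans _ qA).
apply: (le_trans qA).
have := ler_wpM2l (sqr_ge0 A) (ler_wpM2r (sqr_ge0 (W xi)) Wle).
by congr (_ <= _); ring.
Qed.

(** With [omega = 0], [(W h)^2] is at least of order [|xi|^(-4 s)] near the origin; the shells of
    radius [2^-k] detect this once [4 s >= n]. *)
Lemma quotient_omega_neq0 : omega != 0.
Proof.
apply/eqP => o0; have sn := quotient_order_gt.
have c20 : 0 < c ^+ 2 by rewrite exprn_even_gt0.
pose B : R := (4 * pi) `^ s ^+ 4.
have pi0 := pi_gt0 R.
have B0 : 0 < B by rewrite exprn_gt0// powR_gt0// mulr_gt0.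
pose t (k : nat) : R := (2 ^+ k)^-1.
have t0 k : 0 < t k by rewrite invr_gt0 exprn_gt0.
apply: (@shell_nonintegrable R n _ t (fun k => 2 * t k) (fun k => t k ^+ n) (c ^+ 2 / B) Wh.2).
- by move=> x; exact: sqr_ge0.
- exact: t0.
- by move=> k; rewrite ler_peMl ?ler1n// ltW.
- by move=> k; rewrite exprn_gt0.
- by move=> k; exact: dyadic_volume.
- move=> x; apply: cvg_indic_shell.
  have [x0|x0] := leP (enorm x) 0.
    by near=> k => /andP[+ _]; apply/negP; rewrite -leNgt (le_trans x0)// ltW.
  exists (Num.truncn (2 / enorm x)).+1 => // k /= xk /andP[_]; apply/negP; rewrite -ltNge.
  rewrite /t ltr_pdivrMr ?exprn_gt0// mulrC -ltr_pdivrMr//.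
  apply: (lt_le_trans (truncnS_gt _)); rewrite -natrX ler_nat.
  by apply: (leq_trans xk); apply/ltnW/ltn_expl.
- by rewrite divr_gt0.
move=> k; have := @ae_quotient_lower (shell (t k) (2 * t k)) (B * t k ^+ n) 1.
rewrite (_ : c ^+ 2 * 1 / _ = c ^+ 2 / B / t k ^+ n); last by rewrite mulr1 [in LHS]invfM mulrA.
apply; first by rewrite mulr_gt0// exprn_gt0.
move=> xi /andP[ax xb]; rewrite mulr1 /q o0 addr0 -exprM.
have x0 := enorm_ge0 xi.
apply: (@le_trans _ _ (B * t k ^+ n)); last first.
  by apply: ler_peMr; [apply/ltW; rewrite mulr_gt0// exprn_gt0|exact: exprn_ege1].
apply: (@le_trans _ _ (((4 * pi) * t k) `^ s ^+ 4)).
  rewrite ler_pXn2r ?nnegrE ?powR_ge0// ge0_ler_powR ?nnegrE ?mulr_ge0 ?(ltW s0) ?(ltW pi0) ?(ltW (t0 k))//.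
  by move: xb; nra.
rewrite powRM ?mulr_ge0 ?(ltW pi0) ?(ltW (t0 k))// exprMn ler_wpM2l ?(ltW B0)//.
rewrite -[leRHS]powR_mulrn ?(ltW (t0 k))// (_ : n%:R = n%:R / 4 * 4); last by field.
rewrite powRrM powR_mulrn ?powR_ge0// ler_pXn2r ?nnegrE ?powR_ge0//.
(* Here [t k <= 1], and [n / 4 <= s] follows from [quotient_order_gt]. *)
apply: ger_powR; last by have := ler0n R n; lra.
by rewrite t0 invf_le1 ?exprn_gt0// exprn_ege1// ler1n.
Unshelve. all: end_near.
Qed.

Lemma expR_sub1_le (x : R) : expR x - 1 <= x * expR x.
Proof.
have := expR_ge1Dx (- x); rewrite expRN => H.
have := ler_wpM2r (expR_ge0 x) H; rewrite mulVf ?gt_eqF ?expR_gt0//; lra.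
Qed.

Lemma symbol_root : omega < 0 -> exists2 rho : R, 0 < rho & ((2 * pi * rho) `^ s) ^+ 2 = - omega.
Proof.
move=> o0; have pi0 := pi_gt0 R.
have so0 : 0 < Num.sqrt (- omega) by rewrite sqrtr_gt0 oppr_gt0.
exists (Num.sqrt (- omega) `^ s^-1 / (2 * pi)).
  by rewrite divr_gt0 ?mulr_gt0// powR_gt0.
have p0 : 2 * pi != 0 :> R by rewrite mulf_neq0// gt_eqF.
rewrite mulrC divfK// -powRrM mulVf ?gt_eqF// powRr1 ?(ltW so0)//.
by rewrite sqr_sqrtr// oppr_ge0 ltW.
Qed.

(** For [omega < 0], [q] vanishes to first order on the sphere of radius [rho]. Shells of relative
    width [expR (e k)] turn powers into exponentials: [q <= - omega (exp (2 s e) - 1)] on them,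
    against a volume of order [e]. *)
Lemma quotient_omega_gt0 : 0 < omega.
Proof.
have [//|o0|o0] := ltgtP 0 omega; last by have := quotient_omega_neq0; rewrite -o0 eqxx.
exfalso.
have c20 : 0 < c ^+ 2 by rewrite exprn_even_gt0.
have pi0 := pi_gt0 R.
have [rho rho0 rhoE] := symbol_root o0.
pose e (k : nat) : R := k.+1%:R^-1.
have e0 k : 0 < e k by rewrite invr_gt0.
have e1 k : e k <= 1 by rewrite invf_le1// ler1n.
(* From [exp x - 1 <= x exp x] at [x = 2 s e], with [e <= 1] in the last exponential. *)
pose C : R := - omega * (2 * s * expR (2 * s)).
have C0 : 0 < C by rewrite !mulr_gt0 ?oppr_gt0// expR_gt0.
apply: (@shell_nonintegrable R n _ (fun=> rho) (fun k => rho * expR (e k))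
  (fun k => rho ^+ n * e k) (c ^+ 2 * rho ^+ n / C ^+ 2) Wh.2).
- by move=> x; exact: sqr_ge0.
- by move=> _.
- by move=> k; rewrite ler_peMr ?(ltW rho0)// -expR0 ler_expR ltW.
- by move=> k; rewrite mulr_gt0// exprn_gt0.
(* [exp (n e) - 1 >= n e >= e], as [n >= 1]. *)
- move=> k /=; rewrite exprMn -[X in _ - X]mulr1 -mulrBr ler_wpM2l ?exprn_ge0 ?(ltW rho0)//.
  rewrite -expRM_natl lerBrDl; apply: le_trans (expR_ge1Dx _).
  by rewrite lerD2l ler_peMl ?(ltW (e0 k))// ler1n.
- move=> x; apply: cvg_indic_shell.
  have [x0|x0] := leP (enorm x) rho.
    by near=> k => /andP[+ _]; apply/negP; rewrite -leNgt.
  have C1 : rho * expR (e k) @[k --> \oo] --> rho.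
    rewrite -[X in _ --> X]mulr1 -expR0; apply: cvgM; first exact: cvg_cst.
    by apply: continuous_cvg; [exact: continuous_expR|exact: cvg_harmonic].
  apply: filterS (cvgr_lt _ C1 _ x0) => k xk /andP[_].
  by apply/negP; rewrite -ltNge.
- exact: (divr_gt0 (mulr_gt0 c20 (exprn_gt0 _ rho0)) (exprn_gt0 _ C0)).
move=> k; have := @ae_quotient_lower (shell rho (rho * expR (e k))) (C ^+ 2 * e k) 1.
rewrite (_ : c ^+ 2 * 1 / _ = c ^+ 2 * rho ^+ n / C ^+ 2 / (rho ^+ n * e k)); last first.
  by field; rewrite !gt_eqF ?exprn_gt0.
apply; first by rewrite mulr_gt0// exprn_gt0.
move=> xi /andP[ax xb]; rewrite mulr1.
have x0 := enorm_ge0 xi.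
apply: (@le_trans _ _ (C ^+ 2 * e k)); last first.
  by apply: ler_peMr; [apply/ltW; rewrite mulr_gt0// exprn_gt0|exact: exprn_ege1].
have q0 : 0 <= q xi.
  rewrite /q -[omega]opprK -rhoE subr_ge0 ler_pXn2r ?nnegrE ?powR_ge0//.
  by rewrite ge0_ler_powR ?nnegrE ?mulr_ge0 ?(ltW s0) ?(ltW pi0) ?(ltW rho0)// ler_wpM2l ?mulr_ge0 ?(ltW pi0)// ltW.
have qC : q xi <= C * e k.
  apply: (@le_trans _ _ ((- omega) * (expR (2 * s * e k) - 1))).
    rewrite mulrBr mulr1 opprK /q lerD2r -rhoE.
    rewrite (_ : expR _ = (expR (e k) `^ s) ^+ 2); last first.
      by rewrite -expRM -expRM_natl; congr expR; ring.
    rewrite -exprMn -powRM ?mulr_ge0 ?(ltW pi0) ?(ltW rho0) ?expR_ge0//.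
    rewrite ler_pXn2r ?nnegrE ?powR_ge0// ge0_ler_powR ?nnegrE ?mulr_ge0 ?(ltW s0) ?(ltW pi0) ?(ltW rho0) ?expR_ge0//.
    by rewrite -[leRHS]mulrA; apply: ler_wpM2l xb; rewrite mulr_ge0 ?(ltW pi0).
  rewrite /C -!mulrA ler_wpM2l ?oppr_ge0 ?(ltW o0)//.
  apply: (le_trans (expR_sub1_le _)).
  rewrite -!mulrA !ler_wpM2l ?(ltW s0)//.
  rewrite mulrC ler_wpM2r ?(ltW (e0 k))// ler_expR.
  by rewrite mulrA ler_piMr ?mulr_ge0 ?(ltW s0).
apply: (@le_trans _ _ ((C * e k) ^+ 2)).
  by rewrite ler_pXn2r// nnegrE mulr_ge0 ?(ltW C0) ?(ltW (e0 k)).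
(* Giving away one factor [e k <= 1] leaves the order [1 / e k], which already balances the volume
   of the shell. *)
rewrite exprMn ler_wpM2l ?sqr_ge0// expr2 ler_piMl// ltW//.
Unshelve. all: end_near.
Qed.

End square_integrable_quotient.

(** * The constant [c] does not vanish *)

Section nonzero.
Variables (R : realType) (n : nat).
Notation mu := (lebesgue_rV R n).
Notation V := 'rV[R]_n.

(** Injectivity of the transform, by Plancherel for [f] paired with itself. *)
Lemma hartleyL2_ae_eq0 (f h : V -> R) : hartleyL2 f h -> {ae mu, forall x, h x = 0} ->
  {ae mu, forall x, f x = 0}.
Proof.
move=> fh h0; have [[mf If] [mh _] _ _] := fh.
have : {ae mu, forall x, f x ^+ 2 = 0}.
  apply: Rint_eq0_ae => //; first by move=> x; exact: sqr_ge0.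
  have := Plancherel fh fh; rewrite (_ : (fun x => f x * f x) = (fun x => f x ^+ 2)); last first.
    by apply/funext => x; rewrite expr2.
  move=> ->; rewrite (@ae_Rint_eq _ _ _ mu _ (fun=> 0)).
  - by rewrite Rintegral_cst// mul0r.
  - exact: measurable_funM.
  - exact: measurable_cst.
  - by apply: filterS h0 => x ->; rewrite mul0r.
by apply: filterS => x /eqP; rewrite sqrf_eq0 => /eqP.
Qed.

Lemma continuous_ae_eq0 (f : V -> R) : continuous f -> {ae mu, forall x, f x = 0} ->
  forall x, f x = 0.
Proof.
move=> cf f0 x; apply/eqP; apply/negPn/negP => fx.
have := cf x; rewrite /continuous_at => /cvgr_neq0 => /(_ fx) /nbhs_ballP[e /= e0 H].
(* A box inside the sup-norm ball where [f] is nonzero has positive measure, hence contains a zero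
   of [f]. *)
have [y Bxy fy] : exists2 y, box (x - const_mx (e / 2)) (x + const_mx (e / 2)) y & f y = 0.
  by apply: ae_box_ex f0 => i; rewrite !mxE; lra.
have : f y != 0.
  apply: H; split => // i j; rewrite ord1 /ball /=.
  have := Bxy j; rewrite /= in_itv/= !mxE => /andP[h1 h2].
  by rewrite ltr_norml; apply/andP; split; lra.
by rewrite fy eqxx.
Qed.

(** All zeros lie on the single sphere of radius [rho]. For [omega > 0] the square root defaults to
    0, but the argument starts from a zero of the symbol and stays valid. *)
Lemma ae_symbol_neq0 (s omega : R) : (0 < n)%N -> 0 < s ->
  {ae mu, forall xi : V, ((2 * pi * enorm xi) `^ s) ^+ 2 + omega != 0}.
Proof.
move=> n0 s0; have pi0 := pi_gt0 R.
pose rho : R := (Num.sqrt (- omega)) `^ s^-1 / (2 * pi).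
have sn0 : s != 0 by rewrite gt_eqF.
have := @ae_enorm_neq R n rho n0; apply: filterS => xi; apply: contra.
rewrite addr_eq0 => /eqP H.
rewrite /rho -H sqrtr_sqr ger0_norm ?powR_ge0// -powRrM divff//.
rewrite powRr1 ?mulr_ge0 ?(ltW pi0) ?enorm_ge0// mulrC mulKf//.
by rewrite mulf_neq0// (gt_eqF pi0).
Qed.

End nonzero.

Theorem proposition1 (R : realType) (n : nat) (s sigma omega : R)
    (phi : 'rV[R]_n -> R)
    (hn : (1 <= n)%N) (hs : 0 < s) (hsigma : 0 < sigma)
    (phiHs : Hs s phi) (phiC : continuous phi)
    (phi0 : exists x, phi x <> 0)
    (phi_sol : weak_solution s sigma omega phi) :
  (0 < omega /\ n%:R / 2 < s) \/ (omega < 0 /\ s < n%:R / 2).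
Proof.
have [h phih Wh] := Hs_hartley phiHs.
have qh := weak_solution_symbol phi_sol phih.
left; set c := _ * phi 0 in qh.
have [c0|c0] := eqVneq c 0; last first.
  by split; [exact: quotient_omega_gt0 Wh qh|exact: quotient_order_gt Wh qh].
have [x] := phi0; case; apply: continuous_ae_eq0 phiC _ x.
apply: (hartleyL2_ae_eq0 phih).
apply: filterS2 qh (ae_symbol_neq0 omega hn hs) => xi; rewrite c0 => /eqP.
by rewrite mulf_eq0 => /orP[/eqP ->|/eqP //]; rewrite eqxx.
Qed.
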